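(* Let $\mathbf H$ be the Kirchhoff Laplacian on the infinite metric graph $\mathcal G$, let $\lambda_0(\mathbf H)=\inf\sigma(\mathbf H)$ and $\lambda_0^{\mathrm{ess}}(\mathbf H)=\inf\sigma_{\mathrm{ess}}(\mathbf H)$, and let $\alpha(\mathcal G)$ and $\alpha_{\mathrm{ess}}(\mathcal G)$ be the isoperimetric constant and the isoperimetric constant at infinity of $\mathcal G$. Then $$\lambda_0(\mathbf H)\ \ge\ \tfrac14\,\alpha(\mathcal G)^2,\qquad \lambda_0^{\mathrm{ess}}(\mathbf H)\ \ge\ \tfrac14\,\alpha_{\mathrm{ess}}(\mathcal G)^2 .$$
   Context: Setting. $\mathcal G_d=(\mathcal V,\mathcal E)$ is an unoriented, connected, locally finite, simple graph with countably infinite vertex set $\mathcal V$ and edge set $\mathcal E$. Each edge $e$ has a length $|e|\in(0,\infty)$ and is identified with the interval $[0,|e|]$; gluing endpoints at common vertices gives the metric graph $\mathcal G=(\mathcal V,\mathcal E,|\cdot|)$. Let $\mathcal E_v$ be the set of edges incident to $v$ and $\deg_{\mathcal G}(v)=\#\mathcal E_v$. Standing assumptions: $\ell^\ast(\mathcal G):=\sup_{e\in\mathcal E}|e|<\infty$ and $\deg_{\mathcal G}(v)\ne2$ for all $v$. Operator. The vertices of degree $1$ are partitioned into $\mathcal V_D$ (Dirichlet) and $\mathcal V_N$ (Neumann), either possibly empty. $L^2(\mathcal G)=\bigoplus_{e}L^2(e)$. The operator $\mathbf H_0$ acts as $-d^2/dx_e^2$ on each edge, on functions $f=(f_e)_e$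 with $f_e\in H^2(e)$, nonzero on only finitely many edges, such that $f(v)=0$ for $v\in\mathcal V_D$ and, at every $v\in\mathcal V\setminus\mathcal V_D$, $f$ is continuous and $\sum_{e\in\mathcal E_v}f_e'(v)=0$ (derivatives taken from $v$ into the edge). $\mathbf H$ is the self-adjoint operator associated with the closure of the form $f\mapsto\int_{\mathcal G}|f'|^2dx$ on $\mathrm{dom}(\mathbf H_0)$ (the Friedrichs extension of $\mathbf H_0$). By convention $\inf\varnothing=+\infty$. Isoperimetric constants. $\mathcal K_{\mathcal G}$ is the set of finite connected subgraphs of $\mathcal G$ (with at least one edge). For $\widetilde{\mathcal G}=(\widetilde{\mathcal V},\widetilde{\mathcal E})\in\mathcal K_{\mathcal G}$ put $\mathrm{mes}(\widetilde{\mathcal G})=\sum_{e\in\widetilde{\mathcal E}}|e|$, $\partial_{\mathcal G}\widetilde{\mathcal G}=\{v\in\widetilde{\mathcal V}:\ v\in\mathcal V_D\text{ or }\deg_{\widetilde{\mathcal G}}(v)<\deg_{\mathcal G}(v)\}$ and $\deg(\partial_{\mathcal G}\widetilde{\mathcal G})=\sum_{v\in\partial_{\mathcal G}\widetilde{\mathcal G}}\deg_{\widetilde{\mathcal G}}(v)$. Then $$\alpha(\mathcal G)=\inf_{\widetilde{\mathcal G}\in\mathcal K_{\mathcal G}}\frac{\deg(\partial_{\mathcal G}\widetilde{\mathcal G})}{\mathrm{mes}(\widetilde{\mathcal G})},\qquad \alpha_{\mathrm{ess}}(\mathcal G)=\sup_{\widetilde{\mathcal G}\in\mathcal K_{\mathcal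 G}}\alpha(\mathcal G\setminus\widetilde{\mathcal G}),$$ where $\mathcal G\setminus\widetilde{\mathcal G}$ consists of the edges not in $\widetilde{\mathcal G}$ (and their endpoints), with Dirichlet conditions at vertices having at least one edge in $\widetilde{\mathcal G}$ and the original conditions elsewhere; equivalently $\alpha(\mathcal G\setminus\widetilde{\mathcal G})=\inf\deg(\partial_{\mathcal G}\mathcal Y)/\mathrm{mes}(\mathcal Y)$ over finite connected subgraphs $\mathcal Y$ of $\mathcal G\setminus\widetilde{\mathcal G}$. *)

(* Defs.v *)
From Stdlib Require Import Relation_Operators.
From HB Require Import structures.
From mathcomp Require Import all_boot all_order all_algebra finmap.
From mathcomp Require Import all_classical all_reals all_analysis.
From mathcomp Require Import complex.

Set Implicit Arguments.
Unset Strict Implicit.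
Unset Printing Implicit Defensive.
Import Order.TTheory GRing.Theory Num.Theory.
Import numFieldNormedType.Exports.

Local Open Scope classical_set_scope.
Local Open Scope complex_scope.
Local Open Scope ring_scope.

(** * Metric graphs *)

Section Incidence.
Context {V E : Type} (s t : E -> V).

Definition incident_at (v : V) : set E := [set e | s e = v \/ t e = v].

(* [u] and [v] are the two endpoints of an edge from [S]. *)
Definition adjacent_in (S : set E) (u v : V) : Prop :=
  exists2 e, S e & (s e = u /\ t e = v) \/ (s e = v /\ t e = u).

Definition joined_in (S : set E) : V -> V -> Prop :=
  clos_refl_trans V (adjacent_in S).

End Incidence.

(* The graph is unoriented: [src]/[tgt] only record which endpoint of [e] is
   identified with [0], resp. [len e], in the identification of [e] with
   [0, len e]. *)
Record metric_graph (R : realType) := MetricGraph {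
  vertex : countType;
  edge : countType;
  src : edge -> vertex;
  tgt : edge -> vertex;
  len : edge -> R;
  len_gt0 : forall e, 0 < len e;
  no_loop : forall e, src e <> tgt e;
  no_multiple_edge : forall e e',
    (src e = src e' /\ tgt e = tgt e') \/ (src e = tgt e' /\ tgt e = src e') ->
    e = e';
  locally_finite : forall v, finite_set (incident_at src tgt v);
  connected_graph : forall u v, joined_in src tgt setT u v;
  infinite_graph : infinite_set [set: vertex]
}.

Arguments src {R m}.
Arguments tgt {R m}.
Arguments len {R m}.

Section Graph.
Context {R : realType} {G : metric_graph R}.

Definition incident (v : vertex G) : set (edge G) := incident_at src tgt v.

Definition degree_in (S : set (edge G)) (v : vertex G) : nat :=
  #|` fset_set (incident v `&` S) |.

Definition degree (v : vertex G) : nat := degree_in setT v.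

End Graph.

Definition ell_sup {R : realType} (G : metric_graph R) : \bar R :=
  ereal_sup [set (len e)%:E | e in [set: edge G]].

(** * Isoperimetric constants *)

Record finite_subgraph {R : realType} (G : metric_graph R) := FiniteSubgraph {
  sub_V : {fset vertex G};
  sub_E : {fset edge G};
  sub_endpoints : forall e, e \in sub_E -> src e \in sub_V /\ tgt e \in sub_V
}.

Section Isoperimetric.
Context {R : realType} {G : metric_graph R}.
Implicit Types (S : set (edge G)) (D : set (vertex G)) (Y : finite_subgraph G).

(* Finite connected subgraphs with at least one edge, all edges being in [S]. *)
Definition conn_subgraphs S : set (finite_subgraph G) := [set Y |
  [/\ sub_E Y != fset0,
      [set` sub_E Y] `<=` S &
      forall u v, u \in sub_V Y -> v \in sub_V Y ->
        joined_in src tgt [set` sub_E Y] u v]].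

Definition mes Y : R := \sum_(e <- sub_E Y) len e.

(* Boundary of [Y] in the graph with edge set [S] and Dirichlet set [D]. *)
Definition boundary S D Y : set (vertex G) := [set v | v \in sub_V Y /\
  (D v \/ (degree_in [set` sub_E Y] v < degree_in S v)%N)].

Definition deg_boundary S D Y : nat :=
  \sum_(v <- sub_V Y | v \in boundary S D Y) degree_in [set` sub_E Y] v.

(* Isoperimetric constant of the (possibly disconnected) graph with edge set
   [S] and Dirichlet set [D]. *)
Definition alpha_in S D : \bar R :=
  ereal_inf [set ((deg_boundary S D Y)%:R / mes Y)%:E | Y in conn_subgraphs S].

Definition alpha (VD : set (vertex G)) : \bar R := alpha_in setT VD.

(* The constant of [G \ K]: Dirichlet conditions are added at the vertices
   having an edge in [K]. *)
Definition alpha_removed (VD : set (vertex G)) (K : finite_subgraph G) : \bar R :=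
  alpha_in (~` [set` sub_E K])
    (VD `|` [set v | exists2 e, e \in sub_E K & incident v e]).

Definition alpha_ess (VD : set (vertex G)) : \bar R :=
  ereal_sup [set alpha_removed VD K | K in conn_subgraphs setT].

End Isoperimetric.

(** * Complex-valued functions on edges and on the graph *)

Section EdgeFunctions.
Context {R : realType}.
Implicit Types (l : R) (u : R -> R[i]).

Definition cabs2 (z : R[i]) : R := complex.Re z ^+ 2 + complex.Im z ^+ 2.

Definition cintegral l u : R[i] :=
  (\int[lebesgue_measure]_(x in `[0, l]) complex.Re (u x)) +i*
  (\int[lebesgue_measure]_(x in `[0, l]) complex.Im (u x)).

Definition edge_norm2 l u : \bar R :=
  (\int[lebesgue_measure]_(x in `[0%R, l]) (cabs2 (u x))%:E)%E.

Definition edge_L2 l u : Prop :=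
  [/\ measurable_fun (`[0, l] : set R) (fun x => complex.Re (u x)),
      measurable_fun (`[0, l] : set R) (fun x => complex.Im (u x)) &
      (edge_norm2 l u < +oo)%E].

(* [u] is the (absolutely) continuous representative of an element of
   H^1(0, l), and [u'] is its derivative. *)
Definition edge_H1 l u u' : Prop :=
  edge_L2 l u' /\ forall x, 0 <= x <= l -> u x = u 0 + cintegral x u'.

End EdgeFunctions.

(* [f e x] is the value of [f] at the point [x] of the edge [e]; only the
   values for [0 <= x <= len e] are ever used. *)
Definition gfun {R : realType} (G : metric_graph R) := edge G -> R -> R[i].

Section GraphFunctions.
Context {R : realType} {G : metric_graph R}.
Implicit Types (f g : gfun G).

Definition gzero : gfun G := fun _ _ => 0.
Definition gadd f g : gfun G := fun e x => f e x + g e x.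
Definition gsub f g : gfun G := fun e x => f e x - g e x.
Definition gscale (z : R[i]) f : gfun G := fun e x => z * f e x.

Definition norm2 f : \bar R :=
  (\esum_(e in [set: edge G]) edge_norm2 (len e) (f e))%E.

Definition L2 : set (gfun G) := [set f |
  (forall e, edge_L2 (len e) (f e)) /\ (norm2 f < +oo)%E].

(* Sum of an absolutely summable family of reals. *)
Definition real_sum (a : edge G -> R) : R :=
  fine (\esum_(e in [set: edge G]) (Num.max (a e) 0)%:E)%E -
  fine (\esum_(e in [set: edge G]) (Num.max (- a e) 0)%:E)%E.

Definition dotp f g : R[i] :=
  let c e := cintegral (len e) (fun x => f e x * conjc (g e x)) in
  real_sum (fun e => complex.Re (c e)) +i* real_sum (fun e => complex.Im (c e)).

Definition L2_cvg (u : nat -> gfun G) f : Prop :=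
  (fun n => norm2 (gsub (u n) f)) @ \oo --> 0%E.

Definition L2_cauchy (u : nat -> gfun G) : Prop :=
  forall eps : R, 0 < eps -> exists N : nat, forall m n : nat,
    (N <= m)%N -> (N <= n)%N -> (norm2 (gsub (u m) (u n)) < eps%:E)%E.

End GraphFunctions.

(** * The Kirchhoff Laplacian *)

Section Kirchhoff.
Context {R : realType} {G : metric_graph R}.
Implicit Types (f g : gfun G) (VD : set (vertex G)).

(* For an edge [e] incident to [v]: the value of [f] on [e] at [v], and the
   derivative at [v] into the edge, where [f'] is the derivative of [f] in the
   coordinate of [e]. *)
Definition end_value f (v : vertex G) (e : edge G) : R[i] :=
  if src e == v then f e 0 else f e (len e).

Definition end_deriv f' (v : vertex G) (e : edge G) : R[i] :=
  if src e == v then f' e 0 else - f' e (len e).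

Definition vertex_conditions VD f f' : Prop :=
  (forall v, VD v -> forall e, incident v e -> end_value f v e = 0) /\
  (forall v, ~ VD v ->
     (forall e e', incident v e -> incident v e' ->
        end_value f v e = end_value f v e') /\
     \sum_(e \in incident v) end_deriv f' v e = 0).

(* [f] is in dom(H_0) and [f'] is its derivative. Since [f' e] is itself the
   continuous representative of an H^1 function, its values at the endpoints
   are the one-sided derivatives of [f e]. *)
Definition dom_H0 VD f f' : Prop :=
  [/\ forall e, edge_H1 (len e) (f e) (f' e),
      exists f'' : gfun G, forall e, edge_H1 (len e) (f' e) (f'' e),
      finite_set [set e | exists2 x, 0 <= x <= len e & f e x != 0] &
      vertex_conditions VD f f'].

(* [u_n] in dom(H_0) (with derivatives [u'_n]) is Cauchy for the form
   norm and tends to [f] in L^2. *)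
Definition form_approx VD (u u' : nat -> gfun G) f : Prop :=
  [/\ forall n, dom_H0 VD (u n) (u' n), L2_cauchy u', L2 f & L2_cvg u f].

Definition form_dom VD : set (gfun G) :=
  [set f | exists u u', form_approx VD u u' f].

(* Graph of the closure of the form (f, g) |-> \int f' conj(g') on dom(H_0):
   [c] is its value at [(f, g)]. *)
Definition closed_form VD f g (c : R[i]) : Prop :=
  exists u u' w w', [/\ form_approx VD u u' f, form_approx VD w w' g &
    (fun n => cabs2 (dotp (u' n) (w' n) - c)) @ \oo --> (0 : R)].

(* Graph of the operator associated with the closed form: [g] is H f. Elements
   of L^2 are represented by functions, so [g] is determined a.e. only. *)
Definition kirchhoff VD f g : Prop :=
  [/\ form_dom VD f, L2 g &
      forall phi, form_dom VD phi -> closed_form VD f phi (dotp g phi)].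

End Kirchhoff.

(** * Spectra *)

Section Spectrum.
Context {R : realType} {G : metric_graph R}.
(* An operator in L^2(G), given by its graph. *)
Implicit Types (H : gfun G -> gfun G -> Prop) (z : R[i]).

(* (H - z) f = g *)
Definition shifted H z f g : Prop := H f (gadd g (gscale z f)).

(* H - z is a bijection of dom H onto L^2 with bounded inverse; the bound also
   expresses injectivity. *)
Definition resolvent_set H : set R[i] := [set z |
  (forall g, L2 g -> exists f, shifted H z f g) /\
  (exists C : R, forall f g, L2 g -> shifted H z f g ->
     (norm2 f <= C%:E * norm2 g)%E)].

Definition spectrum H : set R[i] := ~` resolvent_set H.

Definition eigenspace H z : set (gfun G) := [set f | shifted H z f gzero].

Definition eigenvalue H z : Prop := exists2 f, eigenspace H z f & norm2 f <> 0%E.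

Definition finite_multiplicity H z : Prop :=
  exists (n : nat) (b : 'I_n -> gfun G), (forall i, eigenspace H z (b i)) /\
    forall f, eigenspace H z f -> exists c : 'I_n -> R[i],
      norm2 (gsub f (fun e x => \sum_(i < n) c i * b i e x)) = 0%E.

Definition isolated_in (A : set R[i]) z : Prop :=
  A z /\ exists2 eps : R, 0 < eps &
    forall w, A w -> cabs2 (w - z) < eps ^+ 2 -> w = z.

Definition discrete_spectrum H : set R[i] := [set z |
  [/\ isolated_in (spectrum H) z, eigenvalue H z & finite_multiplicity H z]].

Definition essential_spectrum H : set R[i] :=
  spectrum H `\` discrete_spectrum H.

(* Infimum of a set of spectral values, which is a subset of the real line for
   a self-adjoint operator; it is +oo for the empty set. *)
Definition spectral_inf (A : set R[i]) : \bar R :=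
  ereal_inf [set x%:E | x in [set x : R | A x%:C]].

End Spectrum.

Definition lambda0 {R : realType} {G : metric_graph R} (VD : set (vertex G)) : \bar R :=
  spectral_inf (spectrum (kirchhoff VD)).

Definition lambda0_ess {R : realType} {G : metric_graph R} (VD : set (vertex G)) : \bar R :=
  spectral_inf (essential_spectrum (kirchhoff VD)).

(* Main.v *)
(* Let A < alpha(G), let u be the real or imaginary part of a function f of
   dom(H_0), and put M(e) = max_e u^2, g(v) = u(v)^2. The isoperimetric
   inequality on the components of the superlevel sets of M and a layer-cake sum
   give
     A sum_e |e| M(e) <= sum_e (2 M(e) - g(src e) - g(tgt e)).
   The left-hand side dominates A \int u^2, and the e-th term on the right is at
   most the total variation of u^2 on e, hence at most
   (A/2) \int_e u^2 + (2/A) \int_e u'^2. This yields the gap inequality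
   (A^2/4) |f|^2 <= |f'|^2 on dom(H_0).
   If only A < alpha(G \ K), then the gap inequality still holds for those f that
   vanish at sufficiently many equidistant points of the finitely many edges of
   K: use the argument above off K and a Poincare inequality on K.

   A gap inequality with constant c on a subspace of finite codimension r makes
   the spectrum in {z : |Im z| < c - Re z} discrete: Lax-Milgram solves the weak
   equation for H - z on that subspace and a Schur complement handles the
   remaining r dimensions, so z is an eigenvalue or a regular point, while an
   orthonormal family of eigenvectors for eigenvalues below c has at most r
   members. For r = 0 there is no spectrum below c at all.

   Complex L^2 is treated as a real semi-inner product space with the isometry
   J f = i f. Completeness is only needed for, and only proved for, sequences of
   dom(H_0) that are Cauchy in the form norm; these converge uniformly on edges. *)

From Stdlib Require Import Relation_Operators Operators_Properties.
From HB Require Import structures.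
Require Import Defs.
From mathcomp Require Import all_boot all_order all_algebra finmap.
From mathcomp Require Import all_classical all_reals all_analysis.
From mathcomp Require Import measurable_realfun complex ring lra zify.

Set Implicit Arguments.
Unset Strict Implicit.
Unset Printing Implicit Defensive.
Import Order.TTheory GRing.Theory Num.Theory.
Import numFieldNormedType.Exports.
Local Open Scope classical_set_scope.
Local Open Scope ring_scope.

(** * Positive semidefinite forms *)

(** Elements of L^2 are functions, not classes, so the inner product is only semidefinite: the
    abstract part works with a seminorm, and a nonzero vector is one with [ip x x != 0]. Riesz and
    Lax-Milgram are therefore proved approximately inside the core, with no limit taken; the
    approximate solutions are then shown to be Cauchy in the form norm, where limits do exist.
    Isolation of an eigenvalue refers to the complex plane, so nonreal spectral points near the real
    axis must be excluded as well. This is why the resolvent is built for all z with |Im z| < c - Re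
    z: there the skew part of the shifted form, of size |Im z|, is dominated by its symmetric part,
    which is coercive with constant c - Re z. The constant 1/4 is the maximum of s(A - s)/A^2, where
    s is the weight in 2|u u'| <= s u^2 + u'^2/s. The zeros prescribed on the edges of K do two
    jobs: those at the ends supply the Dirichlet conditions of G \ K, and a fine spacing makes the
    Poincare constant on K as small as required. *)

Section Scalar.
Context {R : realType} {V : lmodType R} (L : V -> R).
Hypothesis linL : scalar L.

Let Ll : {scalar V} := HB.pack L (GRing.isLinear.Build R V R *%R L linL).

Lemma scalarD u v : L (u + v) = L u + L v. Proof. exact: (linearD Ll). Qed.
Lemma scalarB u v : L (u - v) = L u - L v. Proof. exact: (linearB Ll). Qed.
Lemma scalar_scale a u : L (a *: u) = a * L u. Proof. exact: (linearZ_LR Ll). Qed.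
Lemma scalar0 : L 0 = 0. Proof. exact: (linear0 Ll). Qed.
Lemma scalar_sum I (r : seq I) (P : pred I) F :
  L (\sum_(i <- r | P i) F i) = \sum_(i <- r | P i) L (F i).
Proof. exact: (linear_sum Ll). Qed.

End Scalar.

Section BilinearForm.
Context {R : realType} {V : lmodType R}.
Implicit Types (b : V -> V -> R) (u v : V).

Definition bilinear_form b :=
  (forall v, scalar (b^~ v)) /\ (forall u, scalar (b u)).

Definition psd_form b :=
  [/\ bilinear_form b, forall u v, b u v = b v u & forall u, 0 <= b u u].

Definition seminorm b u := Num.sqrt (b u u).

End BilinearForm.

Section PsdForm.
Context {R : realType} {V : lmodType R} (b : V -> V -> R).
Hypothesis psd_b : psd_form b.
Let blin : bilinear_form b. Proof. by case: psd_b. Qed.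
Let bsym u v : b u v = b v u. Proof. by case: psd_b. Qed.
Let bge0 u : 0 <= b u u. Proof. by case: psd_b. Qed.
Local Notation nrm := (seminorm b).

Lemma seminorm_ge0 u : 0 <= nrm u. Proof. exact: sqrtr_ge0. Qed.

Lemma sqr_seminorm u : nrm u ^+ 2 = b u u. Proof. exact: sqr_sqrtr. Qed.

Lemma seminormZ a u : nrm (a *: u) = `|a| * nrm u.
Proof.
rewrite /seminorm (scalar_scale (blin.1 _)) (scalar_scale (blin.2 _)) mulrA.
by rewrite -expr2 sqrtrM ?sqr_ge0// sqrtr_sqr.
Qed.

Lemma seminorm0 : nrm 0 = 0.
Proof. by rewrite /seminorm (scalar0 (blin.1 _)) sqrtr0. Qed.

Lemma cauchy_schwarz_psd u v : `|b u v| <= nrm u * nrm v.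
Proof.
have key t : 0 <= b u u + 2 * t * b u v + t ^+ 2 * b v v.
  have := bge0 (u + t *: v).
  rewrite (scalarD (blin.1 _)) !(scalarD (blin.2 _)).
  rewrite (scalar_scale (blin.1 _)) !(scalar_scale (blin.2 _)).
  by rewrite (scalar_scale (blin.1 _)) (bsym v u); lra.
(* If [b v v = 0] the quadratic is affine in [t]; were its slope nonzero, the chosen [t] would give
   it the value -1. Otherwise [t] is taken at the minimum, - b u v / b v v. *)
have [bv0|bv0] := eqVneq (b v v) 0.
  suff -> : b u v = 0 by rewrite normr0 mulr_ge0 ?seminorm_ge0.
  apply/eqP; apply: contraT => buv0.
  have := key (- (b u u + 1) / (2 * b u v)).
  rewrite bv0 mulr0 addr0.
  have -> : 2 * (- (b u u + 1) / (2 * b u v)) * b u v = - (b u u + 1) by field.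
  lra.
have bvgt0 : 0 < b v v by rewrite lt_neqAle eq_sym bv0 bge0.
rewrite -(ler_pXn2r (n := 2)) ?nnegrE ?mulr_ge0 ?seminorm_ge0//.
rewrite exprMn !sqr_seminorm real_normK ?num_real//.
have := key (- (b u v / b v v)).
rewrite -(pmulr_rge0 _ bvgt0).
have -> : b v v * (b u u + 2 * - (b u v / b v v) * b u v
    + (- (b u v / b v v)) ^+ 2 * b v v) = b u u * b v v - b u v ^+ 2 by field.
by rewrite subr_ge0.
Qed.

Lemma seminormD u v : nrm (u + v) <= nrm u + nrm v.
Proof.
rewrite -(ler_pXn2r (n := 2)) ?nnegrE ?addr_ge0 ?seminorm_ge0//.
rewrite sqr_seminorm sqrrD !sqr_seminorm.
rewrite (scalarD (blin.1 _)) !(scalarD (blin.2 _)) (bsym v u).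
have := le_trans (ler_norm _) (cauchy_schwarz_psd u v).
lra.
Qed.

Lemma seminormN u : nrm (- u) = nrm u.
Proof. by rewrite -scaleN1r seminormZ normrN1 mul1r. Qed.

Lemma seminormB u v : nrm (u - v) <= nrm u + nrm v.
Proof. by rewrite -(seminormN v) seminormD. Qed.

Lemma seminorm_distC u v : nrm (u - v) = nrm (v - u).
Proof. by rewrite -opprB seminormN. Qed.

Lemma seminorm_sum I (r : seq I) (F : I -> V) :
  nrm (\sum_(i <- r) F i) <= \sum_(i <- r) nrm (F i).
Proof.
elim: r => [|i r IH]; first by rewrite !big_nil seminorm0.
rewrite !big_cons; apply: (le_trans (seminormD _ _)); exact: lerD.
Qed.

(* Near-minimizers of [b u u - 2 L u] nearly represent [L]: no completeness is
   needed. *)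
Lemma approximate_riesz (L : V -> R) (K eps : R) : scalar L -> 0 <= K ->
  (forall v, `|L v| <= K * nrm v) -> 0 < eps ->
  exists u, forall v, `|L v - b u v| <= K * eps * nrm v.
Proof.
(* For [K = 0] the tolerance below would be 0 and a near-minimizer need not exist, but then [L]
   vanishes. *)
move=> linL; rewrite le_eqVlt => /orP[/eqP<- boundL|K0 boundL] eps0.
  exists 0 => v; rewrite (scalar0 (blin.1 _)) subr0.
  by rewrite !mul0r; have := boundL v; rewrite mul0r.
pose F u := b u u - 2 * L u.
pose S := [set F u | u in [set: V]].
have S0 : S !=set0 by exists (F 0), 0.
have lbS : has_lbound S.
  exists (- K ^+ 2) => _ [u _ <-].
  have := le_trans (ler_norm _) (boundL u).
  rewrite /F -sqr_seminorm => h.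
  have := sqr_ge0 (nrm u - K); nra.
(* A defect of (K eps)^2 in the minimum becomes, through the discriminant of [Fv], a defect of K eps
   in the representation of [L]. *)
have e0 : 0 < (K * eps) ^+ 2 by rewrite exprn_gt0// mulr_gt0.
have [_ [u _ <-] Fu] := inf_adherent e0 (conj S0 lbS).
exists u => v.
have Fv t : 0 <= (K * eps) ^+ 2 + 2 * t * (b u v - L v) + t ^+ 2 * b v v.
  have : inf S <= F (u + t *: v) by apply: inf_lbound => //; exists (u + t *: v).
  move: Fu; rewrite /F (scalarD linL) (scalar_scale linL).
  rewrite (scalarD (blin.1 _)) !(scalarD (blin.2 _)).
  rewrite (scalar_scale (blin.1 _)) !(scalar_scale (blin.2 _)).
  rewrite (scalar_scale (blin.1 _)) (bsym v u); lra.
rewrite -normrN opprB.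
have [bv0|bv0] := eqVneq (b v v) 0.
  suff -> : b u v - L v = 0 by rewrite normr0 !mulr_ge0 ?seminorm_ge0// ltW.
  apply/eqP; apply: contraT => d0.
  have := Fv (- ((K * eps) ^+ 2 + 1) / (2 * (b u v - L v))).
  rewrite bv0 mulr0 addr0.
  have -> : 2 * (- ((K * eps) ^+ 2 + 1) / (2 * (b u v - L v))) * (b u v - L v) =
    - ((K * eps) ^+ 2 + 1) by field.
  lra.
have bvgt0 : 0 < b v v by rewrite lt_neqAle eq_sym bv0 bge0.
rewrite -(ler_pXn2r (n := 2)) ?nnegrE ?mulr_ge0 ?seminorm_ge0 ?(ltW K0) ?(ltW eps0)//.
rewrite [leRHS]exprMn !sqr_seminorm real_normK ?num_real//.
have := Fv (- ((b u v - L v) / b v v)).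
rewrite -(pmulr_rge0 _ bvgt0).
have -> : b v v * ((K * eps) ^+ 2 + 2 * - ((b u v - L v) / b v v) * (b u v - L v)
    + (- ((b u v - L v) / b v v)) ^+ 2 * b v v) =
  (K * eps) ^+ 2 * b v v - (b u v - L v) ^+ 2 by field.
by rewrite subr_ge0.
Qed.

(** [P] is a contraction relative to [b], so a Neumann iteration works: the residual functional is
    represented approximately by some [w], and adding [w] leaves the Riesz error plus [P w]. With
    relative Riesz error (1 - theta)/4, the residual shrinks at each step by rho = (1 + theta)/2 <
    1. *)
Lemma approximate_lax_milgram (P : V -> V -> R) (theta : R) (L : V -> R)
    (K eps : R) :
  bilinear_form P -> 0 <= theta < 1 ->
  (forall u v, `|P u v| <= theta * (nrm u * nrm v)) ->
  scalar L -> 0 <= K -> (forall v, `|L v| <= K * nrm v) -> 0 < eps ->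
  exists u, forall v, `|L v - (b u v - P u v)| <= K * eps * nrm v.
Proof.
move=> linP /andP[th0 th1] boundP linL K0 boundL eps0.
pose rho := (1 + theta) / 2.
have rho0 : 0 <= rho by rewrite /rho; lra.
have rho1 : rho < 1 by rewrite /rho; lra.
have step n : exists u, forall v, `|L v - (b u v - P u v)| <= K * rho ^+ n * nrm v.
  elim: n => [|n [u hu]].
    exists 0 => v; rewrite expr0 mulr1 (scalar0 (blin.1 _)) (scalar0 (linP.1 _)).
    by rewrite !subr0.
  have linL' : scalar (fun v => L v - (b u v - P u v)).
    move=> a x y /=.
    rewrite (scalarD linL) (scalar_scale linL) (scalarD (blin.2 _)).
    rewrite (scalar_scale (blin.2 _)) (scalarD (linP.2 _)) (scalar_scale (linP.2 _)).
    ring.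
  have K'0 : 0 <= K * rho ^+ n by rewrite mulr_ge0 ?exprn_ge0.
  have e0 : 0 < (1 - theta) / 4 by lra.
  have [w hw] := approximate_riesz linL' K'0 hu e0.
  set K' := K * rho ^+ n in K'0 hu hw *.
  exists (u + w) => v.
  rewrite (scalarD (blin.1 _)) (scalarD (linP.1 _)).
  have nw : nrm w <= K' * (1 + (1 - theta) / 4).
    have := le_trans (ler_norm _) (hu w).
    have := hw w; rewrite -normrN => /(le_trans (ler_norm _)).
    rewrite -sqr_seminorm => h1 h2.
    have n0 := seminorm_ge0 w.
    case: (ltrP 0 (nrm w)) => [npos|]; last first.
      by move=> /le_trans; apply; rewrite mulr_ge0//; lra.
    rewrite -(ler_pM2r npos); lra.
  have -> : L v - (b u v + b w v - (P u v + P w v)) =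
    (L v - (b u v - P u v) - b w v) + P w v by ring.
  apply: (le_trans (ler_normD _ _)).
  apply: (le_trans (lerD (hw v) (boundP w v))).
  rewrite [theta * _]mulrA -mulrDl; apply: ler_wpM2r; first exact: seminorm_ge0.
  apply: (@le_trans _ _ (K' * ((1 - theta) / 4) +
    theta * (K' * (1 + (1 - theta) / 4)))).
    by rewrite lerD2l; exact: ler_wpM2l.
  rewrite exprSr [K * _]mulrA -/K' /rho.
  have -> : K' * ((1 - theta) / 4) + theta * (K' * (1 + (1 - theta) / 4)) =
    K' * ((1 - theta) / 4 + theta * (1 + (1 - theta) / 4)) by ring.
  apply: ler_wpM2l => //; nra.
have /cvgrPdist_lt /(_ _ eps0) [n _ /(_ n (leqnn n))] :
    (fun n => rho ^+ n) @ \oo --> (0 : R).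
  by apply: cvg_expr; rewrite ger0_norm.
rewrite /= sub0r normrN ger0_norm ?exprn_ge0// => /ltW hn.
have [u hu] := step n; exists u => v; apply: (le_trans (hu v)).
by apply: ler_wpM2r; [exact: seminorm_ge0|exact: ler_wpM2l].
Qed.

End PsdForm.

(** * Finitely many linear constraints and a complement of their kernel *)

Section FiniteCodimension.
Context {R : realType} {V : lmodType R}.

(** The [l j] may be dependent, so a largest family [e] with independent rows (l j (e i))_j is
    taken; every other row is then a combination of these. The coordinates [a i] are combinations of
    the [l j] and inherit their continuity. *)
Lemma finite_codim_projection N (l : 'I_N -> V -> R) :
  (forall j, scalar (l j)) ->
  exists (r : nat) (e : 'I_r -> V) (a : 'I_r -> V -> R),
    [/\ forall i, exists c : 'I_N -> R, forall u, a i u = \sum_j c j * l j u,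
        forall i k, a i (e k) = (i == k)%:R &
        forall j u, l j (u - \sum_i a i u *: e i) = 0].
Proof.
move=> linl.
pose M r (e : 'I_r -> V) : 'M[R]_(r, N) := \matrix_(i, j) l j (e i).
pose free r := `[< exists e : 'I_r -> V, row_free (M r e) >].
have free0 : exists r, free r.
  exists 0%N; apply/asboolP; exists (fun=> 0).
  by rewrite /row_free; apply/eqP; have := rank_leq_row (M 0%N (fun=> 0)); lia.
have free_le r : free r -> (r <= N)%N.
  by move=> /asboolP[e]; rewrite /row_free => /eqP <-; exact: rank_leq_col.
case: (ex_maxnP free0 free_le) => r /asboolP[e free_e] rmax.
pose lrow u : 'rV[R]_N := \row_j l j u.
have lrow_sub u : (lrow u <= M r e)%MS.
  (* A row outside the span could be appended as row r + 1, against the maximality of [r]. *)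
  apply: contraT => nsub.
  pose e' (i : 'I_(r + 1)) := if fintype.split i is inl i' then e i' else u.
  suff /rmax : free (r + 1)%N by lia.
  apply/asboolP; exists e'.
  have -> : M _ e' = col_mx (M r e) (lrow u).
    apply/matrixP => i j; rewrite !mxE /e'.
    by case: splitP => k _; rewrite !mxE.
  rewrite /row_free -addsmxE.
  have /mxdirectP -> /= : mxdirect (M r e + lrow u).
    apply/mxdirect_addsP; apply/eqP; rewrite -mxrank_eq0.
    have := mxrankS (capmxSr (M r e) (lrow u)).
    have rk1 : (\rank (lrow u) <= 1)%N by exact: rank_leq_row.
    case E : (\rank (M r e :&: lrow u)) => [//|k] hk.
    have /eqmxP/eqmx_sym eqm : ((M r e :&: lrow u)%MS == lrow u)%MS.
      by rewrite -(mxrank_leqif_eq (capmxSr _ _)).2; apply/eqP; lia.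
    by case/negP: nsub; rewrite eqm capmxSl.
  rewrite (eqP (free_e : \rank _ == _)).
  have : \rank (lrow u) != 0%N.
    rewrite mxrank_eq0; apply: contra nsub => /eqP ->; exact: sub0mx.
  have rk1 : (\rank (lrow u) <= 1)%N by exact: rank_leq_row.
  by move=> h; apply/eqP; lia.
exists r, e, (fun i u => (lrow u *m pinvmx (M r e)) 0 i); split.
- move=> i; exists (fun j => pinvmx (M r e) j i) => u.
  by rewrite mxE; apply: eq_bigr => j _; rewrite mxE mulrC.
- move=> i k.
  have -> : lrow (e k) = row k (M r e) by apply/rowP => j; rewrite !mxE.
  by rewrite -row_mul mulmxVp// mxE mxE eq_sym.
- move=> j u; rewrite (scalarB (linl j)) (scalar_sum (linl j)).
  have /matrixP/(_ 0 j) := mulmxKpV (lrow_sub u).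
  rewrite [LHS]mxE [X in _ = X -> _]mxE => <-; apply/eqP; rewrite subr_eq0.
  by apply/eqP; apply: eq_bigr => i _; rewrite (scalar_scale (linl j)) mxE [M r e _ _]mxE.
Qed.

End FiniteCodimension.

(** * The operator of a closable form *)

Section Friedrichs.
Context {R : realType} {X D : lmodType R}.
Variables (ip : X -> X -> R) (iota delta : {linear D -> X}).
Hypothesis psd_ip : psd_form ip.
Implicit Types (u v : nat -> D) (x y z : X) (phi : D).

Local Notation nx := (seminorm ip).

Let ip_lin : bilinear_form ip. Proof. by case: psd_ip. Qed.
Let ip_sym x y : ip x y = ip y x. Proof. by case: psd_ip. Qed.

(** In the application [D] is dom(H_0), and [iota], [delta] send a core function to itself and to
    its derivative in L^2, so that [h1] is the H^1 inner product. *)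
Definition form (phi psi : D) := ip (delta phi) (delta psi).
Definition mass (phi psi : D) := ip (iota phi) (iota psi).
Definition h1 (phi psi : D) := mass phi psi + form phi psi.
Local Notation nv := (seminorm h1).

Lemma psd_pullback (f : {linear D -> X}) : psd_form (fun phi psi => ip (f phi) (f psi)).
Proof.
split=> [|phi psi|phi]; last 1 first.
- by case: psd_ip.
- split=> [psi|phi] k a b /=; rewrite linearP.
    by rewrite (scalarD (ip_lin.1 _)) (scalar_scale (ip_lin.1 _)).
  by rewrite (scalarD (ip_lin.2 _)) (scalar_scale (ip_lin.2 _)).
- exact: ip_sym.
Qed.

Lemma psd_mass : psd_form mass. Proof. exact: psd_pullback. Qed.
Lemma psd_form_form : psd_form form. Proof. exact: psd_pullback. Qed.

Lemma psd_h1 : psd_form h1.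
Proof.
have [ml ms m0] := psd_mass; have [fl fs f0] := psd_form_form.
split=> [|phi psi|phi].
- split=> [psi|phi] k a b; rewrite /h1.
    by rewrite (ml.1 psi) (fl.1 psi); ring.
  by rewrite (ml.2 phi) (fl.2 phi); ring.
- by rewrite /h1 ms fs.
- by rewrite addr_ge0.
Qed.

Lemma iota_le_h1 phi : nx (iota phi) <= nv phi.
Proof.
have [_ _ f0] := psd_form_form.
by rewrite ler_wsqrtr// /h1 /mass lerDl.
Qed.

Lemma delta_le_h1 phi : nx (delta phi) <= nv phi.
Proof.
have [_ _ m0] := psd_mass.
by rewrite ler_wsqrtr// /h1 /form lerDr.
Qed.

Lemma h1_le_iota_delta phi : nv phi <= nx (iota phi) + nx (delta phi).
Proof.
rewrite -(ler_pXn2r (n := 2)) ?nnegrE ?addr_ge0 ?seminorm_ge0//.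
rewrite (sqr_seminorm psd_h1) sqrrD !(sqr_seminorm psd_ip) /h1 /mass /form.
have := seminorm_ge0 ip (iota phi); have := seminorm_ge0 ip (delta phi); nra.
Qed.

Lemma form_le_h1 phi psi : `|form phi psi| <= nv phi * nv psi.
Proof.
apply: (le_trans (cauchy_schwarz_psd psd_ip _ _)).
by apply: ler_pM; rewrite ?seminorm_ge0 ?delta_le_h1.
Qed.

Lemma mass_le_h1 phi psi : `|mass phi psi| <= nv phi * nv psi.
Proof.
apply: (le_trans (cauchy_schwarz_psd psd_ip _ _)).
by apply: ler_pM; rewrite ?seminorm_ge0 ?iota_le_h1.
Qed.

Definition xlim (s : nat -> X) x := (fun n => nx (s n - x)) @ \oo --> (0 : R).

Definition h1_cauchy u := forall eps : R, 0 < eps ->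
  exists N, forall m n, (N <= m)%N -> (N <= n)%N -> nv (u m - u n) <= eps.

(** The form domain without a completion: its elements are the [x] that admit such a [u]. *)
Definition h1_limit u x := h1_cauchy u /\ xlim (fun n => iota (u n)) x.

(** Graph of the Friedrichs operator, tested on the core only and through a single approximating
    sequence; [friedrichs_form] recovers the test against the whole form domain. *)
Definition friedrichs x y := exists2 u, h1_limit u x &
  forall phi, (fun n => form (u n) phi) @ \oo --> ip y (iota phi).

Lemma h1_cauchy_near u (eps : R) : h1_cauchy u -> 0 < eps ->
  \forall k \near \oo, \forall n \near \oo, nv (u n - u k) <= eps.
Proof.
move=> cu /cu[N hN]; exists N => // k /= Nk; exists N => // n /= Nn; exact: hN.
Qed.

Lemma h1_cauchy_cst phi : h1_cauchy (fun=> phi).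
Proof.
by move=> eps eps0; exists 0%N => m n _ _; rewrite subrr (seminorm0 psd_h1) ltW.
Qed.

Lemma h1_cauchy_bounded u : h1_cauchy u ->
  exists2 M : R, 0 < M & forall n, nv (u n) <= M.
Proof.
move=> /(_ 1 ltr01)[N hN].
pose M := \sum_(i < N.+1) nv (u i) + 1.
have S0 : 0 <= \sum_(i < N.+1) nv (u i) by apply: sumr_ge0 => i _; exact: seminorm_ge0.
have le_S (i : 'I_N.+1) : nv (u i) <= \sum_(i < N.+1) nv (u i).
  rewrite (bigD1 i)//= lerDl; apply: sumr_ge0 => j _; exact: seminorm_ge0.
exists M; first by rewrite /M; lra.
move=> n; have [nN|Nn] := ltnP n N.+1.
  by apply: (le_trans (le_S (Ordinal nN))); rewrite /M; lra.
rewrite -(subrK (u N) (u n)).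
apply: (le_trans (seminormD psd_h1 _ _)).
have := le_S ord_max; have := hN n N (ltnW Nn) (leqnn N); rewrite /M /=; lra.
Qed.

Lemma h1_cauchy_linear k u v : h1_cauchy u -> h1_cauchy v ->
  h1_cauchy (fun n => k *: u n + v n).
Proof.
move=> cu cv eps eps0.
(* The summand 1 guards the division against [k = 0]; the same device recurs in later estimates. *)
have k1 : 0 < `|k| + 1 by rewrite ltr_wpDl.
have e1 : 0 < eps / 2 / (`|k| + 1) by rewrite !divr_gt0.
have e2 : 0 < eps / 2 by rewrite divr_gt0.
have [N hN] := cu _ e1; have [N' hN'] := cv _ e2.
exists (maxn N N') => m n; rewrite !geq_max => /andP[Nm N'm] /andP[Nn N'n].
rewrite opprD addrACA -scalerBr.
apply: (le_trans (seminormD psd_h1 _ _)); rewrite (seminormZ psd_h1).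
apply: (@le_trans _ _ (eps / 2 + eps / 2)); last by lra.
apply: lerD; last exact: hN'.
apply: (@le_trans _ _ ((`|k| + 1) * (eps / 2 / (`|k| + 1)))); last first.
  by rewrite mulrC divfK// gt_eqF.
by apply: ler_pM => //; [exact: seminorm_ge0|rewrite lerDl|exact: hN].
Qed.

Lemma h1_cauchy_sum I (r : seq I) (c : I -> R) (u : I -> nat -> D) :
  (forall i, h1_cauchy (u i)) -> h1_cauchy (fun n => \sum_(i <- r) c i *: u i n).
Proof.
move=> cu; elim: r => [|i r IH].
  by under eq_fun do rewrite big_nil; exact: h1_cauchy_cst.
by under eq_fun do rewrite big_cons; exact: h1_cauchy_linear.
Qed.

(** This gives a form-bounded functional a value at elements of the form domain that are mere limits
    of core elements. *)
Lemma scalar_h1_cvg (L : D -> R) K u : scalar L ->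
  (forall phi, `|L phi| <= K * nv phi) -> h1_cauchy u -> cvgn (fun n => L (u n)).
Proof.
move=> linL boundL cu.
have K1 : 0 < `|K| + 1 by rewrite ltr_wpDl.
apply: R_complete; apply/cauchy_exP => eps eps0.
have [N hN] := cu (eps / 2 / (`|K| + 1)) ltac:(by rewrite !divr_gt0).
exists (L (u N)); exists N => // n /= Nn.
rewrite -ball_normE /= -(scalarB linL).
apply: (le_lt_trans (boundL _)).
apply: (@le_lt_trans _ _ ((`|K| + 1) * (eps / 2 / (`|K| + 1)))); last first.
  by rewrite mulrC divfK ?gt_eqF//; lra.
apply: (@le_trans _ _ ((`|K| + 1) * nv (u N - u n))).
  by apply: ler_wpM2r; [exact: seminorm_ge0|have := ler_norm K; lra].
by apply: ler_wpM2l; [exact: ltW|exact: hN].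
Qed.

Lemma xlim_linear k s t x y : xlim s x -> xlim t y ->
  xlim (fun n => k *: s n + t n) (k *: x + y).
Proof.
move=> sx ty.
apply: (@squeeze_cvgr _ _ _ _ (cst 0) (fun n => `|k| * nx (s n - x) + nx (t n - y))).
- near=> n; rewrite seminorm_ge0/= opprD addrACA -scalerBr.
  by apply: (le_trans (seminormD psd_ip _ _)); rewrite (seminormZ psd_ip).
- exact: cvg_cst.
- rewrite [X in _ --> X](_ : 0 = `|k| * 0 + 0); last by rewrite mulr0 addr0.
  by apply: cvgD => //; apply: cvgMr; exact: sx.
Unshelve. all: by end_near. Qed.

Lemma xlim_cst x : xlim (fun=> x) x.
Proof. by rewrite /xlim subrr (seminorm0 psd_ip); exact: cvg_cst. Qed.

Lemma ip_cvg s t x y : xlim s x -> xlim t y ->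
  (fun n => ip (s n) (t n)) @ \oo --> ip x y.
Proof.
move=> sx ty; apply/cvgrPdist_le => eps eps0.
have cv : (fun n => nx (s n - x) * (nx (t n - y) + nx y) + nx x * nx (t n - y))
    @ \oo --> 0 * (0 + nx y) + nx x * 0.
  apply: cvgD; last by apply: cvgMr.
  by apply: cvgM => //; apply: cvgD => //; exact: cvg_cst.
move/cvgrPdist_le : cv => /(_ _ eps0); rewrite mul0r mulr0 addr0.
apply: filterS => n; rewrite sub0r normrN => /(le_trans (ler_norm _)).
apply: le_trans; rewrite distrC.
have -> : ip (s n) (t n) - ip x y = ip (s n - x) (t n) + ip x (t n - y).
  by rewrite (scalarB (ip_lin.1 _)) (scalarB (ip_lin.2 _)); ring.
apply: (le_trans (ler_normD _ _)); apply: lerD; last exact: cauchy_schwarz_psd.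
apply: (le_trans (cauchy_schwarz_psd psd_ip _ _)).
apply: ler_wpM2l; first exact: seminorm_ge0.
by rewrite -{1}(subrK y (t n)); exact: seminormD.
Qed.

Lemma friedrichs_linear k x x' y y' : friedrichs x y -> friedrichs x' y' ->
  friedrichs (k *: x + x') (k *: y + y').
Proof.
move=> [u [cu ux] uy] [u' [cu' ux'] uy'].
exists (fun n => k *: u n + u' n).
  split; first exact: h1_cauchy_linear.
  rewrite [X in xlim X](_ : _ = fun n => k *: iota (u n) + iota (u' n)).
    exact: xlim_linear.
  by apply/funext => n; rewrite linearP.
move=> phi; have [[fl _] _ _] := psd_form_form.
rewrite (scalarD (ip_lin.1 _)) (scalar_scale (ip_lin.1 _)).
under eq_fun do rewrite fl.
by apply: cvgD; [apply: cvgMr; exact: uy|exact: uy'].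
Qed.

Lemma friedrichs0 : friedrichs 0 0.
Proof.
exists (fun=> 0); first split; first exact: h1_cauchy_cst.
- by rewrite linear0; exact: xlim_cst.
- move=> phi; have [[fl _] _ _] := psd_form_form.
  by rewrite (scalar0 (ip_lin.1 _)) (scalar0 (fl phi)); exact: cvg_cst.
Qed.

Lemma friedrichs_sum (I : Type) (r : seq I) (P : pred I) (c : I -> R) (x y : I -> X) :
  (forall i, P i -> friedrichs (x i) (y i)) ->
  friedrichs (\sum_(i <- r | P i) c i *: x i) (\sum_(i <- r | P i) c i *: y i).
Proof.
move=> H; elim: r => [|i r IH]; first by rewrite !big_nil; exact: friedrichs0.
rewrite !big_cons; case: ifP => // Pi.
by apply: friedrichs_linear => //; exact: H.
Qed.

Section Closable.

Hypothesis closable : forall u, h1_cauchy u ->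
  (fun n => nx (iota (u n))) @ \oo --> (0 : R) ->
  (fun n => nx (delta (u n))) @ \oo --> (0 : R).

Lemma h1_null u : h1_cauchy u -> (fun n => nx (iota (u n))) @ \oo --> (0 : R) ->
  (fun n => nv (u n)) @ \oo --> (0 : R).
Proof.
move=> cu iu; have du := closable cu iu.
apply: (@squeeze_cvgr _ _ _ _ (cst 0) (fun n => nx (iota (u n)) + nx (delta (u n)))).
- by apply: nearW => n; rewrite seminorm_ge0 h1_le_iota_delta.
- exact: cvg_cst.
- by rewrite -[X in _ --> X](addr0 0); exact: cvgD.
Qed.

Lemma h1_limit_unique u v x : h1_limit u x -> h1_limit v x ->
  (fun n => nv (u n - v n)) @ \oo --> (0 : R).
Proof.
move=> [cu ux] [cv vx].
rewrite (_ : (fun n => _) = fun n => nv (-1 *: v n + u n)); last first.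
  by apply/funext => n; rewrite scaleN1r addrC.
apply: h1_null; first exact: h1_cauchy_linear.
have := xlim_linear (-1) vx ux; rewrite /xlim scaleN1r addNr.
by under eq_fun do rewrite subr0 -linearP.
Qed.

(** Well-definedness of the closed form: its value does not depend on the approximating sequences.
    Here closability enters. *)
Lemma form_sub_null x y u u' v v' : h1_limit u x -> h1_limit u' x ->
  h1_limit v y -> h1_limit v' y ->
  (fun n => form (u n) (v n) - form (u' n) (v' n)) @ \oo --> (0 : R).
Proof.
move=> ux u'x vy v'y.
have [M M0 hM] := h1_cauchy_bounded vy.1.
have [M' M'0 hM'] := h1_cauchy_bounded u'x.1.
have [fl _ _] := psd_form_form.
have h : (fun n => nv (u n - u' n) * M + M' * nv (v n - v' n)) @ \oo --> 0 * M + M' * 0.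
  apply: cvgD; first by apply: cvgMl; exact: h1_limit_unique ux u'x.
  by apply: cvgMr; exact: h1_limit_unique vy v'y.
rewrite mul0r mulr0 addr0 in h.
apply/norm_cvg0P; apply: squeeze_cvgr h; last exact: (@cvg_cst _ 0).
apply: nearW => n; rewrite normr_ge0 /=.
have -> : form (u n) (v n) - form (u' n) (v' n) =
    form (u n - u' n) (v n) + form (u' n) (v n - v' n).
  by rewrite (scalarB (fl.1 _)) (scalarB (fl.2 _)); ring.
apply: le_trans (ler_normD _ _) _; apply: lerD; apply: le_trans (form_le_h1 _ _) _.
  by apply: ler_wpM2l => //; exact: seminorm_ge0.
by apply: ler_wpM2r => //; exact: seminorm_ge0.
Qed.

(** Both arguments move with [n], whereas the definition of [friedrichs] tests against a fixed core
    element. So [v n] is replaced by a late but fixed [v k], and [u] by the sequence [u0] of the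
    definition; each of the four errors is at most eps/4. *)
Lemma friedrichs_form x y z u v : friedrichs x y -> h1_limit u x ->
  h1_limit v z -> (fun n => form (u n) (v n)) @ \oo --> ip y z.
Proof.
move=> [u0 [cu0 u0x] u0y] ux [cv vz].
have [M M0 hM] := h1_cauchy_bounded cu0.
have [M' M'0 hM'] := h1_cauchy_bounded cv.
have [fl _ _] := psd_form_form.
apply/cvgrPdist_le => eps eps0.
have e1 : 0 < eps / 4 / M by rewrite !divr_gt0.
have e2 : 0 < eps / 4 / M' by rewrite !divr_gt0.
have e3 : 0 < eps / 4 / (nx y + 1) by rewrite !divr_gt0 ?ltr_wpDl ?seminorm_ge0.
have e4 : 0 < eps / 4 by rewrite divr_gt0.
have [k [kv kz]] : exists k, (\forall n \near \oo, nv (v n - v k) <= eps / 4 / M) /\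
    nx (iota (v k) - z) <= eps / 4 / (nx y + 1).
  have h1 := h1_cauchy_near cv e1.
  move/cvgrPdist_le : vz => /(_ _ e3) h2.
  have [k [hk1 hk2]] := filter_ex (filterI h1 h2); exists k; split => //.
  by move: hk2; rewrite sub0r normrN ger0_norm ?seminorm_ge0.
have := h1_limit_unique ux (conj cu0 u0x) => /cvgrPdist_le/(_ _ e2).
have /cvgrPdist_le/(_ _ e4) := u0y (v k).
apply: filterS3 kv => n h1 h2 h3.
rewrite sub0r normrN ger0_norm ?seminorm_ge0// in h3.
rewrite distrC.
have -> : form (u n) (v n) - ip y z = form (u n - u0 n) (v n)
   + form (u0 n) (v n - v k) + (form (u0 n) (v k) - ip y (iota (v k)))
   + ip y (iota (v k) - z).
  rewrite (scalarB (fl.1 _)) (scalarB (fl.2 _)) (scalarB (ip_lin.2 _)); ring.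
rewrite distrC in h2.
have b1 : `|form (u n - u0 n) (v n)| <= eps / 4.
  apply: (le_trans (form_le_h1 _ _)).
  rewrite -[leRHS](divfK (x := M')) ?gt_eqF//.
  by apply: ler_pM; rewrite ?seminorm_ge0.
have b2 : `|form (u0 n) (v n - v k)| <= eps / 4.
  apply: (le_trans (form_le_h1 _ _)).
  rewrite -[leRHS](divfK (x := M)) ?gt_eqF// mulrC.
  by apply: ler_pM; rewrite ?seminorm_ge0.
have b4 : `|ip y (iota (v k) - z)| <= eps / 4.
  apply: (le_trans (cauchy_schwarz_psd psd_ip _ _)).
  have ny : nx y + 1 != 0 by rewrite gt_eqF// ltr_wpDl ?seminorm_ge0.
  rewrite -[leRHS](divfK ny) mulrC.
  by apply: ler_pM; rewrite ?seminorm_ge0// lerDl.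
apply: (le_trans (ler_normD _ _)); apply: (le_trans (lerD (ler_normD _ _) (lexx _))).
apply: (le_trans (lerD (lerD (ler_normD _ _) (lexx _)) (lexx _))); lra.
Qed.

Lemma friedrichs_limit x y : friedrichs x y -> exists u, h1_limit u x.
Proof. by case=> u; exists u. Qed.

Lemma friedrichs_sym x y x' y' : friedrichs x y -> friedrichs x' y' ->
  ip y x' = ip x y'.
Proof.
move=> H H'; have [u ux] := friedrichs_limit H; have [v vx'] := friedrichs_limit H'.
have h1 := friedrichs_form H ux vx'.
have := friedrichs_form H' vx' ux.
rewrite (_ : (fun n => _) = fun n => form (u n) (v n)).
  by move=> h2; rewrite (cvg_unique _ h1 h2)// ip_sym.
by apply/funext => n; rewrite /form ip_sym.
Qed.

End Closable.
End Friedrichs.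

(** * Spectrum below a gap of finite codimension *)

Section SpectralAlternative.
Context {R : realType} {X D : lmodType R}.
Variables (ip : X -> X -> R) (iota delta : {linear D -> X}) (J : {linear X -> X}).
Hypothesis psd_ip : psd_form ip.
Hypothesis J_isometry : forall x, ip (J x) (J x) = ip x x.
Hypothesis J_skew : forall x, ip (J x) x = 0.

Local Notation nx := (seminorm ip).
Local Notation form := (form ip delta).
Local Notation mass := (mass ip iota).
Local Notation h1 := (h1 ip iota delta).
Local Notation nv := (seminorm h1).
Local Notation h1_cauchy := (h1_cauchy ip iota delta).
Local Notation h1_limit := (h1_limit ip iota delta).
Local Notation xlim := (xlim ip).
Local Notation friedrichs := (friedrichs ip iota delta).

Hypothesis complete : forall u, h1_cauchy u -> exists x, xlim (fun n => iota (u n)) x.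
Hypothesis closable : forall u, h1_cauchy u ->
  (fun n => nx (iota (u n))) @ \oo --> (0 : R) ->
  (fun n => nx (delta (u n))) @ \oo --> (0 : R).

Let ip_lin : bilinear_form ip. Proof. by case: psd_ip. Qed.
Let form_lin : bilinear_form form. Proof. by case: (psd_form_form delta psd_ip). Qed.
Let mass_lin : bilinear_form mass. Proof. by case: (psd_mass iota psd_ip). Qed.
Let psd_h1 : psd_form h1. Proof. exact: psd_h1. Qed.

Variables (r : nat) (e : 'I_r -> D) (a : 'I_r -> D -> R).
Hypothesis a_lin : forall i, scalar (a i).
Hypothesis a_bounded : forall i, exists K : R, forall phi, `|a i phi| <= K * nv phi.
Hypothesis a_e : forall i k, a i (e k) = (i == k)%:R.

(** Projection onto the common kernel of the [a i], where the gap inequality is assumed, along the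
    span of the [e i]. *)
Definition proj phi := phi - \sum_i a i phi *: e i.

Lemma projP k phi psi : proj (k *: phi + psi) = k *: proj phi + proj psi.
Proof.
rewrite /proj scalerBr addrACA -opprD; congr (_ - _).
rewrite scaler_sumr -big_split/=; apply: eq_bigr => i _.
by rewrite (scalarD (a_lin i)) (scalar_scale (a_lin i)) scalerDl scalerA.
Qed.

HB.instance Definition _ := GRing.isLinear.Build R D D *:%R proj projP.

Lemma projB phi psi : proj (phi - psi) = proj phi - proj psi.
Proof. exact: linearB. Qed.

Lemma a_proj i phi : a i (proj phi) = 0.
Proof.
rewrite (scalarB (a_lin i)) (scalar_sum (a_lin i)) (bigD1 i)//= big1 ?addr0.
  by rewrite (scalar_scale (a_lin i)) a_e eqxx mulr1 subrr.
by move=> j ji; rewrite (scalar_scale (a_lin i)) a_e eq_sym (negbTE ji) mulr0.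
Qed.

Lemma projK phi : proj phi + \sum_i a i phi *: e i = phi.
Proof. by rewrite subrK. Qed.

Variable c : R.
Hypothesis gap : forall phi, c * mass (proj phi) (proj phi) <= form (proj phi) (proj phi).

Section Shift.
Variables (s t : R).
Hypothesis ts : `|t| < c - s.

(** Real part of the form of H - (s + it); the complex number s + it acts on the real space as s + t
    J. *)
Definition shift phi psi := form phi psi - s * mass phi psi - t * ip (J (iota phi)) (iota psi).

Lemma shift_lin : bilinear_form shift.
Proof.
split=> [psi|phi] k p q; rewrite /shift.
  rewrite (form_lin.1 psi) (mass_lin.1 psi) !linearP (ip_lin.1 (iota psi)); ring.
by rewrite (form_lin.2 phi) (mass_lin.2 phi) !linearP (ip_lin.2 (J (iota phi))); ring.
Qed.

Lemma seminormJ x : nx (J x) = nx x. Proof. by rewrite /seminorm J_isometry. Qed.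

Let Lam := 1 + `|s| + `|t|.
Let Lam0 : 0 <= Lam. Proof. by rewrite !addr_ge0. Qed.

Lemma shift_bounded phi psi : `|shift phi psi| <= Lam * nv phi * nv psi.
Proof.
rewrite /shift; apply: (le_trans (ler_normB _ _)).
apply: (le_trans (lerD (ler_normB _ _) (lexx _))).
rewrite /Lam !mulrDl mul1r !normrM; apply: lerD; first apply: lerD.
- exact: form_le_h1.
- by rewrite -mulrA; apply: ler_wpM2l => //; exact: mass_le_h1.
- rewrite -mulrA; apply: ler_wpM2l => //.
  apply: (le_trans (cauchy_schwarz_psd psd_ip _ _)); rewrite seminormJ.
  by apply: ler_pM; rewrite ?seminorm_ge0 ?iota_le_h1.
Qed.

(** The symmetric part of [shift], composed with [proj] so that the gap makes it semidefinite on all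
    of [D]. *)
Let b phi psi := form (proj phi) (proj psi) - s * mass (proj phi) (proj psi).
Let cs : 0 < c - s. Proof. by apply: le_lt_trans ts. Qed.

Let b_ge phi : (c - s) * nx (iota (proj phi)) ^+ 2 <= b phi phi.
Proof. by rewrite (sqr_seminorm psd_ip) /b; have := gap phi; rewrite /mass; lra. Qed.

Let psd_b : psd_form b.
Proof.
split=> [|phi psi|phi].
- split=> [psi|phi] k p q; rewrite /b linearP.
    by rewrite (form_lin.1 (proj psi)) (mass_lin.1 (proj psi)); ring.
  by rewrite (form_lin.2 (proj phi)) (mass_lin.2 (proj phi)); ring.
- have [_ ms _] := psd_mass iota psd_ip; have [_ fs _] := psd_form_form delta psd_ip.
  by rewrite /b ms fs.
- by apply: le_trans (b_ge phi); rewrite mulr_ge0 ?sqr_ge0// ltW.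
Qed.
Local Notation nb := (seminorm b).

(** On the range of [proj], h1 = b + (1 + s) mass and mass <= b / (c - s); this yields the square of
    [kap]. *)
Let kap := Num.sqrt (1 + (1 + `|s|) / (c - s)).
Let kap0 : 0 <= kap. Proof. exact: sqrtr_ge0. Qed.

Let nv_le_nb phi : nv (proj phi) <= kap * nb phi.
Proof.
have h0 : 0 <= 1 + (1 + `|s|) / (c - s).
  by rewrite addr_ge0// divr_ge0 ?(ltW cs)// addr_ge0.
rewrite -(ler_pXn2r (n := 2)) ?nnegrE ?mulr_ge0 ?seminorm_ge0//.
rewrite exprMn (sqr_seminorm psd_h1) (sqr_seminorm psd_b) sqr_sqrtr//.
have := b_ge phi; rewrite (sqr_seminorm psd_ip) -ler_pdivlMl// => h.
have -> : h1 (proj phi) (proj phi) = b phi phi + (1 + s) * mass (proj phi) (proj phi).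
  by rewrite /b /h1; ring.
have m0 : 0 <= mass (proj phi) (proj phi) by case: (psd_mass iota psd_ip).
have b0 : 0 <= b phi phi by case: psd_b.
rewrite [leRHS]mulrDl mul1r lerD2l.
apply: (@le_trans _ _ ((1 + `|s|) * mass (proj phi) (proj phi))).
  by apply: ler_wpM2r => //; have := ler_norm s; lra.
by rewrite -mulrA; apply: ler_wpM2l => //; rewrite addr_ge0.
Qed.

Let skew phi psi := t * ip (J (iota (proj phi))) (iota (proj psi)).

Let skew_lin : bilinear_form skew.
Proof.
split=> [psi|phi] k p q; rewrite /skew !linearP.
  by rewrite (ip_lin.1 (iota (proj psi))); ring.
by rewrite (ip_lin.2 (J (iota (proj phi)))); ring.
Qed.

(** The mass is at most b / (c - s), so the contraction ratio is |t| / (c - s). That this is below 1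
    is exactly the assumption [ts]. *)
Let skew_bounded phi psi : `|skew phi psi| <= `|t| / (c - s) * (nb phi * nb psi).
Proof.
have sq0 : 0 < Num.sqrt (c - s) by rewrite sqrtr_gt0.
have le p : Num.sqrt (c - s) * nx (iota (proj p)) <= nb p.
  rewrite -(ler_pXn2r (n := 2)) ?nnegrE ?mulr_ge0 ?seminorm_ge0 ?sqrtr_ge0//.
  by rewrite exprMn sqr_sqrtr ?(ltW cs)// (sqr_seminorm psd_b).
rewrite normrM -mulrA; apply: ler_wpM2l => //.
apply: (le_trans (cauchy_schwarz_psd psd_ip _ _)); rewrite seminormJ.
rewrite ler_pdivlMl//.
apply: le_trans (ler_pM _ _ (le phi) (le psi)).
- by rewrite -{1}(sqr_sqrtr (ltW cs)) expr2 mulrACA.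
- by rewrite mulr_ge0 ?seminorm_ge0 ?sqrtr_ge0.
- by rewrite mulr_ge0 ?seminorm_ge0 ?sqrtr_ge0.
Qed.

(** Weak solution on the constrained subspace, given as a sequence of approximate Lax-Milgram
    solutions with tolerance 1/(n + 1). The constant [kappa] is chosen before [L], which later makes
    the resolvent bounded. *)
Lemma solve_proj : exists2 kappa : R, 0 <= kappa & forall (L : D -> R) (K : R),
  scalar L -> 0 <= K -> (forall phi, `|L phi| <= K * nv phi) ->
  exists u : nat -> D, [/\ forall i n, a i (u n) = 0, h1_cauchy u,
    forall n, nv (u n) <= kappa * K &
    forall phi, (fun n => shift (u n) (proj phi)) @ \oo --> L (proj phi)].
Proof.
(* In the [b]-seminorm a solution is at most twice K kap, once for [L] and once for the residual;
   the other [kap] comes from returning to [nv]. *)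
exists (2 * kap ^+ 2); first by rewrite mulr_ge0 ?sqr_ge0.
move=> L K linL K0 boundL.
have linL' : scalar (L \o proj) by move=> k p q /=; rewrite linearP linL.
have K'0 : 0 <= K * kap by rewrite mulr_ge0.
have boundL' phi : `|(L \o proj) phi| <= K * kap * nb phi.
  by apply: (le_trans (boundL _)); rewrite -mulrA; apply: ler_wpM2l.
have th : 0 <= `|t| / (c - s) < 1.
  by rewrite divr_ge0 ?(ltW cs)//= ltr_pdivrMr// mul1r.
have sol n := approximate_lax_milgram psd_b skew_lin th skew_bounded linL' K'0
  boundL' (divr_gt0 (@ltr01 R) (ltr0Sn R n)).
have /choice[v hv] n : exists v, forall phi, `|L (proj phi) - shift (proj v) (proj phi)|
    <= K * kap / n.+1%:R * nb phi.
  have [v hv] := sol n; exists v => phi; have := hv phi; rewrite div1r; exact.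
have shift_b phi : shift (proj phi) (proj phi) = b phi phi.
  by rewrite /shift /b J_skew mulr0 subr0.
have [b_lin _ _] := psd_b.
exists (fun n => proj (v n)); split.
- by move=> i n; exact: a_proj.
(* The two approximate equations are subtracted and tested with [v m - v n] itself; on the diagonal
   the J-term drops out and only [b] remains. *)
- have key m n : nb (v m - v n) <= K * kap / m.+1%:R + K * kap / n.+1%:R.
    have h := hv m (v m - v n); have h' := hv n (v m - v n).
    have [n0|n0] := lerP (nb (v m - v n)) 0.
      by apply: (le_trans n0); rewrite addr_ge0// divr_ge0.
    rewrite -(ler_pM2r n0) -expr2 (sqr_seminorm psd_b) -shift_b.
    rewrite {1}projB (scalarB (shift_lin.1 _)).
    move: h h'; rewrite !ler_norml mulrDl => /andP[l1 _] /andP[_ l2].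
    have := lerD l2 l1.
    move: (L _) (shift _ _) (shift _ _) (K * kap / _ * _) (K * kap / _ * _).
    move=> *; lra.
  move=> eps eps0.
  have K1 : 0 < 2 * (kap * (K * kap)) + 1 by rewrite ltr_wpDl// !mulr_ge0.
  have /cvgrPdist_le/(_ _ (divr_gt0 eps0 K1))[N _ hN] := @cvg_harmonic R.
  have N1 n : (N <= n)%N -> n.+1%:R^-1 <= eps / (2 * (kap * (K * kap)) + 1).
    by move=> /hN /=; rewrite sub0r normrN ger0_norm// invr_ge0.
  exists N => m n /N1 Nm /N1 Nn; rewrite -linearB.
  apply: (le_trans (nv_le_nb _)).
  apply: (le_trans (ler_wpM2l kap0 (key m n))).
  apply: (@le_trans _ _ ((2 * (kap * (K * kap)) + 1) * (eps / (2 * (kap * (K * kap)) + 1)))).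
    have d0 : 0 <= eps / (2 * (kap * (K * kap)) + 1) by rewrite divr_ge0 // ltW.
    have kk : 0 <= kap * (K * kap) by rewrite !mulr_ge0.
    move: (ler_wpM2l kk Nm) (ler_wpM2l kk Nn) d0.
    move: (m.+1%:R^-1) (n.+1%:R^-1) (eps / _) => x y z.
    move: (K * kap) => w; nra.
  by rewrite mulrC divfK// gt_eqF.
- move=> n; apply: (le_trans (nv_le_nb _)).
  rewrite -mulrA expr2 -mulrA mulrCA; apply: ler_wpM2l => //.
  have h := hv n (v n).
  have [n0|n0] := lerP (nb (v n)) 0.
    by apply: (le_trans n0); rewrite !mulr_ge0.
  rewrite -(ler_pM2r n0) -expr2 (sqr_seminorm psd_b) -shift_b.
  move: h; rewrite ler_norml => /andP[h1 h2].
  have := boundL' (v n); rewrite ler_norml => /andP[h3 h4].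
  have d1 : K * kap / n.+1%:R <= K * kap.
    by rewrite ler_pdivrMr// ler_peMr// ler1n.
  have := ler_wpM2r (ltW n0) d1; move: h1 h4 => /=.
  move: (L _) (shift _ _) (K * kap / _ * _) => x y z; lra.
- move=> phi; apply/cvgrPdist_le => eps eps0.
  have K1 : 0 < K * kap * nb phi + 1 by rewrite ltr_wpDl// !mulr_ge0// seminorm_ge0.
  have /cvgrPdist_le/(_ _ (divr_gt0 eps0 K1)) := @cvg_harmonic R.
  apply: filterS => n /=; rewrite sub0r normrN ger0_norm ?invr_ge0// => hn.
  apply: (le_trans (hv n phi)).
  apply: (@le_trans _ _ ((K * kap * nb phi + 1) * (eps / (K * kap * nb phi + 1)))).
    rewrite mulrAC; apply: ler_pM => //; last by rewrite lerDl.
    by rewrite !mulr_ge0// seminorm_ge0.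
  by rewrite mulrC divfK// gt_eqF.
Qed.

Lemma shift_friedrichs f x y : h1_limit f x ->
  (forall phi, (fun n => shift (f n) phi) @ \oo --> ip y (iota phi)) ->
  friedrichs x (y + (s *: x + t *: J x)).
Proof.
move=> fx fy; exists f => // phi.
rewrite !(scalarD (ip_lin.1 _)) !(scalar_scale (ip_lin.1 _)).
rewrite (_ : (fun n => _) = fun n => shift (f n) phi +
  (s * mass (f n) phi + t * ip (J (iota (f n))) (iota phi))); last first.
  by apply/funext => n; rewrite /shift; ring.
apply: cvgD => //; apply: cvgD; apply: cvgMr.
  by apply: ip_cvg => //; [case: fx|exact: xlim_cst].
apply: ip_cvg => //; last exact: xlim_cst.
case: fx => _; rewrite /xlim; under eq_fun do rewrite -seminormJ linearB.
exact.
Qed.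

(** An equation on the range of [proj] together with the equations at the [e i] gives the equation
    on all of [D]. *)
Lemma shift_cvg (L : D -> R) f : scalar L ->
  (forall phi, (fun n => shift (f n) (proj phi)) @ \oo --> L (proj phi)) ->
  (forall i, (fun n => shift (f n) (e i)) @ \oo --> L (e i)) ->
  forall phi, (fun n => shift (f n) phi) @ \oo --> L phi.
Proof.
move=> linL fp fe phi; rewrite -(projK phi) (scalarD linL) (scalar_sum linL).
under eq_fun do rewrite (scalarD (shift_lin.2 _)) (scalar_sum (shift_lin.2 _)).
apply: cvgD => //.
under eq_fun do under eq_bigr do rewrite (scalar_scale (shift_lin.2 _)).
under eq_bigr do rewrite (scalar_scale linL).
by apply: cvg_big => [|i _]; [exact: add_continuous|apply: cvgMr; exact: fe].
Qed.

(** Schur complement with respect to the splitting of [D] into the range of [proj] and the span of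
    the [e i]. The matrix [M] below describes the remaining finite-dimensional equation: a kernel
    vector yields an eigenvector, an inverse yields the resolvent. *)
Lemma resolvent_alternative :
  (exists2 x, ip x x != 0 & friedrichs x (s *: x + t *: J x)) \/
  (forall y, exists x, friedrichs x (y + (s *: x + t *: J x))) /\
  (exists C : R, forall x y, friedrichs x (y + (s *: x + t *: J x)) ->
     ip x x <= C * ip y y).
Proof.
have [ex|nex] := pselect (exists2 x, ip x x != 0 & friedrichs x (s *: x + t *: J x)).
  by left.
right.
have [kappa kappa0 solve] := solve_proj.
have LamE i phi : `|shift (e i) phi| <= Lam * nv (e i) * nv phi by exact: shift_bounded.
have Lame0 i : 0 <= Lam * nv (e i) by rewrite mulr_ge0 ?seminorm_ge0.
have /choice[v hv] i := solve _ _ (shift_lin.2 (e i)) (Lame0 i) (LamE i).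
(* [y i] corrects [e i] inside the constrained subspace so that the homogeneous equation holds in
   the limit against every [proj phi]; its coordinates [a k] are still those of [e i]. *)
pose y i n := e i - v i n.
have cy i : h1_cauchy (y i).
  rewrite /y (_ : (fun n => _) = fun n => -1 *: v i n + e i).
    by apply: h1_cauchy_linear => //; [case: (hv i)|exact: h1_cauchy_cst].
  by apply/funext => n; rewrite scaleN1r addrC.
have ay k i n : a k (y i n) = (k == i)%:R.
  by rewrite (scalarB (a_lin k)) a_e; case: (hv i) => -> _ _ _; rewrite subr0.
have yproj i phi : (fun n => shift (y i n) (proj phi)) @ \oo --> (0 : R).
  under eq_fun do rewrite (scalarB (shift_lin.1 _)).
  rewrite -(subrr (shift (e i) (proj phi))); apply: cvgB; first exact: cvg_cst.
  by case: (hv i).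
have cvg_e w j : h1_cauchy w -> cvgn (fun n => shift (w n) (e j)).
  have boundE phi : `|shift phi (e j)| <= Lam * nv (e j) * nv phi.
    by rewrite mulrAC; exact: shift_bounded.
  exact: (scalar_h1_cvg (shift_lin.1 (e j)) boundE).
pose M : 'M[R]_r := \matrix_(i, j) limn (fun n => shift (y i n) (e j)).
have My i j : (fun n => shift (y i n) (e j)) @ \oo --> M i j.
  by rewrite mxE; apply: cvg_e.
have comb_shift (z : 'I_r -> R) n psi :
    shift (\sum_i z i *: y i n) psi = \sum_i z i * shift (y i n) psi.
  rewrite (scalar_sum (shift_lin.1 psi)).
  by apply: eq_bigr => i _; rewrite (scalar_scale (shift_lin.1 psi)).
have comb_cvg (z : 'I_r -> R) j :
    (fun n => shift (\sum_i z i *: y i n) (e j)) @ \oo --> \sum_i z i * M i j.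
  under eq_fun do rewrite comb_shift.
  by apply: cvg_big => [|i _]; [exact: add_continuous|apply: cvgMr; exact: My].
have comb_proj (z : 'I_r -> R) phi :
    (fun n => shift (\sum_i z i *: y i n) (proj phi)) @ \oo --> (0 : R).
  under eq_fun do rewrite comb_shift.
  have : (fun n => \sum_i z i * shift (y i n) (proj phi)) @ \oo --> \sum_i z i * 0.
    by apply: cvg_big => [|i _]; [exact: add_continuous|apply: cvgMr; exact: yproj].
  by rewrite big1// => i _; rewrite mulr0.
have unitM : M \in unitmx.
  rewrite unitmxE unitfE; apply/negP => /det0P[z z0 zM]; apply: nex.
  pose f n := \sum_i z 0 i *: y i n.
  have cf : h1_cauchy f by exact: h1_cauchy_sum.
  have [x fx] := complete cf; exists x; last first.
    rewrite -[X in friedrichs _ X]add0r.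
    apply: (shift_friedrichs (f := f)) => // phi; rewrite (scalar0 (ip_lin.1 _)).
    apply: (shift_cvg (L := fun=> 0)) => // [k p q|psi|j]; first by rewrite mulr0 addr0.
      exact: comb_proj.
    have := comb_cvg (z 0) j.
    by move/matrixP : zM => /(_ 0 j); rewrite mxE [X in _ = X -> _]mxE => ->.
  (* The eigenvector is not null: otherwise closability would force [f n] to 0 in form norm, hence
     also [a k (f n)], which is constantly [z 0 k]. *)
  apply: contra z0 => /eqP ipx0.
  have nf : (fun n => nv (f n)) @ \oo --> (0 : R).
    apply: h1_null => //; apply: squeeze_cvgr fx; last exact: (@cvg_cst _ 0).
    apply: nearW => n; rewrite seminorm_ge0/= -{1}(subrK x (iota (f n))).
    apply: le_trans (seminormD psd_ip _ _) _.
    by rewrite /seminorm ipx0 sqrtr0 addr0.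
  apply/eqP/rowP => k; rewrite [RHS]mxE.
  have af n : a k (f n) = z 0 k.
    rewrite (scalar_sum (a_lin k)) (bigD1 k)//= (scalar_scale (a_lin k)) ay eqxx mulr1.
    rewrite big1 ?addr0// => i ik.
    by rewrite (scalar_scale (a_lin k)) ay eq_sym (negbTE ik) mulr0.
  have [K hK] := a_bounded k.
  have : (fun n => K * nv (f n)) @ \oo --> K * 0 by apply: cvgMr.
  rewrite mulr0 => /cvgrPdist_le h0.
  apply/eqP; rewrite -normr_le0; apply/ler_addgt0Pr => eps eps0; rewrite add0r.
  have [n] := filter_ex (h0 _ eps0); rewrite sub0r normrN => /(le_trans (ler_norm _)).
  by apply: le_trans; rewrite -(af n); exact: hK.
pose Mi := invmx M.
have /choice[Y hY] i : exists Y, 0 <= Y /\ forall n, nv (y i n) <= Y.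
  by have [Y Y0 hY] := h1_cauchy_bounded psd_ip (cy i); exists Y; rewrite ltW.
pose B j := nv (e j) + Lam * kappa * nv (e j).
pose C := kappa + \sum_i (\sum_j B j * `|Mi j i|) * Y i.
have solution g : exists x, friedrichs x (g + (s *: x + t *: J x)) /\ nx x <= C * nx g.
  pose L phi := ip g (iota phi).
  have linL : scalar L by move=> k p q; rewrite /L linearP (ip_lin.2 g).
  have boundL phi : `|L phi| <= nx g * nv phi.
    apply: le_trans (cauchy_schwarz_psd psd_ip _ _) _.
    by apply: ler_wpM2l; [exact: seminorm_ge0|exact: iota_le_h1].
  have ng0 : 0 <= nx g by exact: seminorm_ge0.
  have [u [_ cu bu uL]] := solve L (nx g) linL ng0 boundL.
  (* The defect that the constrained solution [u] leaves at [e j]; a combination of the [y i] with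
     coefficients b' M^-1 removes it without disturbing the equation on the range of [proj]. *)
  pose b' j := L (e j) - limn (fun n => shift (u n) (e j)).
  have bb' j : `|b' j| <= B j * nx g.
    rewrite /b' mulrDl; apply: le_trans (ler_normB _ _) _; apply: lerD.
      by rewrite mulrC; exact: boundL.
    have h : (fun n => `|shift (u n) (e j)|) @ \oo --> `|limn (fun n => shift (u n) (e j))|.
      by apply: cvg_norm; exact: cvg_e.
    rewrite -(cvg_lim _ h)//; apply: limr_le; first by apply/cvg_ex; eexists; exact: h.
    apply: nearW => n; apply: le_trans (shift_bounded _ _) _.
    have -> : Lam * kappa * nv (e j) * nx g = Lam * (kappa * nx g) * nv (e j) by ring.
    by apply: ler_wpM2r; [exact: seminorm_ge0|exact: ler_wpM2l].
  pose z i := \sum_j b' j * Mi j i.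
  have zM j : \sum_i z i * M i j = b' j.
    have /matrixP/(_ 0 j) := mulmxKV unitM (\row_j b' j); rewrite !mxE => <-.
    apply: eq_bigr => i _; congr (_ * _); rewrite mxE.
    by apply: eq_bigr => k _; rewrite mxE.
  pose f n := 1 *: u n + \sum_i z i *: y i n.
  have cf : h1_cauchy f by apply: h1_cauchy_linear => //; exact: h1_cauchy_sum.
  have [x fx] := complete cf; exists x; split.
    apply: (shift_friedrichs (f := f)) => // phi.
    apply: (shift_cvg (L := L)) => // [psi|j].
      under eq_fun do rewrite /f scale1r (scalarD (shift_lin.1 _)).
      by rewrite -[L _]addr0; apply: cvgD => //; exact: comb_proj.
    under eq_fun do rewrite /f scale1r (scalarD (shift_lin.1 _)).
    have -> : L (e j) = limn (fun n => shift (u n) (e j)) + \sum_i z i * M i j.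
      by rewrite zM /b' addrC subrK.
    by apply: cvgD; [exact: cvg_e|exact: comb_cvg].
  have bf n : nv (f n) <= C * nx g.
    rewrite /f scale1r mulrDl; apply: le_trans (seminormD psd_h1 _ _) _.
    apply: lerD => //; apply: le_trans (seminorm_sum psd_h1 _ _) _.
    rewrite mulr_suml; apply: ler_sum => i _; rewrite (seminormZ psd_h1).
    rewrite mulrAC; apply: ler_pM => //; last by case: (hY i).
      exact: seminorm_ge0.
    apply: le_trans (ler_norm_sum _ _ _) _; rewrite mulr_suml; apply: ler_sum => j _.
    by rewrite normrM mulrAC; apply: ler_wpM2r.
  apply/ler_addgt0Pr => eps eps0.
  have /cvgrPdist_le/(_ _ eps0) := fx => h; have [n] := filter_ex h.
  rewrite sub0r normrN ger0_norm ?seminorm_ge0// => hn.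
  rewrite -(subrK (iota (f n)) x) [leRHS]addrC; apply: le_trans (seminormD psd_ip _ _) _.
  apply: lerD; first by rewrite (seminorm_distC psd_ip).
  by apply: le_trans (bf n); exact: iota_le_h1.
split; first by move=> g; have [x [hx _]] := solution g; exists x.
exists (C ^+ 2) => x g hx.
have [x' [hx' nx']] := solution g.
(* In the absence of eigenvectors, two solutions differ by a null vector, so the bound on the
   constructed solution holds for every solution. *)
have ip0 : ip (x - x') (x - x') = 0.
  apply/eqP; apply: contraT => ne0; exfalso; apply: nex; exists (x - x') => //.
  have := friedrichs_linear psd_ip (-1) hx' hx.
  rewrite !scaleN1r [X in friedrichs X _]addrC; congr (friedrichs _ _).
  rewrite (linearB J) !scalerBr [RHS]addrACA -opprD [LHS]addrC.
  by rewrite [X in X - _]addrC addrKA.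
have C0 : 0 <= C.
  rewrite addr_ge0//; apply: sumr_ge0 => i _; rewrite mulr_ge0//; last by case: (hY i).
  by apply: sumr_ge0 => j _; rewrite mulr_ge0// addr_ge0 ?mulr_ge0 ?seminorm_ge0.
have hnx : nx x <= C * nx g.
  rewrite -(subrK x' x); apply: le_trans (seminormD psd_ip _ _) _.
  by rewrite /seminorm ip0 sqrtr0 add0r.
rewrite -!(sqr_seminorm psd_ip) -exprMn ler_pXn2r ?nnegrE ?mulr_ge0 ?seminorm_ge0//.
Qed.

End Shift.

Lemma h1_limit_sum I (q : seq I) (z : I -> R) (u : I -> nat -> D) (x : I -> X) :
  (forall i, h1_limit (u i) (x i)) ->
  h1_limit (fun n => \sum_(i <- q) z i *: u i n) (\sum_(i <- q) z i *: x i).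
Proof.
move=> ux; elim: q => [|i q [IH1 IH2]].
  split; first by under eq_fun do rewrite big_nil; exact: h1_cauchy_cst.
  by rewrite big_nil; under eq_fun do rewrite big_nil linear0; exact: xlim_cst.
have [cu xu] := ux i; split.
  by under eq_fun do rewrite big_cons; exact: h1_cauchy_linear.
rewrite big_cons; under eq_fun do rewrite big_cons linearP.
exact: xlim_linear.
Qed.

Lemma proj_bounded : exists2 K : R, 0 <= K & forall phi, nv (proj phi) <= K * nv phi.
Proof.
have /choice[K hK] := a_bounded.
exists (1 + \sum_i `|K i| * nv (e i)).
  by rewrite addr_ge0//; apply: sumr_ge0 => i _; rewrite mulr_ge0// seminorm_ge0.
move=> phi; rewrite mulrDl mul1r mulr_suml.
apply: le_trans (seminormB psd_h1 _ _) _; rewrite lerD2l.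
apply: le_trans (seminorm_sum psd_h1 _ _) _; apply: ler_sum => i _.
rewrite (seminormZ psd_h1) mulrAC; apply: ler_wpM2r; first exact: seminorm_ge0.
apply: le_trans (hK i phi) _; apply: ler_wpM2r; first exact: seminorm_ge0.
exact: ler_norm.
Qed.

(** The gap is known only on the range of [proj]. If the coordinates [a i (u n)] tend to 0, then
    [proj (u n)] has the same limit [x], and the inequality survives. *)
Lemma gap_limit x y u : friedrichs x y -> h1_limit u x ->
  (forall i, (fun n => a i (u n)) @ \oo --> (0 : R)) -> c * ip x x <= ip y x.
Proof.
move=> xy [cu ux] au.
have pux : h1_limit (fun n => proj (u n)) x.
  split.
    have [K K0 hK] := proj_bounded.
    move=> eps eps0; have K1 : 0 < K + 1 by rewrite ltr_wpDl.
    have [N hN] := cu _ (divr_gt0 eps0 K1); exists N => m n Nm Nn.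
    rewrite -projB; apply: le_trans (hK _) _.
    apply: (@le_trans _ _ ((K + 1) * (eps / (K + 1)))).
      by apply: ler_pM; rewrite ?seminorm_ge0 ?lerDl//; exact: hN.
    by rewrite mulrC divfK// gt_eqF.
  have : (fun n => nx (iota (u n) - x) + \sum_i `|a i (u n)| * nx (iota (e i)))
      @ \oo --> 0 + \sum_i `|0 : R| * nx (iota (e i)).
    apply: cvgD => //; apply: cvg_big => [|i _]; first exact: add_continuous.
    by apply: cvgMl; apply: cvg_norm; exact: au.
  rewrite add0r big1; last by move=> i _; rewrite normr0 mul0r.
  apply: squeeze_cvgr; last exact: (@cvg_cst _ 0).
  apply: nearW => n; rewrite seminorm_ge0/= linearB addrAC.
  apply: le_trans (seminormB psd_ip _ _) _; rewrite lerD2l linear_sum.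
  apply: le_trans (seminorm_sum psd_ip _ _) _; apply: ler_sum => i _.
  by rewrite linearZ (seminormZ psd_ip).
have h1 := friedrichs_form psd_ip closable xy pux pux.
have h2 : (fun n => c * mass (proj (u n)) (proj (u n))) @ \oo --> c * ip x x.
  by apply: cvgMr; apply: ip_cvg => //; case: pux.
rewrite -(cvg_lim _ h1)// -(cvg_lim _ h2)//.
by apply: ler_lim; [apply/cvg_ex; eexists; exact: h2|apply/cvg_ex; eexists; exact: h1|
  apply: nearW => n; exact: gap].
Qed.

Definition eigenfamily k (x : 'I_k -> X) (mu : 'I_k -> R) :=
  [/\ forall i, mu i < c, forall i, friedrichs (x i) (mu i *: x i) &
      forall i j, ip (x i) (x j) = (i == j)%:R].

Lemma ip_sum_orthonormal k (x : 'I_k -> X) (z w : 'I_k -> R) :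
  (forall i j, ip (x i) (x j) = (i == j)%:R) ->
  ip (\sum_i z i *: x i) (\sum_i w i *: x i) = \sum_i z i * w i.
Proof.
move=> orth; rewrite (scalar_sum (ip_lin.1 _)); apply: eq_bigr => i _.
rewrite (scalar_scale (ip_lin.1 _)) (scalar_sum (ip_lin.2 _)) (bigD1 i)//=.
rewrite (scalar_scale (ip_lin.2 _)) orth eqxx mulr1 big1 ?addr0// => j ji.
by rewrite (scalar_scale (ip_lin.2 _)) orth eq_sym (negbTE ji) mulr0.
Qed.

(** With more than [r] members, some nontrivial combination satisfies all [r] constraints in the
    limit, so [gap_limit] applies to it. By orthonormality this reads sum (c - mu_i) z_i^2 <= 0,
    impossible as every [mu i] is below [c]. *)
Lemma eigenfamily_size k (x : 'I_k -> X) (mu : 'I_k -> R) :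
  eigenfamily x mu -> (k <= r)%N.
Proof.
move=> [mu_c eig orth]; rewrite leqNgt; apply/negP => rk.
have /choice[u hu] i := friedrichs_limit (eig i).
have acvg j i : cvgn (fun n => a j (u i n)).
  have [K hK] := a_bounded j; case: (hu i) => cu _.
  exact: (scalar_h1_cvg (a_lin j) hK).
pose M : 'M[R]_(k, r) := \matrix_(i, j) limn (fun n => a j (u i n)).
have : kermx M != 0.
  by rewrite kermx_eq0 /row_free; apply/eqP; have := rank_leq_col M; lia.
move=> /rowV0Pn[z /sub_kermxP zM z0].
have XY := friedrichs_sum psd_ip (index_enum 'I_k) (P := predT) (z 0) (fun i _ => eig i).
have UX := h1_limit_sum (index_enum 'I_k) (z 0) hu.
have UX0 j : (fun n => a j (\sum_i z 0 i *: u i n)) @ \oo --> (0 : R).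
  rewrite (_ : (fun n => _) = fun n => \sum_i z 0 i * a j (u i n)); last first.
    apply/funext => n; rewrite (scalar_sum (a_lin j)).
    by apply: eq_bigr => i _; rewrite (scalar_scale (a_lin j)).
  have : (fun n => \sum_i z 0 i * a j (u i n)) @ \oo --> \sum_i z 0 i * M i j.
    apply: cvg_big => [|i _]; first exact: add_continuous.
    by apply: cvgMr; rewrite mxE; exact: acvg.
  by move/matrixP : zM => /(_ 0 j); rewrite mxE [X in _ = X -> _]mxE => ->.
have := gap_limit XY UX UX0.
have -> : \sum_i z 0 i *: (mu i *: x i) = \sum_i (z 0 i * mu i) *: x i.
  by apply: eq_bigr => i _; rewrite scalerA.
rewrite !ip_sum_orthonormal//.
rewrite mulr_sumr -subr_ge0 -sumrB => h.
case/negP: z0; apply/eqP/rowP => i; rewrite [RHS]mxE.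
have pos j : 0 <= - (z 0 j * mu j * z 0 j - c * (z 0 j * z 0 j)).
  rewrite (_ : - _ = z 0 j ^+ 2 * (c - mu j)); last by ring.
  by rewrite mulr_ge0 ?sqr_ge0// subr_ge0 ltW.
have : - (z 0 i * mu i * z 0 i - c * (z 0 i * z 0 i)) <= 0.
  move: h; rewrite -oppr_le0 -sumrN; apply: le_trans.
  by rewrite (bigD1 i)//= lerDl sumr_ge0.
rewrite (_ : - _ = z 0 i ^+ 2 * (c - mu i)); last by ring.
by rewrite pmulr_lle0 ?subr_gt0// => le0; apply/eqP; rewrite -sqrf_eq0 eq_le le0 sqr_ge0.
Qed.

(** A family of maximal size spans every eigenspace below [c] up to null vectors: the residual [y']
    is orthogonal to the members with eigenvalue [m] by construction and to the others by symmetry,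
    so if it were not null it could be normalized and appended. *)
Lemma eigenfamily_maximal : exists k (x : 'I_k -> X) (mu : 'I_k -> R),
  eigenfamily x mu /\ forall m y, m < c -> friedrichs y (m *: y) ->
    let y' := y - \sum_(i | mu i == m) ip y (x i) *: x i in ip y' y' = 0.
Proof.
pose fam k := `[< exists (x : 'I_k -> X) mu, eigenfamily x mu >].
have fam0 : exists k, fam k.
  exists 0%N; apply/asboolP; exists (fun=> 0), (fun=> 0).
  by split; case.
have fam_le k : fam k -> (k <= r)%N.
  by move=> /asboolP[x [mu h]]; exact: eigenfamily_size h.
case: (ex_maxnP fam0 fam_le) => k /asboolP[x [mu h]] kmax.
have [mu_c eig orth] := h.
exists k, x, mu; split=> // m y mc ym y'.
have eig' : friedrichs y' (m *: y').
  have eigm i : mu i == m -> friedrichs (x i) (m *: x i) by move=> /eqP <-.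
  have := friedrichs_sum psd_ip (index_enum 'I_k) (fun i => ip y (x i)) eigm.
  move=> /(friedrichs_linear psd_ip (-1)) /(_ ym).
  rewrite (_ : \sum_(i | _) _ *: (m *: _) = m *: \sum_(i | mu i == m) ip y (x i) *: x i).
    by rewrite /y' scalerBr !scaleN1r ![- _ + _]addrC.
  by rewrite scaler_sumr; apply: eq_bigr => i _; rewrite !scalerA mulrC.
have orth' i : ip y' (x i) = 0.
  rewrite (scalarB (ip_lin.1 _)) (scalar_sum (ip_lin.1 _)).
  have [mi|mi] := eqVneq (mu i) m.
    rewrite (bigD1 i) ?mi//= (scalar_scale (ip_lin.1 _)) orth eqxx mulr1.
    rewrite big1 ?addr0 ?subrr// => j /andP[_ ji].
    by rewrite (scalar_scale (ip_lin.1 _)) orth (negbTE ji) mulr0.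
  rewrite big1 ?subr0; last first.
    move=> j /eqP mj; rewrite (scalar_scale (ip_lin.1 _)) orth.
    case: eqP => [ji|]; last by rewrite mulr0.
    by rewrite ji in mj; rewrite mj eqxx in mi.
  have := friedrichs_sym psd_ip closable ym (eig i).
  rewrite (scalar_scale (ip_lin.1 _)) (scalar_scale (ip_lin.2 _)) => /eqP.
  rewrite -subr_eq0 -mulrBl mulf_eq0 subr_eq0 [m == _]eq_sym (negbTE mi)/=.
  by move=> /eqP.
apply/eqP; apply: contraT => ne0; exfalso.
have ny0 : nx y' != 0.
  by have [_ _ ip0] := psd_ip; rewrite sqrtr_eq0 -ltNge lt_neqAle eq_sym ne0 ip0.
pose x' (i : 'I_(k + 1)) := if fintype.split i is inl j then x j else (nx y')^-1 *: y'.
pose mu' (i : 'I_(k + 1)) := if fintype.split i is inl j then mu j else m.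
suff /kmax : fam (k + 1)%N by lia.
apply/asboolP; exists x', mu'; split.
- by move=> i; rewrite /mu'; case: splitP.
- move=> i; rewrite /mu' /x'; case: splitP => // _ _.
  have := friedrichs_linear psd_ip (nx y')^-1 eig' (friedrichs0 iota delta psd_ip).
  by rewrite !addr0 !scalerA mulrC.
- have ip_sym p q : ip p q = ip q p by case: psd_ip.
  move=> i j; rewrite /x'; case: splitP => i' hi; case: splitP => j' hj.
  + by rewrite orth -!val_eqE /= hi hj.
  + rewrite (scalar_scale (ip_lin.2 _)) ip_sym orth' mulr0 -val_eqE /= hi hj.
    by rewrite (_ : (_ == _) = false)//; have := ltn_ord i'; lia.
  + rewrite (scalar_scale (ip_lin.1 _)) orth' mulr0 -val_eqE /= hi hj.
    by rewrite (_ : (_ == _) = false)//; have := ltn_ord j'; lia.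
  + rewrite (scalar_scale (ip_lin.1 _)) (scalar_scale (ip_lin.2 _)).
    rewrite -(sqr_seminorm psd_ip) expr2 mulKf// mulVf//.
    by rewrite !ord1 in hi hj; rewrite -val_eqE/= hi hj eqxx.
Qed.

End SpectralAlternative.

(** * Functions on an interval *)

Section SquareIntegrable.
Context {R : realType}.
Implicit Types (l s x y z : R) (f g u v w F : R -> R).
Local Notation mu := (@lebesgue_measure R).
Local Notation itg f x y := (\int[mu]_(t in `[x, y]) f t).

Definition integrable_on l f := mu.-integrable `[0, l] (EFin \o f).

Definition square_integrable l w :=
  measurable_fun `[0, l] w /\ integrable_on l (fun x => w x ^+ 2).

Lemma integrable_onD l f g : integrable_on l f -> integrable_on l g ->
  integrable_on l (fun x => f x + g x).
Proof.
move=> fi gi; rewrite /integrable_on.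
rewrite (_ : EFin \o _ = (EFin \o f) \+ (EFin \o g)); last by apply/funext.
exact: integrableD.
Qed.

Lemma integrable_onZ l k f : integrable_on l f -> integrable_on l (fun x => k * f x).
Proof.
move=> fi; rewrite /integrable_on.
rewrite (_ : EFin \o _ = (fun x => k%:E * (EFin \o f) x)%E); last by apply/funext.
exact: integrableZl.
Qed.

Lemma integrable_on_norm l f : integrable_on l f -> integrable_on l (fun x => `|f x|).
Proof. by move=> fi; apply: integrable_norm. Qed.

Lemma integrable_on_cst l k : integrable_on l (fun=> k).
Proof.
apply: (continuous_compact_integrable (f := cst k)); first exact: segment_compact.
by move=> ?; exact: cvg_cst.
Qed.

Lemma integrable_on_measurable l f : integrable_on l f -> measurable_fun `[0, l] f.
Proof. by move=> /measurable_int/measurable_EFinP. Qed.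

Lemma dominated_integrable_on l f g : measurable_fun `[0, l] f ->
  (forall x, 0 <= x <= l -> `|f x| <= g x) -> integrable_on l g -> integrable_on l f.
Proof.
move=> mf fg; apply: le_integrable => //; first exact/measurable_EFinP.
move=> x; rewrite /= in_itv/= => xl; rewrite lee_fin.
by apply: le_trans (fg x xl) _; exact: ler_norm.
Qed.

Lemma continuous_integrable_on l f : {within `[0, l], continuous f} -> integrable_on l f.
Proof. by move=> cf; apply: continuous_compact_integrable => //; exact: segment_compact. Qed.

Lemma integrable_sub l f x y : 0 <= x -> y <= l -> integrable_on l f ->
  mu.-integrable `[x, y] (EFin \o f).
Proof.
move=> x0 yl; apply: integrableS => // z /=; rewrite !in_itv/= => /andP[xz zy].
by rewrite (le_trans x0 xz) (le_trans zy yl).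
Qed.

Lemma itg_split l f x y z : integrable_on l f -> 0 <= x -> x <= y -> y <= z -> z <= l ->
  itg f x z = itg f x y + itg f y z.
Proof.
move=> fi x0 xy yz zl.
have := @Rintegral_itvB R f (BLeft x) (BRight z) y (integrable_sub x0 zl fi).
rewrite !bnd_simp => /(_ xy yz).
rewrite Rintegral_itv_obnd_cbnd; first by move=> /eqP; rewrite subr_eq addrC => /eqP.
apply: integrableS (integrable_sub x0 zl fi) => //.
by move=> t /=; rewrite !in_itv/= => /andP[/ltW/(le_trans xy) -> ->].
Qed.

Lemma itg_ge0 f x y : (forall t, x <= t <= y -> 0 <= f t) -> 0 <= itg f x y.
Proof. by move=> f0; apply: Rintegral_ge0 => t /=; rewrite in_itv/=; exact: f0. Qed.

Lemma itg_sub_le l f x y : integrable_on l f -> (forall t, 0 <= t <= l -> 0 <= f t) ->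
  0 <= x -> x <= y -> y <= l -> itg f x y <= itg f 0 l.
Proof.
move=> fi f0 x0 xy yl; have xl := le_trans xy yl.
rewrite (itg_split fi (lexx 0) x0 xl (lexx l)) (itg_split fi x0 xy yl (lexx l)).
rewrite addrCA lerDl addr_ge0//; apply: itg_ge0 => t /andP[t1 t2]; apply: f0.
  by rewrite t1 (le_trans t2).
by rewrite t2 andbT (le_trans (le_trans x0 xy)).
Qed.

Lemma le_itg l f g x y : integrable_on l f -> integrable_on l g -> 0 <= x -> y <= l ->
  (forall t, x <= t <= y -> f t <= g t) -> itg f x y <= itg g x y.
Proof.
move=> fi gi x0 yl fg.
by apply: (le_Rintegral _ (integrable_sub x0 yl fi) (integrable_sub x0 yl gi)).
Qed.

Lemma eq_itg f g x y : (forall t, x <= t <= y -> f t = g t) -> itg f x y = itg g x y.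
Proof. by move=> fg; apply: eq_Rintegral => t; rewrite inE/= in_itv/=; exact: fg. Qed.

Lemma itgD l f g x y : integrable_on l f -> integrable_on l g -> 0 <= x -> y <= l ->
  itg (fun t => f t + g t) x y = itg f x y + itg g x y.
Proof.
move=> fi gi x0 yl.
exact: (RintegralD _ (integrable_sub x0 yl fi) (integrable_sub x0 yl gi)).
Qed.

Lemma itgZ l k f x y : integrable_on l f -> 0 <= x -> y <= l ->
  itg (fun t => k * f t) x y = k * itg f x y.
Proof. by move=> fi x0 yl; exact: (RintegralZl _ _ (integrable_sub x0 yl fi)). Qed.

Lemma itg_cst x y k : x <= y -> itg (fun=> k) x y = k * (y - x).
Proof.
move=> xy; rewrite Rintegral_cst//= lebesgue_measure_itv/= lte_fin.
by move: xy; rewrite le_eqVlt => /orP[/eqP ->|->//]; rewrite ltxx subrr.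
Qed.

Lemma norm_itg_le l f x y : integrable_on l f -> 0 <= x -> y <= l ->
  `|itg f x y| <= itg (fun t => `|f t|) x y.
Proof. by move=> fi x0 yl; exact: (le_normr_Rintegral _ (integrable_sub x0 yl fi)). Qed.

Lemma square_integrable_mul l u v : square_integrable l u -> square_integrable l v ->
  integrable_on l (fun x => u x * v x).
Proof.
move=> [mu_ ui] [mv vi].
apply: dominated_integrable_on (integrable_onD ui vi); first exact: measurable_funM.
by move=> x _; rewrite normrM; have := sqr_ge0 (`|u x| - `|v x|);
  rewrite sqrrB !real_normK ?num_real//; have := mulr_ge0 (normr_ge0 (u x)) (normr_ge0 (v x));
  lra.
Qed.

Lemma square_integrable_cst l k : square_integrable l (fun=> k).
Proof. by split => //; exact: integrable_on_cst. Qed.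

Lemma square_integrable_integrable l u : square_integrable l u -> integrable_on l u.
Proof.
move=> ui; have := square_integrable_mul ui (square_integrable_cst l 1).
by congr (integrable_on _ _); apply/funext => x; rewrite mulr1.
Qed.

Lemma continuous_square_integrable l u : {within `[0, l], continuous u} ->
  square_integrable l u.
Proof.
move=> cu; split.
  exact: integrable_on_measurable (continuous_integrable_on cu).
rewrite (_ : (fun x => u x ^+ 2) = fun x => u x * u x)//.
by apply: continuous_integrable_on => x; apply: continuousM; exact: cu.
Qed.

Lemma square_integrableD l u v : square_integrable l u -> square_integrable l v ->
  square_integrable l (fun x => u x + v x).
Proof.
move=> ui vi; have uv := square_integrable_mul ui vi.
split; first by apply: measurable_funD; [case: ui|case: vi].
have := integrable_onD (integrable_onD ui.2 vi.2) (integrable_onZ 2 uv).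
by congr (integrable_on _ _); apply/funext => x; ring.
Qed.

Lemma square_integrableZ l k u : square_integrable l u ->
  square_integrable l (fun x => k * u x).
Proof.
move=> ui; split; first by apply: measurable_funM => //; case: ui.
have := integrable_onZ (k ^+ 2) ui.2.
by congr (integrable_on _ _); apply/funext => x; rewrite exprMn.
Qed.

(** Real form of [edge_H1]: [F] is the continuous representative of an element of H^1(0, l) with
    derivative [w]. *)
Definition primitive l F w :=
  square_integrable l w /\ forall x, 0 <= x <= l -> F x = F 0 + itg w 0 x.

Lemma primitive_sub l F w x y : primitive l F w -> 0 <= x -> x <= y -> y <= l ->
  F y - F x = itg w x y.
Proof.
move=> [wi FE] x0 xy yl.
rewrite (FE y) ?yl ?(le_trans x0)// (FE x) ?x0 ?(le_trans xy)//.
rewrite (itg_split (square_integrable_integrable wi) (lexx 0) x0 xy yl); ring.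
Qed.

Lemma primitive_continuous l F w : 0 <= l -> primitive l F w ->
  {within `[0, l], continuous F}.
Proof.
move=> l0 [wi FE].
have := parameterized_integral_continuous l0 (square_integrable_integrable wi).
move=> c; apply: (subspace_eq_continuous (f := fun x => F 0 + itg w 0 x)).
  by move=> x; rewrite inE/= in_itv/= => /FE /esym.
by move=> x; apply: cvgD; [exact: cvg_cst|exact: c].
Qed.

(** Cauchy-Schwarz for [w] against 1, obtained by integrating the square of [w] minus its mean
    [m]. *)
Lemma primitive_holder l F w x y : primitive l F w -> 0 <= x -> x <= y -> y <= l ->
  (F y - F x) ^+ 2 <= (y - x) * itg (fun t => w t ^+ 2) x y.
Proof.
move=> Fw x0 xy yl; have [wi _] := Fw; rewrite (primitive_sub Fw)//.
move: xy; rewrite le_eqVlt => /orP[/eqP <-|xy].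
  by rewrite set_itv1 Rintegral_set1 subrr mul0r expr0n.
set I := itg w x y; pose m := I / (y - x).
have yx : 0 < y - x by rewrite subr_gt0.
have wI := square_integrable_integrable wi.
have wmi := integrable_onZ (- (2 * m)) wI.
have : 0 <= itg (fun t => w t ^+ 2 + - (2 * m) * w t + m ^+ 2) x y.
  apply: itg_ge0 => t _.
  by rewrite (_ : _ + _ = (w t - m) ^+ 2) ?sqr_ge0//; ring.
rewrite (itgD (l := l))//; last 2 first.
- exact: integrable_onD wi.2 _.
- exact: integrable_on_cst.
rewrite (itgD wi.2 wmi)// (itgZ _ wI)// (itg_cst _ (ltW xy)) -/I.
rewrite -(pmulr_rge0 _ yx).
set J := itg (fun t => w t ^+ 2) x y.
have -> : (y - x) * (J + - (2 * m) * I + m ^+ 2 * (y - x)) = (y - x) * J - I ^+ 2.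
  by rewrite /m; field; rewrite gt_eqF.
by rewrite subr_ge0.
Qed.

End SquareIntegrable.

(** * Estimates for C^1 functions on an edge *)

Section ContinuouslyDifferentiable.
Context {R : realType}.
Implicit Types (l s x y z : R) (f g u v w F V : R -> R).
Local Notation mu := (@lebesgue_measure R).
Local Notation itg f x y := (\int[mu]_(t in `[x, y]) f t).

(** Core functions have this regularity because their derivative is again in H^1; it permits the
    integration by parts for F^2. *)
Definition c1 l F w := primitive l F w /\ {within `[0, l], continuous w}.

Lemma c1_derivable l F w x : c1 l F w -> 0 < x -> x < l ->
  derivable F x 1 /\ derive1 F x = w x.
Proof.
move=> [[wi FE] cw] x0 xl.
have wx : {for x, continuous w}.
  have [+ _ _] := (continuous_within_itvP w (lt_trans x0 xl)).1 cw.
  by apply; rewrite in_itv/= x0 xl.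
have [d dE] := continuous_FTC1_closed xl (square_integrable_integrable wi) x0 wx.
pose P t := F 0 + itg w 0 t.
have eqFP : \near x, P x = F x.
  near=> t; rewrite /P -FE//; apply/andP; split; apply: ltW; near: t.
    exact: lt_nbhsr.
  exact: lt_nbhsl.
have PE : P = cst (F 0) + (fun t => itg w 0 t) by [].
have dc : derivable (cst (F 0)) x 1 by exact: derivable_cst.
split; first by apply: near_eq_derivable eqFP _; rewrite PE; exact: derivableD.
by rewrite derive1E -(near_eq_derive _ eqFP) PE deriveD// derive_cst add0r -derive1E.
Unshelve. all: by end_near. Qed.

Lemma itv_subset l x y : 0 <= x -> y <= l -> `[x, y] `<=` (`[0, l] : set R).
Proof.
move=> x0 yl z /=; rewrite !in_itv/= => /andP[xz zy].
by rewrite (le_trans x0 xz) (le_trans zy yl).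
Qed.

Lemma c1_sqr_sub l F w x y : c1 l F w -> 0 <= x -> x <= y -> y <= l ->
  F y ^+ 2 - F x ^+ 2 = 2 * itg (fun t => F t * w t) x y.
Proof.
move=> Fw x0; rewrite le_eqVlt => /orP[/eqP <- _|xy yl].
  by rewrite set_itv1 Rintegral_set1 mulr0 subrr.
have [Fp cw] := Fw.
have l0 : 0 <= l by apply: le_trans yl; apply: le_trans (ltW xy).
have sub := itv_subset x0 yl.
have cF := continuous_subspaceW sub (primitive_continuous l0 Fp).
have cw' := continuous_subspaceW sub cw.
have dF z : z \in `]x, y[ -> derivable F z 1 /\ derive1 F z = w z.
  rewrite in_itv/= => /andP[xz zy].
  by apply: (c1_derivable Fw); [exact: le_lt_trans xz|exact: lt_le_trans yl].
have LR : derivable_oo_LRcontinuous F x y.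
  have [_ h1 h2] := (continuous_within_itvP F xy).1 cF.
  by split=> // z /dF[].
have := Rintegration_by_parts xy cw' LR (fun z h => (dF z h).2) cw' LR
  (fun z h => (dF z h).2).
have -> : itg (fun t => w t * F t) x y = itg (fun t => F t * w t) x y.
  by apply: eq_itg => t _; rewrite mulrC.
rewrite -!expr2; lra.
Qed.

(* AM-GM: 2 |F F'| <= s F^2 + s^-1 F'^2. *)
Lemma c1_dist_sqr l F w x y s : c1 l F w -> 0 <= x -> x <= y -> y <= l -> 0 < s ->
  `|F y ^+ 2 - F x ^+ 2| <=
  s * itg (fun t => F t ^+ 2) x y + s^-1 * itg (fun t => w t ^+ 2) x y.
Proof.
move=> Fw x0 xy yl s0; have [Fp cw] := Fw; have [wi _] := Fp.
have l0 : 0 <= l := le_trans x0 (le_trans xy yl).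
have Fi := continuous_square_integrable (primitive_continuous l0 Fp).
have FwI := square_integrable_mul Fi wi.
rewrite (c1_sqr_sub Fw)// -(itgZ _ FwI)// -(itgZ _ Fi.2)// -(itgZ _ wi.2)//.
have i1 := integrable_onZ s Fi.2; have i2 := integrable_onZ s^-1 wi.2.
rewrite -(itgD i1 i2)//.
apply: le_trans (norm_itg_le (integrable_onZ 2 FwI) x0 yl) _.
apply: (le_itg _ (integrable_onD i1 i2)) => //.
  exact: integrable_on_norm (integrable_onZ 2 FwI).
move=> t _; rewrite ler_norml.
have e1 : s * F t ^+ 2 + s^-1 * w t ^+ 2 - 2 * (F t * w t) = s^-1 * (s * F t - w t) ^+ 2.
  by field; rewrite gt_eqF.
have e2 : s * F t ^+ 2 + s^-1 * w t ^+ 2 + 2 * (F t * w t) = s^-1 * (s * F t + w t) ^+ 2.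
  by field; rewrite gt_eqF.
have := mulr_ge0 (ltW (etrans (invr_gt0 s) s0)) (sqr_ge0 (s * F t - w t)).
have := mulr_ge0 (ltW (etrans (invr_gt0 s) s0)) (sqr_ge0 (s * F t + w t)).
by rewrite -e1 -e2 => *; apply/andP; split; lra.
Qed.

Lemma sqr_itg_split_le l w x y : integrable_on l (fun t => w t ^+ 2) ->
  0 <= x -> x <= y -> y <= l ->
  itg (fun t => w t ^+ 2) x y <= itg (fun t => w t ^+ 2) 0 l.
Proof. by move=> wi x0 xy yl; apply: itg_sub_le => // t _; exact: sqr_ge0. Qed.

(** The oscillation bound for F^2 on both sides of [x]. In the application [x] is a maximum point of
    F^2 on the edge. *)
Lemma c1_cheeger_edge l F w x s : c1 l F w -> 0 <= x -> x <= l -> 0 < s ->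
  2 * F x ^+ 2 - F 0 ^+ 2 - F l ^+ 2 <=
  s * itg (fun t => F t ^+ 2) 0 l + s^-1 * itg (fun t => w t ^+ 2) 0 l.
Proof.
move=> Fw x0 xl s0; have [Fp cw] := Fw; have [wi _] := Fp.
have l0 : 0 <= l := le_trans x0 xl.
have Fi := continuous_square_integrable (primitive_continuous l0 Fp).
rewrite (itg_split Fi.2 (lexx 0) x0 xl)// (itg_split wi.2 (lexx 0) x0 xl)//.
have := c1_dist_sqr Fw (lexx 0) x0 xl s0.
have := c1_dist_sqr Fw x0 xl (lexx l) s0.
rewrite !ler_norml !mulrDr => /andP[h1 _] /andP[_ h2]; lra.
Qed.

Lemma itg_sqr_le l F M : 0 <= l -> integrable_on l (fun t => F t ^+ 2) ->
  (forall x, 0 <= x <= l -> F x ^+ 2 <= M) -> itg (fun t => F t ^+ 2) 0 l <= l * M.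
Proof.
move=> l0 Fi FM; apply: le_trans (le_itg Fi (integrable_on_cst l M) (lexx 0) (lexx l) FM) _.
by rewrite itg_cst// subr0 mulrC.
Qed.

(** F(x)^2 exceeds each F(y)^2 by at most the oscillation bound; averaging over [y] gives the term
    with l^-1. A large [s] shows that a small L^2 norm and a bounded derivative force small
    values. *)
Lemma c1_sup l F w x s : 0 < l -> c1 l F w -> 0 <= x <= l -> 0 < s ->
  F x ^+ 2 <= (l^-1 + s) * itg (fun t => F t ^+ 2) 0 l
              + s^-1 * itg (fun t => w t ^+ 2) 0 l.
Proof.
move=> l0 Fw /andP[x0 xl] s0; have [Fp cw] := Fw; have [wi _] := Fp.
have Fi := continuous_square_integrable (primitive_continuous (ltW l0) Fp).
set E0 := itg (fun t => F t ^+ 2) 0 l; set E1 := itg (fun t => w t ^+ 2) 0 l.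
have s'0 : 0 <= s^-1 by rewrite invr_ge0 ltW.
have key y : 0 <= y <= l -> F x ^+ 2 - (s * E0 + s^-1 * E1) <= F y ^+ 2.
  move=> /andP[y0 yl].
  have [xy|/ltW yx] := leP x y.
    have := c1_dist_sqr Fw x0 xy yl s0.
    have := ler_wpM2l (ltW s0) (sqr_itg_split_le Fi.2 x0 xy yl).
    have := ler_wpM2l s'0 (sqr_itg_split_le wi.2 x0 xy yl).
    rewrite -/E0 -/E1 ler_norml => h1 h2 /andP[h3 _]; lra.
  have := c1_dist_sqr Fw y0 yx xl s0.
  have := ler_wpM2l (ltW s0) (sqr_itg_split_le Fi.2 y0 yx xl).
  have := ler_wpM2l s'0 (sqr_itg_split_le wi.2 y0 yx xl).
  rewrite -/E0 -/E1 ler_norml => h1 h2 /andP[_ h3]; lra.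
have := le_itg (integrable_on_cst l (F x ^+ 2 - (s * E0 + s^-1 * E1))) Fi.2
  (lexx 0) (lexx l) key.
rewrite (itg_cst _ (ltW l0)) subr0 -/E0 -ler_pdivlMr//.
rewrite mulrDl [l^-1 * _]mulrC; move: (E0 / l) => q; lra.
Qed.

(** Every point lies within l/n to the right of a zero, so the Hölder bound gives F^2 <= (l/n) int
    w^2 pointwise. The factor l^2/n is not sharp, but it tends to 0 with growing [n]. *)
Lemma primitive_poincare l F w n : 0 < l -> primitive l F w -> (0 < n)%N ->
  (forall k, (k <= n)%N -> F (k%:R * l / n%:R) = 0) ->
  itg (fun t => F t ^+ 2) 0 l <= l ^+ 2 / n%:R * itg (fun t => w t ^+ 2) 0 l.
Proof.
move=> l0 Fw n0 F0; have [wi _] := Fw.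
have n0' : 0 < n%:R :> R by rewrite ltr0n.
have Fi := continuous_square_integrable (primitive_continuous (ltW l0) Fw).
set E1 := itg (fun t => w t ^+ 2) 0 l.
have -> : l ^+ 2 / n%:R * E1 = l * (l / n%:R * E1) by rewrite expr2; ring.
apply: (itg_sqr_le (ltW l0) Fi.2) => x /andP[x0 xl].
have xn0 : 0 <= x * n%:R / l by rewrite divr_ge0 ?mulr_ge0// ltW.
have /andP[k1 k2] := truncn_itv xn0.
set k := Num.truncn _ in k1 k2.
pose y := k%:R * l / n%:R.
have yx : y <= x by rewrite /y ler_pdivrMr// -ler_pdivlMr.
have xy : x - y <= l / n%:R.
  have e : l / n%:R + y = (k%:R + 1) * l / n%:R by rewrite /y; field; rewrite gt_eqF.
  by rewrite lerBlDr e ler_pdivlMr// natr1 -ler_pdivrMr// ltW.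
have kn : (k <= n)%N.
  rewrite -(ler_nat R); apply: le_trans k1 _.
  by rewrite ler_pdivrMr// mulrC ler_pM2l.
have y0 : 0 <= y by rewrite /y divr_ge0// ?mulr_ge0// ltW.
have := primitive_holder Fw y0 yx xl; rewrite F0// subr0 => /le_trans; apply.
have h := sqr_itg_split_le wi.2 y0 yx xl.
apply: ler_pM => //; first by rewrite subr_ge0.
by apply: itg_ge0 => t _; exact: sqr_ge0.
Qed.

(* Integration by parts against a Hölder function, up to an arbitrarily small
   error: replace [V] by its value at the left end of each of [N.+1] equal
   subintervals. *)
Lemma primitive_weak_null l V v eta : 0 < l -> primitive l V v -> 0 < eta ->
  exists2 C : R, 0 <= C & forall F w S, primitive l F w ->
    (forall x, 0 <= x <= l -> `|F x| <= S) ->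
    `|itg (fun t => w t * V t) 0 l| <=
      C * S + eta * (l + itg (fun t => w t ^+ 2) 0 l).
Proof.
move=> l0 Vv eta0; have [vi _] := Vv.
have cV := primitive_continuous (ltW l0) Vv.
have Vi := continuous_square_integrable cV.
set W := itg (fun t => v t ^+ 2) 0 l.
have W0 : 0 <= W by apply: itg_ge0 => t _; exact: sqr_ge0.
have [M MV] : exists M, forall x, 0 <= x <= l -> `|V x| <= M.
  exists (1 + V 0 ^+ 2 + `|V 0| + l * W) => x /andP[x0 xl].
  have h1 := primitive_holder Vv (lexx 0) x0 xl.
  have h2 : (x - 0) * itg (fun t => v t ^+ 2) 0 x <= l * W.
    apply: ler_pM => //; rewrite ?subr0//; first by apply: itg_ge0 => t _; exact: sqr_ge0.
    exact: sqr_itg_split_le vi.2 (lexx 0) x0 xl.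
  rewrite -(subrK (V 0) (V x)); apply: le_trans (ler_normD _ _) _.
  have := sqr_ge0 (`|V x - V 0| - 1); rewrite sqrrB real_normK ?num_real//.
  have := sqr_ge0 (V 0); have := normr_ge0 (V x - V 0); nra.
have M0 : 0 <= M by apply: le_trans (normr_ge0 (V 0)) (MV 0 _); rewrite lexx ltW.
(* By [primitive_holder], this many pieces keep the oscillation of [V] on each piece below [eta]. *)
pose N := (Num.truncn (l * W / eta ^+ 2)).+1.
have N0 : 0 < N%:R :> R by rewrite ltr0n.
have hN : l / N%:R * W <= eta ^+ 2.
  have q0 : 0 <= l * W / eta ^+ 2 by rewrite divr_ge0 ?mulr_ge0 ?sqr_ge0// ltW.
  rewrite mulrAC ler_pdivrMr// [leRHS]mulrC -ler_pdivrMr ?exprn_gt0//.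
  by have /andP[_ /ltW] := truncn_itv q0.
exists (2 * M * N%:R); first by rewrite !mulr_ge0// ltW.
move=> F w S Fw FS; have [wi _] := Fw.
have wVi := square_integrable_mul wi Vi.
have wn := integrable_on_norm (square_integrable_integrable wi).
pose xk k := k%:R * (l / N%:R).
have xk0 k : 0 <= xk k by rewrite mulr_ge0// divr_ge0// ltW.
have xkl k : (k <= N)%N -> xk k <= l.
  by move=> kN; rewrite /xk mulrCA ger_pMr// ler_pdivrMr// mul1r ler_nat.
have xkS k : xk k <= xk k.+1 by rewrite ler_wpM2r ?ler_nat// divr_ge0// ltW.
have step k : (k <= N)%N -> `|itg (fun t => w t * V t) 0 (xk k)| <=
    2 * M * k%:R * S + eta * itg (fun t => `|w t|) 0 (xk k).
  elim: k => [|k IH] kN.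
    by rewrite /xk mul0r set_itv1 !Rintegral_set1 !mulr0 mul0r addr0 normr0.
  have x0 := xk0 k; have x1 := xkl _ kN; have x01 := xkS k.
  have x0l : xk k <= l := le_trans x01 x1.
  rewrite (itg_split wVi (lexx 0) x0 x01 x1) (itg_split wn (lexx 0) x0 x01 x1).
  apply: le_trans (ler_normD _ _) _.
  have piece : `|itg (fun t => w t * V t) (xk k) (xk k.+1)| <=
      2 * M * S + eta * itg (fun t => `|w t|) (xk k) (xk k.+1).
    have wI := square_integrable_integrable wi.
    have i1 := integrable_onZ (V (xk k)) wI.
    have Vi' := square_integrableD Vi (square_integrable_cst l (- V (xk k))).
    have i2 := square_integrable_mul wi Vi'.
    have -> : itg (fun t => w t * V t) (xk k) (xk k.+1) =
        V (xk k) * (F (xk k.+1) - F (xk k)) +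
        itg (fun t => w t * (V t - V (xk k))) (xk k) (xk k.+1).
      rewrite (primitive_sub Fw)// -(itgZ _ wI)// -(itgD i1 i2)//.
      by apply: eq_itg => t _; ring.
    apply: le_trans (ler_normD _ _) _; apply: lerD.
      rewrite normrM [2 * M]mulrC -mulrA; apply: ler_pM => //.
        by apply: MV; rewrite x0 x0l.
      apply: le_trans (ler_normB _ _) _.
      have := FS (xk k.+1); rewrite (le_trans x0 x01) x1 => /(_ isT).
      have := FS (xk k); rewrite x0 x0l => /(_ isT); lra.
    apply: le_trans (norm_itg_le i2 x0 x1) _; rewrite -(itgZ _ wn)//.
    apply: (le_itg (integrable_on_norm i2) (integrable_onZ eta wn) x0 x1).
    move=> t /andP[t1 t2]; rewrite normrM mulrC; apply: ler_wpM2r => //.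
    rewrite -(ler_pXn2r (n := 2)) ?nnegrE// ?(ltW eta0)// real_normK ?num_real//.
    have tl := le_trans t2 x1.
    apply: le_trans (primitive_holder Vv x0 t1 tl) _; apply: le_trans hN.
    apply: ler_pM; first by rewrite subr_ge0.
    - by apply: itg_ge0 => z _; exact: sqr_ge0.
    - by rewrite lerBlDr; apply: le_trans t2 _; rewrite /xk -natr1 mulrDl mul1r addrC.
    - exact: sqr_itg_split_le vi.2 x0 t1 tl.
  apply: le_trans (lerD (IH (ltnW kN)) piece) _; rewrite -natr1 le_eqVlt.
  by apply/orP; left; apply/eqP; ring.
have := step N (leqnn N); rewrite /xk mulrCA divff ?gt_eqF// mulr1 => /le_trans; apply.
rewrite lerD2l; apply: ler_wpM2l; first exact: ltW.
have c1i := integrable_on_cst l (1 : R).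
apply: (@le_trans _ _ (itg (fun t => 1 + w t ^+ 2) 0 l)).
  apply: (le_itg wn (integrable_onD c1i wi.2) (lexx 0) (lexx l)) => t _.
  have := sqr_ge0 (`|w t| - 1); rewrite sqrrB real_normK ?num_real//.
  have := normr_ge0 (w t); lra.
by rewrite (itgD c1i wi.2)// itg_cst ?(ltW l0)// subr0 mul1r.
Qed.

End ContinuouslyDifferentiable.

(** * The discrete Cheeger inequality *)

Lemma fproper_witness (K : choiceType) (A B : {fset K}) x :
  {subset A <= B} -> x \in B -> x \notin A -> (A `<` B)%fset.
Proof.
move=> AB xB xA; rewrite fproperE; apply/andP; split; first exact/fsubsetP.
by apply: contra xA => /fsubsetP; exact.
Qed.

Section DiscreteCheeger.
Context {R : realType} {G : metric_graph R}.
Implicit Types (S : set (edge G)) (D : set (vertex G)) (T C : {fset edge G}).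
Implicit Types (W : vertex G -> bool) (v : vertex G) (e : edge G).

Lemma degree_in_fset T v :
  degree_in [set` T] v = (\sum_(e <- T) ((src e == v) + (tgt e == v)))%N.
Proof.
rewrite /degree_in.
have -> : fset_set (incident v `&` [set` T]) =
    [fset e in T | (src e == v) || (tgt e == v)]%fset.
  apply/fsetP => e; rewrite in_fset_set; last exact: finite_setIl (locally_finite v).
  apply/idP/idP.
    rewrite !inE /= => -[ev ->] /=.
    by case: ev => <-; rewrite eqxx ?orbT.
  rewrite !inE /= => /andP[eT ev]; split=> //.
  by case/orP : ev => /eqP; [left|right].
rewrite card_fset_sum1 big_fset big_mkcond/=; apply: eq_bigr => e _.
have := @no_loop _ _ e.
by case: (src e =P v) => [->|_]; case: (tgt e =P v) => [->|_].
Qed.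

Lemma degree_in_le S T v : (forall e, S e -> incident v e -> e \in T) ->
  (degree_in S v <= degree_in [set` T] v)%N.
Proof.
move=> ST; apply: fsubset_leq_card; apply/fsubsetP => e.
rewrite !in_fset_set; try exact: finite_setIl (locally_finite v).
rewrite !inE => -[ev Se]; split => //; exact: ST.
Qed.

Lemma sum_eq_le (I : eqType) (s : seq I) (P : pred I) (a : I) (b : bool) : uniq s ->
  (forall x, x \in s -> P x -> a = x -> b) -> (\sum_(x <- s | P x) (a == x) <= b)%N.
Proof.
move=> us aP; rewrite big_mkcond; case: b aP => aP.
  apply: (@leq_trans (\sum_(x <- s) (a == x))%N).
    by apply: leq_sum => x _; case: ifP.
  have -> : (\sum_(x <- s) (a == x) = count_mem a s)%N.
    by rewrite -sum1_count [RHS]big_mkcond; apply: eq_bigr => x _ /=; rewrite eq_sym; case: eqP.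
  by rewrite count_uniq_mem//; case: (_ \in _).
rewrite big_seq big1// => x xs; case: ifP => // Px.
by case: eqP => // /(aP x xs Px).
Qed.

(** Double counting: an edge contributes once for each of its endpoints on the boundary, and there
    [W] fails. *)
Lemma deg_boundary_le S D (Y : finite_subgraph G) W :
  (forall v, v \in sub_V Y -> boundary S D Y v -> ~~ W v) ->
  (deg_boundary S D Y <= \sum_(e <- sub_E Y) (~~ W (src e) + ~~ W (tgt e)))%N.
Proof.
move=> bW; rewrite /deg_boundary.
under eq_bigr do rewrite degree_in_fset.
rewrite exchange_big/=; apply: leq_sum => e _; rewrite big_split/=.
by apply: leq_add; apply: sum_eq_le (fset_uniq _) _ => v vY; rewrite inE => vb ->; exact: bW.
Qed.

Lemma joined_in_sym (A : set (edge G)) u v :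
  joined_in src tgt A u v -> joined_in src tgt A v u.
Proof.
elim=> [a b [e eA ab]|a|a b c _ ba _ cb].
- by apply: rt_step; exists e => //; case: ab => [[? ?]|[? ?]]; [right|left].
- exact: rt_refl.
- exact: rt_trans cb ba.
Qed.

(** The connected component of [e0] in the graph with edge set [T]; the last clause says that no
    edge of [T] leaves it. *)
Lemma component_subgraph T (e0 : edge G) : e0 \in T ->
  exists Y : finite_subgraph G,
    [/\ e0 \in sub_E Y, {subset sub_E Y <= T}, conn_subgraphs [set` T] Y &
      forall v e e', v \in sub_V Y -> e \in T -> incident v e -> e \in sub_E Y].
Proof.
move=> e0T.
pose reach e := `[< joined_in src tgt [set` T] (src e0) (src e) >].
pose C := [fset e in T | reach e]%fset.
pose VC := ([fset src e | e in C] `|` [fset tgt e | e in C])%fset.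
have srcV e : e \in C -> src e \in VC.
  by move=> eC; rewrite inE; apply/orP; left; apply/imfsetP; exists e.
have tgtV e : e \in C -> tgt e \in VC.
  by move=> eC; rewrite inE; apply/orP; right; apply/imfsetP; exists e.
have edge_step e : e \in T -> joined_in src tgt [set` T] (src e) (tgt e).
  by move=> eT; apply: rt_step; exists e => //; left.
have reachV v : v \in VC -> joined_in src tgt [set` T] (src e0) v.
  rewrite inE => /orP[] /imfsetP[e /=]; rewrite !inE => /andP[eT /asboolP re] ->//.
  exact: rt_trans re (edge_step e eT).
have inC v e : joined_in src tgt [set` T] (src e0) v -> e \in T -> incident v e ->
    e \in C.
  move=> rv eT ev; rewrite !inE eT/=; apply/asboolP.
  case: ev => [->//|tv]; apply: rt_trans rv _; rewrite -tv.
  exact/joined_in_sym/edge_step.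
(* All edges of a path starting at [src e0] are themselves reachable, so the path stays inside
   [C]. *)
have joinC v : joined_in src tgt [set` T] (src e0) v ->
    joined_in src tgt [set` C] (src e0) v.
  move=> rv; elim: (clos_rt_rtn1 _ _ _ _ rv) => [|a b [e eT ab] ra IH]; first exact: rt_refl.
  apply: rt_trans IH _; apply: rt_step; exists e => //.
  apply: (inC a) => //; first exact: clos_rtn1_rt ra.
  by case: ab => [[h _]|[_ h]]; [left|right].
exists (@FiniteSubgraph _ _ VC C (fun e eC => conj (srcV e eC) (tgtV e eC))).
split=> /=.
- by rewrite !inE e0T; apply/asboolP; exact: rt_refl.
- by move=> e; rewrite !inE => /andP[].
- split=> /=.
  + by apply/fset0Pn; exists e0; rewrite !inE e0T; apply/asboolP; exact: rt_refl.
  + by move=> e /=; rewrite !inE => /andP[].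
  + move=> u v /reachV/joinC ru /reachV/joinC rv.
    exact: rt_trans (joined_in_sym ru) rv.
- by move=> v e _ /reachV rv eT ev; exact: inC rv eT ev.
Qed.

Section Isoperimetric.
Variables (S : set (edge G)) (D : set (vertex G)) (A : R).
Hypothesis isoperimetric : forall Y, conn_subgraphs S Y ->
  A * mes Y <= (deg_boundary S D Y)%:R.

(** The assumption on [W] keeps its vertices off the boundary of each component of [T], so
    [deg_boundary_le] bounds the boundary degree. As the isoperimetric inequality concerns connected
    subgraphs only, one component is split off and the rest is handled by induction. *)
Lemma level_set_isoperimetric T W : [set` T] `<=` S ->
  (forall v, W v -> ~ D v /\ forall e, S e -> incident v e -> e \in T) ->
  A * (\sum_(e <- T) len e) <= (\sum_(e <- T) (~~ W (src e) + ~~ W (tgt e)))%N%:R.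
Proof.
elim/finSet_rect : T W => T IH W TS WT.
have [->|/fset0Pn[e0 e0T]] := eqVneq T fset0; first by rewrite !big_seq_fset0 mulr0.
have [Y [e0Y YT [Y0 _ Yconn] Yclosed]] := component_subgraph e0T.
have CY : [fset e in T | e \in sub_E Y]%fset = sub_E Y.
  by apply/fsetP => e; rewrite !inE /= andb_idl//; exact: YT.
rewrite (big_fsetID _ (fun e => e \in sub_E Y))/= CY.
rewrite [X in _ <= X%:R](big_fsetID _ (fun e => e \in sub_E Y))/= CY.
rewrite natrD mulrDr; apply: lerD.
  apply: (le_trans (isoperimetric _)).
    by split => // e /YT; exact: TS.
  rewrite ler_nat; apply: deg_boundary_le => v vY [_ bv].
  apply/negP => Wv; have [nDv vT] := WT v Wv.
  case: bv => // ; rewrite ltnNge => /negP; apply.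
  by apply: degree_in_le => e Se ev; exact: Yclosed vY (vT e Se ev) ev.
set T' := [fset e in T | _]%fset.
(* Vertices of the removed component no longer have all their edges in [T'] and must leave [W];
   edges of [T'] do not meet them, so the right-hand side is unchanged. *)
pose W' v := W v && `[< forall e, incident v e -> e \notin sub_E Y >].
have W'E e v : e \in T' -> incident v e -> W' v = W v.
  rewrite !inE => /andP[eT eY] ev; rewrite /W' andb_idr// => _; apply/asboolP => e' e'v.
  apply: contra eY => e'Y; apply: (Yclosed v) => //.
  by have [sV tV] := sub_endpoints e'Y; case: e'v => <-.
have -> : (\sum_(e <- T') (~~ W (src e) + ~~ W (tgt e)) =
    \sum_(e <- T') (~~ W' (src e) + ~~ W' (tgt e)))%N.
  apply: eq_big_seq => e eT'; rewrite (W'E e (src e))//; last by left.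
  by rewrite (W'E e (tgt e))//; right.
apply: IH.
- apply: (fproper_witness (x := e0)) => //; last by rewrite !inE e0T e0Y.
  by move=> e; rewrite !inE => /andP[].
- by move=> e /=; rewrite !inE => /andP[eT _]; exact: TS.
- move=> v /andP[/WT[nD vT] /asboolP vY]; split=> // e Se ev.
  by rewrite !inE (vT e Se ev) vY.
Qed.

Lemma seq_argmin (I : eqType) (s : seq I) (f : I -> R) : s != [::] ->
  exists2 x, x \in s & forall y, y \in s -> f x <= f y.
Proof.
elim: s => [//|a s IH] _; have [->|/IH[x xs xmin]] := eqVneq s [::].
  by exists a; rewrite ?mem_head// => y; rewrite inE => /eqP ->.
have [ax|/ltW xa] := leP (f a) (f x).
  exists a; rewrite ?mem_head// => y; rewrite inE => /orP[/eqP ->//|/xmin].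
  exact: le_trans.
by exists x; rewrite ?inE ?xs ?orbT// => y /orP[/eqP ->|/xmin].
Qed.

(* Layer cake: peel off the smallest positive value [c] of [M]. *)
Lemma discrete_cheeger (F : {fset edge G}) (M : edge G -> R) (g : vertex G -> R) :
  [set` F] `<=` S -> (forall e, S e -> 0 <= M e) ->
  (forall e, S e -> e \notin F -> M e = 0) ->
  (forall v, 0 <= g v) -> (forall v, D v -> g v = 0) ->
  (forall v e, S e -> incident v e -> g v <= M e) ->
  A * (\sum_(e <- F) len e * M e) <=
    \sum_(e <- F) (2 * M e - g (src e) - g (tgt e)).
Proof.
move=> FS; pose T M := [fset e in F | 0 < M e :> R]%fset.
have inT N e : (e \in T N) = (e \in F) && (0 < N e) by rewrite !inE.
have [n] := ubnP #|` T M|; elim: n M g => // n IH M g nT M0 MF g0 gD gM.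
have TF e : e \in T M -> e \in F by rewrite inT => /andP[].
have notT e : e \in F -> e \notin T M -> M e = 0.
  move=> eF; rewrite inT eF/= -leNgt => Me; apply: le_anti.
  by rewrite Me M0//; exact: FS.
have [T0|] := eqVneq (T M) fset0.
  have M00 e : e \in F -> M e = 0 by move=> eF; apply: notT; rewrite ?T0.
  have g00 v e : e \in F -> incident v e -> g v = 0.
    by move=> eF ev; apply: le_anti; rewrite g0 andbT -(M00 e eF) gM//; exact: FS.
  rewrite big1_seq ?mulr0; last by move=> e /= eF; rewrite M00 ?mulr0.
  rewrite big1_seq// => e /= eF; rewrite M00// (g00 (src e) e)//; last by left.
  by rewrite (g00 (tgt e) e)//; [rewrite mulr0 !subr0|right].
move=> T0; have [e0 e0T cmin] := seq_argmin M (s := enum_fset (T M)) ltac:(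
  by apply: contra T0 => /eqP T0; rewrite -cardfs_eq0 /= T0).
set c := M e0 in cmin.
have c0 : 0 < c by move: e0T; rewrite inT => /andP[].
pose M' e := if e \in T M then M e - c else M e.
(* Unlike [M], which has no positive value below [c], the vertex values may lie strictly between 0
   and [c]; hence the truncation. *)
pose g' v := Num.max (g v - c) 0.
pose W v := 0 < g v.
have sub' e : e \in T M' -> (e \in T M) && (e != e0).
  rewrite inT /M'; have [eT /andP[_]|eT /andP[eF Me]] := boolP (e \in T M).
    by rewrite subr_gt0; apply: contraTneq => ->; rewrite ltxx.
  by rewrite inT eF Me in eT.
have MT e : S e -> 0 < M e -> e \in T M.
  move=> Se Me; rewrite inT Me andbT; apply: contraTT Me => /(MF e Se) ->.
  by rewrite ltxx.
have {}IH := IH M' g'.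
have /IH IH1 : (#|` T M'| < n)%N.
  rewrite -ltnS; apply: leq_trans nT; rewrite ltnS; apply: fproper_ltn_card.
  apply: (fproper_witness (x := e0)) => //; first by move=> e /sub'/andP[].
  by apply/negP => /sub'; rewrite eqxx andbF.
have {IH1}IH' : A * (\sum_(e <- F) len e * M' e) <=
    \sum_(e <- F) (2 * M' e - g' (src e) - g' (tgt e)).
  apply: IH1 => //.
  - move=> e Se; rewrite /M'; case: ifP => [eT|_]; last exact: M0.
    by rewrite subr_ge0 cmin.
  - by move=> e Se eF; rewrite /M' ifN ?MF//; apply: contra eF; exact: TF.
  - by move=> v; rewrite le_max lexx orbT.
  - by move=> v Dv; rewrite /g' gD//; apply/max_idPr; rewrite sub0r oppr_le0 ltW.
  - move=> v e Se ev; rewrite /M' /g' ge_max; case: ifP => [eT|eT].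
      by rewrite lerD2r gM// subr_ge0 cmin.
    rewrite M0// andbT; apply: le_trans (gM v e Se ev).
    by rewrite gerBl ltW.
have lev := @level_set_isoperimetric (T M) W ltac:(by move=> e /TF; exact: FS) ltac:(
  by move=> v Wv; split; [move=> /gD gv; rewrite /W gv ltxx in Wv|
     move=> e Se ev; apply: MT => //; exact: lt_le_trans Wv (gM v e Se ev)]).
have split1 (f : edge G -> R) : \sum_(e <- F) (if e \in T M then f e else 0) =
    \sum_(e <- T M) f e.
  rewrite -big_mkcond big_fset_condE; apply: eq_fbigl => e.
  by rewrite !inE /= andbA andbb.
have -> : \sum_(e <- F) len e * M e =
    \sum_(e <- F) len e * M' e + c * \sum_(e <- T M) len e.
  rewrite mulr_sumr -split1 -big_split; apply: eq_bigr => e _ /=.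
  by rewrite /M'; case: ifP => _; ring.
rewrite mulrDr [A * (c * _)]mulrCA.
apply: le_trans (lerD IH' (ler_wpM2l (ltW c0) lev)) _.
rewrite natr_sum mulr_sumr -split1 -big_split/= big_seq [leRHS]big_seq.
apply: ler_sum => e eF; have Se := FS e eF.
have gsrc := gM (src e) e Se (or_introl erefl).
have gtgt := gM (tgt e) e Se (or_intror erefl).
(* One endpoint accounts for at most [c]: either [g] drops by at most [c], or [g v = 0] and the
   level-set term costs [c]. Two endpoints match the drop 2c of 2M. *)
have gb v : g v - g' v + (if W v then 0 else c) <= c.
  have m1 : g v - c <= g' v by rewrite le_max lexx.
  have m2 : 0 <= g' v by rewrite le_max lexx orbT.
  by rewrite /W; have := g0 v; case: ltrP => *; lra.
have gb' v : (~~ W v)%:R * c = if W v then 0 else c.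
  by case: (W v); rewrite ?mul0r ?mul1r.
have gb0 v : incident v e -> e \notin T M -> g v - g' v = 0.
  move=> ev eT; have : g v <= 0 by rewrite -(notT e eF eT) gM.
  move=> gv; have gv0 : g v = 0 by apply: le_anti; rewrite gv g0.
  have -> : g' v = 0 by rewrite /g' gv0 sub0r; apply/max_idPr; rewrite oppr_le0 ltW.
  by rewrite gv0 subr0.
rewrite /M'; have [eT|eT] := boolP (e \in T M).
  rewrite natrD [c * _]mulrDr ![c * _]mulrC !gb'.
  by have := gb (src e); have := gb (tgt e); lra.
have := gb0 (src e) (or_introl erefl) eT; have := gb0 (tgt e) (or_intror erefl) eT.
lra.
Qed.

End Isoperimetric.
End DiscreteCheeger.

(** * The space L^2 of a metric graph *)

Section RealSum.
Context {R : realType} {G : metric_graph R}.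
Implicit Types (a b p q : edge G -> R).

Definition abs_summable a := (\esum_(e in [set: edge G]) `|a e|%:E < +oo)%E.

Local Notation total a := (\esum_(e in [set: edge G]) (a e)%:E)%E.

Lemma total_ge0 a : (forall e, 0 <= a e) -> (0 <= total a)%E.
Proof. by move=> a0; apply: esum_ge0 => e _; rewrite lee_fin. Qed.

Lemma totalD a b : (forall e, 0 <= a e) -> (forall e, 0 <= b e) ->
  (total (fun e => (a e + b e)%R) = total a + total b)%E.
Proof. by move=> a0 b0; rewrite -esumD// => e _; rewrite lee_fin. Qed.

Lemma abs_summable_ge0 a : (forall e, 0 <= a e) -> abs_summable a = (total a < +oo)%E.
Proof. by move=> a0; rewrite /abs_summable; under eq_esum do rewrite ger0_norm//. Qed.

Lemma abs_summable_le a b : (forall e, `|a e| <= `|b e|) -> abs_summable b -> abs_summable a.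
Proof. by move=> ab; apply: le_lt_trans; apply: le_esum => e _; rewrite lee_fin. Qed.

Lemma abs_summableD a b : abs_summable a -> abs_summable b ->
  abs_summable (fun e => a e + b e).
Proof.
move=> sa sb; apply: (@abs_summable_le _ (fun e => `|a e| + `|b e|)).
  by move=> e; rewrite [leRHS]ger0_norm ?addr_ge0// ler_normD.
rewrite abs_summable_ge0; last by move=> e; rewrite addr_ge0.
by rewrite totalD// lte_add_pinfty.
Qed.

Lemma totalZ_le k a : 0 < k -> (forall e, 0 <= a e) ->
  (total (fun e => (k * a e)%R) <= k%:E * total a)%E.
Proof.
move=> k0 a0; apply: ge_ereal_sup => _ [F [finF _]] <-.
under eq_fsbigr do rewrite EFinM.
rewrite -ge0_mule_fsumr; last by move=> e; rewrite lee_fin.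
rewrite lee_pmul2l// ?lte_fin//; apply: ereal_sup_ubound.
by exists F.
Qed.

Lemma totalZ k a : 0 < k -> (forall e, 0 <= a e) ->
  (total (fun e => (k * a e)%R) = k%:E * total a)%E.
Proof.
move=> k0 a0; apply/eqP; rewrite eq_le totalZ_le//=.
have ka0 e : 0 <= k * a e by rewrite mulr_ge0// ltW.
rewrite -lee_pdivlMl//; apply: le_trans (totalZ_le _ ka0); rewrite ?invr_gt0//.
by apply: le_esum => e _; rewrite mulrA mulVf ?mul1r// gt_eqF.
Qed.

Lemma abs_summableZ k a : abs_summable a -> abs_summable (fun e => k * a e).
Proof.
move=> sa; have k1 : 0 < `|k| + 1 by rewrite ltr_wpDl.
apply: (@abs_summable_le _ (fun e => (`|k| + 1) * `|a e|)).
  by move=> e; rewrite !normrM normr_id ler_wpM2r// [leRHS]ger0_norm ?lerDl// ltW.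
rewrite abs_summable_ge0; last by move=> e; rewrite mulr_ge0// ltW.
by rewrite totalZ// lte_mul_pinfty// lee_fin ltW.
Qed.

(** Any splitting into nonnegative summable families gives the same value, since the positive part
    of [a] plus [q] equals its negative part plus [p]. Additivity follows from this. *)
Lemma real_sum_diff a p q : (forall e, 0 <= p e) -> (forall e, 0 <= q e) ->
  abs_summable p -> abs_summable q -> (forall e, a e = p e - q e) ->
  real_sum a = fine (total p) - fine (total q).
Proof.
move=> p0 q0 sp sq apq; rewrite /real_sum.
have ap0 e : 0 <= Num.max (a e) 0 by rewrite le_max lexx orbT.
have an0 e : 0 <= Num.max (- a e) 0 by rewrite le_max lexx orbT.
have sa : abs_summable a.
  apply: (@abs_summable_le _ (fun e => p e + q e)); last exact: abs_summableD.
  move=> e; rewrite apq; apply: le_trans (ler_normB _ _) _.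
  by rewrite !ger0_norm ?addr_ge0.
have sap : abs_summable (fun e => Num.max (a e) 0).
  by apply: abs_summable_le sa => e; rewrite ger0_norm// ge_max ler_norm normr_ge0.
have san : abs_summable (fun e => Num.max (- a e) 0).
  apply: abs_summable_le sa => e; rewrite ger0_norm// ge_max normr_ge0.
  by rewrite -normrN ler_norm.
have fin b : (forall e, 0 <= b e) -> abs_summable b -> (total b) \is a fin_num.
  by move=> b0; rewrite abs_summable_ge0// => bfin; rewrite ge0_fin_numE// total_ge0.
have : (total (fun e => (Num.max (a e) 0 + q e)%R) =
        total (fun e => (Num.max (- a e) 0 + p e)%R))%E.
  apply: eq_esum => e _; congr EFin.
  by rewrite apq; case: (leP (p e - q e) 0); case: (leP (- (p e - q e)) 0); lra.
rewrite !totalD// => /(congr1 fine); rewrite !fineD ?fin//; lra.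
Qed.

Lemma real_sum_ge0 a : (forall e, 0 <= a e) -> abs_summable a ->
  real_sum a = fine (total a).
Proof.
move=> a0 sa; rewrite (@real_sum_diff a a (fun=> 0))//.
- by rewrite [X in _ - fine X]esum1// subr0.
- by rewrite abs_summable_ge0// esum1.
- by move=> e; rewrite subr0.
Qed.

Lemma real_sumD a b : abs_summable a -> abs_summable b ->
  real_sum (fun e => a e + b e) = real_sum a + real_sum b.
Proof.
move=> sa sb.
pose pos (c : edge G -> R) e := (`|c e| + c e) / 2.
pose neg (c : edge G -> R) e := (`|c e| - c e) / 2.
have nm (c : edge G -> R) e : - `|c e| <= c e <= `|c e|.
  by rewrite -ler_norml.
have pos0 (c : edge G -> R) e : 0 <= pos c e.
  by rewrite /pos; have /andP[] := nm c e; lra.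
have neg0 (c : edge G -> R) e : 0 <= neg c e.
  by rewrite /neg; have /andP[] := nm c e; lra.
have spos (c : edge G -> R) : abs_summable c -> abs_summable (pos c).
  apply: abs_summable_le => e; rewrite ger0_norm// /pos.
  by have /andP[] := nm c e; lra.
have sneg (c : edge G -> R) : abs_summable c -> abs_summable (neg c).
  apply: abs_summable_le => e; rewrite ger0_norm// /neg.
  by have /andP[] := nm c e; lra.
have fin c : (forall e, 0 <= c e) -> abs_summable c -> (total c) \is a fin_num.
  by move=> c0; rewrite abs_summable_ge0// => cfin; rewrite ge0_fin_numE// total_ge0.
rewrite (@real_sum_diff a (pos a) (neg a)) ?spos ?sneg//; last by move=> e; rewrite /pos /neg; lra.
rewrite (@real_sum_diff b (pos b) (neg b)) ?spos ?sneg//; last by move=> e; rewrite /pos /neg; lra.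
rewrite (@real_sum_diff _ (fun e => pos a e + pos b e) (fun e => neg a e + neg b e)).
- by rewrite !totalD// !fineD ?fin ?spos ?sneg//; lra.
- by move=> e; rewrite addr_ge0.
- by move=> e; rewrite addr_ge0.
- by apply: abs_summableD; exact: spos.
- by apply: abs_summableD; exact: sneg.
- by move=> e; rewrite /pos /neg; lra.
Qed.

Lemma real_sumN a : real_sum (fun e => - a e) = - real_sum a.
Proof. by rewrite /real_sum; under [X in _ - fine X]eq_esum do rewrite opprK; rewrite opprB. Qed.

Lemma real_sumZ k a : abs_summable a -> real_sum (fun e => k * a e) = k * real_sum a.
Proof.
move=> sa; have maxZ c d : 0 < c -> Num.max (c * d) 0 = c * Num.max d 0 :> R.
  by move=> c0; rewrite maxr_pMr ?mulr0// ltW.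
have pos c : 0 < c -> real_sum (fun e => c * a e) = c * real_sum a.
  move=> c0; rewrite /real_sum mulrBr.
  have e1 e : Num.max (c * a e) 0 = c * Num.max (a e) 0 by exact: maxZ.
  have e2 e : Num.max (- (c * a e)) 0 = c * Num.max (- a e) 0 by rewrite -mulrN maxZ.
  under eq_esum do rewrite e1; under [X in _ - fine X]eq_esum do rewrite e2.
  rewrite !totalZ//; last 2 first.
  - by move=> e; rewrite le_max lexx orbT.
  - by move=> e; rewrite le_max lexx orbT.
  have fin (d : edge G -> R) : (forall e, 0 <= d e) -> (forall e, d e <= `|a e|) ->
      (total d) \is a fin_num.
    move=> d0 da; rewrite ge0_fin_numE ?total_ge0//; apply: le_lt_trans sa.
    by apply: le_esum => e _; rewrite lee_fin.
  rewrite !fineM ?fin//.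
  - by move=> e; rewrite le_max lexx orbT.
  - by move=> e; rewrite ge_max normr_ge0 -normrN ler_norm.
  - by move=> e; rewrite le_max lexx orbT.
  - by move=> e; rewrite ge_max normr_ge0 ler_norm.
case: (ltgtP k 0) => [k0|/pos//|->].
  rewrite -[k]opprK mulNr -pos ?oppr_gt0// -real_sumN; congr real_sum.
  by apply/funext => e; rewrite mulNr.
have -> : (fun e => 0 * a e) = fun=> 0 by apply/funext => e; rewrite mul0r.
rewrite real_sum_ge0 ?esum1 ?mul0r//.
by rewrite abs_summable_ge0// esum1.
Qed.

Lemma real_sum_finite (F : {fset edge G}) a : (forall e, 0 <= a e) ->
  (forall e, e \notin F -> a e = 0) ->
  (total a = (\sum_(e <- F) a e)%:E)%E.
Proof.
move=> a0 aF; rewrite (_ : total a = \esum_(e in [set` F]) (a e)%:E)%E; last first.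
  rewrite [RHS]esum_mkcond; apply: eq_esum => e _.
  by case: ifPn => //; rewrite notin_setE /= => /negP/aF ->.
rewrite esum_fset//; last by move=> e _; rewrite lee_fin.
by rewrite fsbig_finite//= set_fsetK sumEFin.
Qed.

Lemma real_sum_fset (F : {fset edge G}) a : (forall e, e \notin F -> a e = 0) ->
  real_sum a = \sum_(e <- F) a e.
Proof.
move=> aF; rewrite /real_sum.
rewrite !(@real_sum_finite F) /=; try by [move=> e; rewrite le_max lexx orbT|
  move=> e /aF ->; rewrite ?oppr0 maxxx].
rewrite -sumrB; apply: eq_bigr => e _.
by case: (leP (a e) 0); case: (leP (- a e) 0); lra.
Qed.

Lemma abs_summable_finite (F : {fset edge G}) a :
  (forall e, e \notin F -> a e = 0) -> abs_summable a.
Proof.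
move=> aF; rewrite /abs_summable (@real_sum_finite F (fun e => `|a e|)) ?ltry//.
by move=> e /aF ->; rewrite normr0.
Qed.

End RealSum.

(** The functions of [gfun], with [Rcomplex] supplying the structure of a vector space over the
    reals. *)
Definition real_gfun {R : realType} (G : metric_graph R) : Type :=
  edge G -> R -> Rcomplex R.
HB.instance Definition _ {R : realType} (G : metric_graph R) :=
  GRing.Lmodule.copy (real_gfun G) (edge G -> R -> Rcomplex R).
HB.instance Definition _ {R : realType} (G : metric_graph R) :=
  Choice.copy (real_gfun G) (edge G -> R -> Rcomplex R).

Section Parts.
Context {R : realType}.
Implicit Types (z w : R[i]) (l : R) (u v : R -> R[i]).

(** A boolean index lets one argument serve both parts and turns complex norms into sums over
    [bool]. *)
Definition part (b : bool) (z : R[i]) : R := if b then complex.Im z else complex.Re z.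

Lemma part0 b : part b 0 = 0. Proof. by case: b. Qed.

Lemma partD b z w : part b (z + w) = part b z + part b w.
Proof. by case: b z w => -[? ?] [? ?]. Qed.

Lemma partB b z w : part b (z - w) = part b z - part b w.
Proof. by case: b z w => -[? ?] [? ?]. Qed.

Lemma part_scale b k (z : Rcomplex R) : part b (k *: z) = k * part b z.
Proof. by case: b z => -[? ?]. Qed.

Lemma scaleRc k (z : Rcomplex R) : k *: z = k%:C%C * (z : R[i]).
Proof.
by case: z => x y; apply/eqP; rewrite eq_complex /= !mul0r subr0 addr0 !eqxx.
Qed.

Lemma cabs2E z : cabs2 z = part false z ^+ 2 + part true z ^+ 2. Proof. by []. Qed.

Lemma cabs2_ge0 z : 0 <= cabs2 z. Proof. by rewrite addr_ge0 ?sqr_ge0. Qed.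

Lemma complex_eqP z w : (forall b, part b z = part b w) -> z = w.
Proof. by case: z w => [a b] [c d] h; have /= -> := h false; have /= -> := h true. Qed.

Lemma edge_L2P l u : edge_L2 l u <-> forall b, square_integrable l (fun x => part b (u x)).
Proof.
split=> [[mre mim un]|hu].
  have cint : integrable_on l (fun x => cabs2 (u x)).
    apply/integrableP; split.
      apply/measurable_EFinP; apply: measurable_funD; exact: measurable_funX.
    under eq_integral => x _ do rewrite /= ger0_norm ?cabs2_ge0//.
    exact: un.
  by case; split => //; apply: dominated_integrable_on cint;
    rewrite /=; try exact: measurable_funX; move=> x _; rewrite ger0_norm ?sqr_ge0//;
    rewrite cabs2E ?lerDl ?lerDr sqr_ge0.
have [mre ire] := hu false; have [mim iim] := hu true.
split=> //; have /integrableP[_] := integrable_onD ire iim.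
by under eq_integral => x _ do rewrite /= ger0_norm ?cabs2_ge0//.
Qed.

Local Notation itg f x y := (\int[(@lebesgue_measure R)]_(t in `[x, y]) f t).

(** The real part of the complex inner product on one edge, see [Re_cintegral]. *)
Definition edge_ip l u v := \sum_(b : bool) itg (fun x => part b (u x) * part b (v x)) 0 l.

Lemma edge_norm2E l u : edge_L2 l u -> edge_norm2 l u = (edge_ip l u u)%:E.
Proof.
move=> /edge_L2P hu; rewrite /edge_ip big_bool /= /edge_norm2.
have i1 := (hu true).2; have i2 := (hu false).2.
rewrite -(itgD i1 i2)//.
have /integrable_fin_num := integrable_onD i1 i2.
move=> /(_ (measurable_itv _)) fin.
rewrite -[LHS]fineK; last first.
  by move: fin; under eq_integral do rewrite /= addrC.
by congr (fine _)%:E; apply: eq_integral => x _; rewrite /= addrC.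
Qed.

Lemma Re_cintegral l u v : edge_L2 l u -> edge_L2 l v ->
  complex.Re (cintegral l (fun x => u x * conjc (v x))) = edge_ip l u v.
Proof.
move=> /edge_L2P hu /edge_L2P hv; rewrite /edge_ip big_bool/=.
have i1 := square_integrable_mul (hu true) (hv true).
have i2 := square_integrable_mul (hu false) (hv false).
rewrite -(itgD i1 i2)//; apply: eq_Rintegral => x _.
by case: (u x) (v x) => [a b] [c d] /=; ring.
Qed.

Lemma edge_ip_mulr_i l u v :
  edge_ip l (fun x => 'i%C * u x) (fun x => 'i%C * v x) = edge_ip l u v.
Proof.
rewrite /edge_ip !big_bool /= addrC; congr (_ + _); apply: eq_Rintegral => x _.
  by case: (u x) (v x) => [a b] [c d] /=; ring.
by case: (u x) (v x) => [a b] [c d] /=; ring.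
Qed.

Lemma edge_L2_linear l k u v : edge_L2 l u -> edge_L2 l v ->
  edge_L2 l (fun x => k * u x + v x).
Proof.
move=> /edge_L2P hu /edge_L2P hv; apply/edge_L2P => b.
case: k => kr ki.
have := square_integrableD (square_integrableD (square_integrableZ kr (hu b))
  (square_integrableZ (if b then ki else - ki) (hu (~~ b)))) (hv b).
congr (square_integrable _ _); apply/funext => x.
by case: b; case: (u x) (v x) => [a b] [c d] /=; ring.
Qed.

Lemma edge_ip_linear l k (u v w : R -> Rcomplex R) : edge_L2 l u -> edge_L2 l v -> edge_L2 l w ->
  edge_ip l (fun x => k *: u x + v x) w = k * edge_ip l u w + edge_ip l v w.
Proof.
move=> /edge_L2P hu /edge_L2P hv /edge_L2P hw.
rewrite /edge_ip mulr_sumr -big_split/=; apply: eq_bigr => b _.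
have iu := square_integrable_mul (hu b) (hw b).
have iv := square_integrable_mul (hv b) (hw b).
rewrite -(itgZ k iu)// -(itgD (integrable_onZ k iu) iv)//.
by apply: eq_Rintegral => x _; rewrite partD part_scale; ring.
Qed.

Lemma edge_ip_sym l u v : edge_ip l u v = edge_ip l v u.
Proof.
by apply: eq_bigr => b _; apply: eq_Rintegral => x _; rewrite mulrC.
Qed.

Lemma edge_ip_ge0 l u : 0 <= edge_ip l u u.
Proof. by apply: sumr_ge0 => b _; apply: itg_ge0 => x _; rewrite -expr2 sqr_ge0. Qed.

Lemma edge_ip_le l u v : edge_L2 l u -> edge_L2 l v ->
  `|edge_ip l u v| <= edge_ip l u u + edge_ip l v v.
Proof.
move=> /edge_L2P hu /edge_L2P hv.
rewrite /edge_ip -big_split/=; apply: le_trans (ler_norm_sum _ _ _) _.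
apply: ler_sum => b _.
have i1 := square_integrable_mul (hu b) (hv b).
have i2 := square_integrable_mul (hu b) (hu b).
have i3 := square_integrable_mul (hv b) (hv b).
apply: le_trans (norm_itg_le i1 (lexx 0) (lexx l)) _.
rewrite -(itgD i2 i3)//; apply: (le_itg (integrable_on_norm i1) (integrable_onD i2 i3)) => //.
move=> x _; rewrite normrM; have := sqr_ge0 (`|part b (u x)| - `|part b (v x)|).
rewrite sqrrB !real_normK ?num_real//.
have := mulr_ge0 (normr_ge0 (part b (u x))) (normr_ge0 (part b (v x))); lra.
Qed.

End Parts.

(** * Square-integrable functions as a real semi-inner product space *)

Section L2Space.
Context {R : realType} (G : metric_graph R).
Implicit Types (f g h : gfun G).

Definition sq_norm f e := edge_ip (len e) (f e) (f e).

Lemma L2P f : L2 f <-> (forall e, edge_L2 (len e) (f e)) /\ abs_summable (sq_norm f).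
Proof.
have h : (forall e, edge_L2 (len e) (f e)) -> (norm2 f < +oo)%E = abs_summable (sq_norm f).
  move=> fe; rewrite abs_summable_ge0; last by move=> e; exact: edge_ip_ge0.
  by congr (_ < _)%E; apply: eq_esum => e _; rewrite edge_norm2E.
by split => -[fe]; [rewrite h//|rewrite -h//].
Qed.

Definition gip f g := complex.Re (dotp f g).

Lemma gipE f g : L2 f -> L2 g ->
  gip f g = real_sum (fun e => edge_ip (len e) (f e) (g e)).
Proof.
move=> [fe _] [ge _]; rewrite /gip /=; congr real_sum; apply/funext => e.
exact: Re_cintegral.
Qed.

Lemma abs_summable_ip f g : L2 f -> L2 g ->
  abs_summable (fun e => edge_ip (len e) (f e) (g e)).
Proof.
move=> /L2P[fe sf] /L2P[ge sg].
apply: abs_summable_le (abs_summableD sf sg) => e.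
by rewrite [leRHS]ger0_norm ?addr_ge0 ?edge_ip_ge0// edge_ip_le.
Qed.

Lemma gip_norm2 f : L2 f -> norm2 f = (gip f f)%:E.
Proof.
move=> fL; have [fe sf] := (L2P f).1 fL.
have s0 e : 0 <= sq_norm f e by exact: edge_ip_ge0.
rewrite gipE// real_sum_ge0// fineK; last first.
  by rewrite ge0_fin_numE ?total_ge0//; rewrite -abs_summable_ge0.
by apply: eq_esum => e _; rewrite edge_norm2E.
Qed.

Lemma sq_norm_linear_le k f g e :
  edge_L2 (len e) (f e) -> edge_L2 (len e) (g e) ->
  sq_norm (gadd (gscale k f) g) e <= (2 + 2 * cabs2 k) * (sq_norm f e + sq_norm g e).
Proof.
case: k => k1 k2; set k := Complex k1 k2; set c := cabs2 k => fe ge.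
have fge : edge_L2 (len e) (gadd (gscale k f) g e) by exact: edge_L2_linear.
have c0 : 0 <= c by exact: cabs2_ge0.
rewrite /sq_norm /edge_ip !big_bool /=.
have /edge_L2P hf := fe; have /edge_L2P hg := ge; have /edge_L2P hfg := fge.
have i1 b := square_integrable_mul (hf b) (hf b).
have i2 b := square_integrable_mul (hg b) (hg b).
have i3 b := square_integrable_mul (hfg b) (hfg b).
rewrite -(itgD (i3 true) (i3 false))// -(itgD (i1 true) (i1 false))//.
rewrite -(itgD (i2 true) (i2 false))//.
have j1 := integrable_onD (i1 true) (i1 false); have j2 := integrable_onD (i2 true) (i2 false).
rewrite -(itgD j1 j2)// -(itgZ _ (integrable_onD j1 j2))//.
apply: (le_itg (integrable_onD (i3 true) (i3 false))
  (integrable_onZ _ (integrable_onD j1 j2))) => //.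
move=> x _; rewrite /c /cabs2 /gadd /gscale.
rewrite /k; case: (f e x) (g e x) => [a1 a2] [b1 b2] /=.
have := sqr_ge0 (k1 * a1 - k2 * a2 - b1); have := sqr_ge0 (k1 * a2 + k2 * a1 - b2).
have := mulr_ge0 (addr_ge0 (sqr_ge0 k1) (sqr_ge0 k2)) (addr_ge0 (sqr_ge0 b1) (sqr_ge0 b2)).
have := sqr_ge0 a1; have := sqr_ge0 a2; have := sqr_ge0 b1; have := sqr_ge0 b2.
rewrite !expr2; lra.
Qed.

Lemma L2_linear k f g : L2 f -> L2 g -> L2 (gadd (gscale k f) g).
Proof.
move=> fL gL; have [fe sf] := (L2P f).1 fL; have [ge sg] := (L2P g).1 gL.
apply/L2P; split; first by move=> e; exact: edge_L2_linear.
have sc := abs_summableZ (2 + 2 * cabs2 k) (abs_summableD sf sg).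
apply: abs_summable_le sc => e.
rewrite !ger0_norm ?edge_ip_ge0 ?sq_norm_linear_le//.
by rewrite mulr_ge0 ?addr_ge0 ?mulr_ge0 ?edge_ip_ge0 ?cabs2_ge0.
Qed.

Lemma L2_zero : L2 (gzero : gfun G).
Proof.
apply/L2P; split.
  move=> e; apply/edge_L2P => b; have := square_integrable_cst (len e) (0 : R).
  by congr (square_integrable _ _); apply/funext => x; case: b.
rewrite (_ : sq_norm _ = fun=> 0); first exact: (@abs_summable_finite _ _ fset0).
apply/funext => e; rewrite /sq_norm /edge_ip big1// => b _.
by rewrite (@eq_itg _ _ (fun=> 0)) ?itg_cst ?mul0r ?(ltW (len_gt0 e))// => x _;
  case: b; rewrite /= mulr0.
Qed.

Definition is_L2 : {pred real_gfun G} := [pred f | `[< L2 (f : gfun G) >]].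

Lemma is_L2_submod : submod_closed is_L2.
Proof.
split; first by rewrite inE; exact: L2_zero.
move=> k f g; rewrite !inE => fL gL.
have := L2_linear k%:C%C fL gL; congr L2.
apply/funext => e; apply/funext => x.
by rewrite /gadd /gscale -scaleRc.
Qed.

HB.instance Definition _ := GRing.isSubmodClosed.Build R (real_gfun G) is_L2 is_L2_submod.

(** No quotient by null functions is taken, which keeps point values available; [l2_ip] is
    accordingly only semidefinite. *)
Record l2 := L2Fun { l2_val : real_gfun G; _ : l2_val \in is_L2 }.
HB.instance Definition _ := [isSub for l2_val].
HB.instance Definition _ := [Choice of l2 by <:].
HB.instance Definition _ := [SubChoice_isSubLmodule of l2 by <:].

Lemma l2P (x : l2) : L2 (l2_val x : gfun G).
Proof. by case: x => f /=; rewrite inE. Qed.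

Lemma mem_is_L2 f : L2 f -> (f : real_gfun G) \in is_L2.
Proof. by rewrite inE. Qed.

Definition to_l2 f (fL : L2 f) : l2 := L2Fun (mem_is_L2 fL).

Definition l2_ip (x y : l2) := gip (l2_val x) (l2_val y).

Lemma psd_l2_ip : psd_form l2_ip.
Proof.
have sym x y : l2_ip x y = l2_ip y x.
  rewrite /l2_ip (gipE (l2P x) (l2P y)) (gipE (l2P y) (l2P x)).
  by congr real_sum; apply/funext => e; exact: edge_ip_sym.
have lin (z : l2) : scalar (l2_ip^~ z).
  move=> k x y; rewrite /l2_ip (gipE (l2P x) (l2P z)) (gipE (l2P y) (l2P z)).
  rewrite (gipE (l2P (k *: x + y)) (l2P z)).
  rewrite -real_sumZ; last exact: abs_summable_ip (l2P x) (l2P z).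
  rewrite -real_sumD; last 2 first.
  - by apply: abs_summableZ; exact: abs_summable_ip (l2P x) (l2P z).
  - exact: abs_summable_ip (l2P y) (l2P z).
  congr real_sum; apply/funext => e; rewrite -edge_ip_linear//.
  - by case: (l2P x).
  - by case: (l2P y).
  - by case: (l2P z).
split=> //; first by split => // x k y z; rewrite sym lin !(sym x).
move=> x; rewrite /l2_ip (gipE (l2P x) (l2P x)).
have s0 e : 0 <= edge_ip (len e) (l2_val x e) (l2_val x e) by exact: edge_ip_ge0.
by rewrite real_sum_ge0 ?fine_ge0 ?total_ge0//; exact: abs_summable_ip (l2P x) (l2P x).
Qed.

Lemma l2_norm2 (x : l2) : norm2 (l2_val x : gfun G) = (l2_ip x x)%:E.
Proof. exact: gip_norm2 (l2P x). Qed.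

Lemma L2_scale k f : L2 f -> L2 (gscale k f).
Proof.
move=> fL; have := L2_linear k fL L2_zero; congr L2.
by apply/funext => e; apply/funext => x; rewrite /gadd addr0.
Qed.

Definition mul_i (x : l2) : l2 := to_l2 (L2_scale 'i%C (l2P x)).

Lemma mul_i_linear : linear mul_i.
Proof.
move=> k x y; apply/val_inj/funext => e; apply/funext => t /=.
change ('i%C * (k *: (l2_val x e t) + l2_val y e t : R[i]) =
  (k *: ('i%C * l2_val x e t : Rcomplex R) + 'i%C * l2_val y e t : R[i])).
by rewrite mulrDr !scaleRc mulrCA.
Qed.
HB.instance Definition _ := GRing.isLinear.Build R l2 l2 *:%R mul_i mul_i_linear.

Lemma mul_i_isometry x : l2_ip (mul_i x) (mul_i x) = l2_ip x x.
Proof.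
rewrite /l2_ip (gipE (l2P x) (l2P x)) (gipE (l2P (mul_i x)) (l2P (mul_i x))).
by congr real_sum; apply/funext => e; exact: edge_ip_mulr_i.
Qed.

Lemma mul_i_skew x : l2_ip (mul_i x) x = 0.
Proof.
rewrite /l2_ip (gipE (l2P (mul_i x)) (l2P x)).
rewrite (_ : (fun e => _) = fun=> 0).
  by rewrite real_sum_ge0 ?esum1// abs_summable_ge0// esum1.
apply/funext => e; rewrite /edge_ip big_bool/=.
have /edge_L2P he := (l2P x).1 e.
have i1 := square_integrable_mul (he true) (he false).
rewrite [X in _ + X](_ : _ = \int[lebesgue_measure]_(t in `[0, len e])
  (-1 * (complex.Im (l2_val x e t) * complex.Re (l2_val x e t)))).
  rewrite (itgZ _ i1)// mulN1r; apply/eqP; rewrite subr_eq0; apply/eqP.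
  by apply: eq_Rintegral => t _; rewrite /gscale; case: (l2_val x e t) => a b /=; ring.
by apply: eq_Rintegral => t _; rewrite /gscale; case: (l2_val x e t) => a b /=; ring.
Qed.

(** The complex inner product is recovered from the real one and multiplication by i. *)
Lemma Im_dotp (x y : l2) :
  complex.Im (dotp (l2_val x : gfun G) (l2_val y : gfun G)) = l2_ip x (mul_i y).
Proof.
rewrite /l2_ip (gipE (l2P x) (l2P (mul_i y))) /=; congr real_sum; apply/funext => e.
rewrite -(Re_cintegral ((l2P x).1 e) ((l2P (mul_i y)).1 e)) /=.
apply: eq_Rintegral => t _; rewrite /gscale.
by case: (l2_val x e t) (l2_val y e t) => [a b] [c d] /=; ring.
Qed.

End L2Space.

(** * The form core *)

Section EdgeSobolev.
Context {R : realType}.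
Implicit Types (l : R) (u v : R -> R[i]).
Local Notation itg f x y := (\int[(@lebesgue_measure R)]_(t in `[x, y]) f t).

Lemma primitive_linear l k (F G w v : R -> R) : primitive l F w -> primitive l G v ->
  primitive l (fun x => k * F x + G x) (fun x => k * w x + v x).
Proof.
move=> [wi FE] [vi GE]; split.
  exact: square_integrableD (square_integrableZ k wi) vi.
move=> x xl; have /andP[x0 x1] := xl.
have wI := square_integrable_integrable wi.
rewrite (itgD (integrable_onZ k wI) (square_integrable_integrable vi))// (itgZ k wI)//.
by rewrite (FE x xl) (GE x xl); ring.
Qed.

Lemma edge_H1P l u u' : edge_H1 l u u' <->
  forall b, primitive l (fun x => part b (u x)) (fun x => part b (u' x)).
Proof.
split=> [[u'L uE] b|hu].
  split; first by move/edge_L2P : u'L; exact.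
  by move=> x xl; rewrite (uE x xl) partD; case: b.
split; first by apply/edge_L2P => b; case: (hu b).
move=> x xl; apply: complex_eqP => b; rewrite partD (hu b).2//.
by case: b.
Qed.

Lemma edge_H1_linear l k u u' v v' : edge_H1 l u u' -> edge_H1 l v v' ->
  edge_H1 l (fun x => k * u x + v x) (fun x => k * u' x + v' x).
Proof.
move=> /edge_H1P hu /edge_H1P hv; apply/edge_H1P => b; case: k => kr ki.
have := primitive_linear kr (hu b)
  (primitive_linear (if b then ki else - ki) (hu (~~ b)) (hv b)).
congr (primitive _ _ _); apply/funext => x.
  by case: b; case: (u x) (v x) => [a1 a2] [b1 b2] /=; ring.
by case: b; case: (u' x) (v' x) => [a1 a2] [b1 b2] /=; ring.
Qed.

Lemma edge_H1_0 l : 0 <= l -> edge_H1 l (fun=> 0) (fun=> 0).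
Proof.
move=> l0; apply/edge_H1P => b; rewrite (_ : (fun=> part b 0) = fun=> 0).
  split; first exact: square_integrable_cst.
  by move=> x /andP[x0 _]; rewrite itg_cst// mul0r addr0.
by apply/funext => x; case: b.
Qed.

(** [primitive_weak_null] with [V] equal to the derivative [w] itself and S = 0: the integral of w^2
    is then at most any positive multiple of l + E. *)
Lemma primitive_eq0 l (F w w' : R -> R) : 0 < l -> primitive l F w -> primitive l w w' ->
  (forall x, 0 <= x <= l -> F x = 0) -> itg (fun x => w x ^+ 2) 0 l = 0.
Proof.
move=> l0 Fw ww' F0; set E := itg _ 0 l.
have E0 : 0 <= E by apply: itg_ge0 => x _; exact: sqr_ge0.
have lE : 0 < l + E by rewrite ltr_pwDl.
apply: le_anti; rewrite E0 andbT; apply/ler_addgt0Pr => eps eps0; rewrite add0r.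
have [C C0] := primitive_weak_null l0 ww' (divr_gt0 eps0 lE).
move=> /(_ F w 0 Fw) /(_ _)/wrap[x xl|]; first by rewrite F0// normr0.
rewrite mulr0 add0r -/E divfK ?gt_eqF// => /(le_trans (ler_norm _)).
by apply: le_trans; rewrite le_eqVlt; apply/orP; left; apply/eqP/eq_itg.
Qed.

End EdgeSobolev.

Definition gfun_pair {R : realType} (G : metric_graph R) : Type :=
  (real_gfun G * real_gfun G)%type.
HB.instance Definition _ {R : realType} (G : metric_graph R) :=
  GRing.Lmodule.copy (gfun_pair G) (real_gfun G * real_gfun G)%type.
HB.instance Definition _ {R : realType} (G : metric_graph R) :=
  Choice.copy (gfun_pair G) (real_gfun G * real_gfun G)%type.

Section FormCore.
Context {R : realType} (G : metric_graph R) (VD : set (vertex G)).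
Implicit Types (f g : gfun G) (e : edge G) (k : R[i]).

Lemma end_value_linear k f g v e :
  end_value (gadd (gscale k f) g) v e = k * end_value f v e + end_value g v e.
Proof. by rewrite /end_value; case: ifP. Qed.

Lemma end_deriv_linear k f g v e :
  end_deriv (gadd (gscale k f) g) v e = k * end_deriv f v e + end_deriv g v e.
Proof. by rewrite /end_deriv; case: ifP => // _; rewrite mulrN opprD. Qed.

Lemma dom_H0_linear k f f' g g' : dom_H0 VD f f' -> dom_H0 VD g g' ->
  dom_H0 VD (gadd (gscale k f) g) (gadd (gscale k f') g').
Proof.
move=> [f1 [f'' f2] f3 [f4 f5]] [g1 [g'' g2] g3 [g4 g5]]; split.
- by move=> e; exact: edge_H1_linear.
- by exists (gadd (gscale k f'') g'') => e; exact: edge_H1_linear.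
- apply: (@sub_finite_set _ _ ([set e | exists2 x, 0 <= x <= len e & f e x != 0] `|`
    [set e | exists2 x, 0 <= x <= len e & g e x != 0])); last by rewrite finite_setU.
  move=> e [x xl]; rewrite /gadd /gscale; have [fx|fx] := eqVneq (f e x) 0.
    by rewrite fx mulr0 add0r => gx; right; exists x.
  by move=> _; left; exists x.
- split=> [v vD e ev|v vD].
    by rewrite end_value_linear f4// g4// mulr0 addr0.
  have [fc fk] := f5 v vD; have [gc gk] := g5 v vD; split.
    by move=> e e' ev ev'; rewrite !end_value_linear (fc e e')// (gc e e').
  move: fk gk; rewrite !(fsbig_finite _ _ (locally_finite v))/= => fk gk.
  under eq_bigr do rewrite end_deriv_linear.
  by rewrite big_split/= -mulr_sumr fk gk mulr0 addr0.
Qed.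

Lemma dom_H0_zero : dom_H0 VD gzero gzero.
Proof.
have l0 e : 0 <= len e := ltW (len_gt0 e).
split; [by move=> e; exact: edge_H1_0|by exists gzero => e; exact: edge_H1_0| |].
  apply: (@sub_finite_set _ _ set0) => //.
  by move=> e [x _]; rewrite /gzero eqxx.
split=> [v _ e _|v _]; first by rewrite /end_value /gzero if_same.
split; first by move=> e e' _ _; rewrite /end_value /gzero !if_same.
rewrite fsbig_finite ?big1//; last exact: locally_finite.
by move=> e _; rewrite /end_deriv /gzero oppr0 if_same.
Qed.

(** The core consists of pairs (f, f'), so that the derivative is a linear map on it and no choice
    is involved. *)
Definition is_core : {pred gfun_pair G} :=
  [pred p | `[< dom_H0 VD (p.1 : gfun G) (p.2 : gfun G) >]].

Lemma gscale_realE (c : R) (f g : real_gfun G) :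
  gadd (gscale c%:C%C (f : gfun G)) (g : gfun G) = (c *: f + g : real_gfun G)
  :> (edge G -> R -> R[i]).
Proof. by apply/funext => e; apply/funext => x; rewrite /gadd /gscale -scaleRc. Qed.

Lemma is_core_submod : submod_closed is_core.
Proof.
split; first by rewrite inE; exact: dom_H0_zero.
move=> c p q; rewrite !inE => hp hq.
by have := dom_H0_linear c%:C%C hp hq; rewrite !gscale_realE.
Qed.

HB.instance Definition _ :=
  GRing.isSubmodClosed.Build R (gfun_pair G) is_core is_core_submod.

Record core := CoreFun { core_val : gfun_pair G;
  _ : core_val \in is_core }.
HB.instance Definition _ := [isSub for core_val].
HB.instance Definition _ := [Choice of core by <:].
HB.instance Definition _ := [SubChoice_isSubLmodule of core by <:].

Lemma coreP (p : core) : dom_H0 VD ((core_val p).1 : gfun G) ((core_val p).2 : gfun G).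
Proof. by case: p => p /=; rewrite inE. Qed.

Lemma mem_is_core f f' : dom_H0 VD f f' -> ((f, f') : gfun_pair G) \in is_core.
Proof. by rewrite inE. Qed.

Definition to_core f f' (h : dom_H0 VD f f') : core := CoreFun (mem_is_core h).

Definition support f : {fset edge G} :=
  fset_set [set e | exists2 x, 0 <= x <= len e & f e x != 0].

Lemma notin_support f f' e : dom_H0 VD f f' -> e \notin support f ->
  forall x, 0 <= x <= len e -> f e x = 0.
Proof.
move=> [_ _ fs _]; rewrite in_fset_set// notin_setE/= => h x xl.
by apply/eqP; apply: contrapT => /negP fx; apply: h; exists x.
Qed.

Lemma dom_H0_primitive f f' b e : dom_H0 VD f f' ->
  primitive (len e) (fun x => part b (f e x)) (fun x => part b (f' e x)).
Proof. by move=> [h _ _ _]; exact: (edge_H1P _ _ _).1 (h e) b. Qed.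

Lemma dom_H0_primitive2 f f' : dom_H0 VD f f' -> exists f'' : gfun G, forall b e,
  primitive (len e) (fun x => part b (f' e x)) (fun x => part b (f'' e x)).
Proof. by move=> [_ [f'' h] _ _]; exists f'' => b e; exact: (edge_H1P _ _ _).1 (h e) b. Qed.

Lemma dom_H0_c1 f f' b e : dom_H0 VD f f' ->
  c1 (len e) (fun x => part b (f e x)) (fun x => part b (f' e x)).
Proof.
move=> h; split; first exact: dom_H0_primitive.
have [f'' h2] := dom_H0_primitive2 h.
exact: primitive_continuous (ltW (len_gt0 e)) (h2 b e).
Qed.

Lemma sq_normE (h : gfun G) e :
  sq_norm h e = \sum_(b : bool) \int[lebesgue_measure]_(t in `[0, len e]) (part b (h e t) ^+ 2).
Proof. by apply: eq_bigr => b _; apply: eq_Rintegral => t _; rewrite expr2. Qed.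

Lemma sq_norm_support f f' e : dom_H0 VD f f' -> e \notin support f -> sq_norm f e = 0.
Proof.
move=> h es; rewrite sq_normE big1// => b _.
rewrite (@eq_itg _ _ (fun=> 0)) ?itg_cst ?mul0r ?(ltW (len_gt0 e))// => x xl.
by rewrite (notin_support h es xl); case: b; rewrite expr0n.
Qed.

Lemma sq_norm_deriv_support f f' e : dom_H0 VD f f' -> e \notin support f ->
  sq_norm f' e = 0.
Proof.
move=> h es; rewrite sq_normE big1// => b _.
have [f'' h2] := dom_H0_primitive2 h.
apply: (primitive_eq0 (len_gt0 e) (dom_H0_primitive b e h) (h2 b e)) => x xl.
by rewrite (notin_support h es xl); case: b.
Qed.

Lemma dom_H0_L2 f f' : dom_H0 VD f f' -> L2 f.
Proof.
move=> h; apply/L2P; split; last first.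
  by apply: (@abs_summable_finite _ _ (support f)) => e; exact: sq_norm_support h.
move=> e; apply/edge_L2P => b; apply: continuous_square_integrable.
exact: primitive_continuous (ltW (len_gt0 e)) (dom_H0_primitive b e h).
Qed.

Lemma dom_H0_deriv_L2 f f' : dom_H0 VD f f' -> L2 f'.
Proof.
move=> h; apply/L2P; split; last first.
  by apply: (@abs_summable_finite _ _ (support f)) => e; exact: sq_norm_deriv_support h.
by move=> e; apply/edge_L2P => b; case: (dom_H0_primitive b e h).
Qed.

Definition core_fun (p : core) : l2 G := to_l2 (dom_H0_L2 (coreP p)).
Definition core_deriv (p : core) : l2 G := to_l2 (dom_H0_deriv_L2 (coreP p)).

Lemma core_fun_linear : linear core_fun.
Proof. by move=> c p q; exact/val_inj. Qed.
Lemma core_deriv_linear : linear core_deriv.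
Proof. by move=> c p q; exact/val_inj. Qed.
HB.instance Definition _ := GRing.isLinear.Build R core (l2 G) *:%R core_fun core_fun_linear.
HB.instance Definition _ := GRing.isLinear.Build R core (l2 G) *:%R core_deriv core_deriv_linear.

End FormCore.

(** * Limits of L^2-Cauchy sequences that converge uniformly on each edge *)

Section LocallyUniformLimit.
Context {R : realType} (G : metric_graph R).
Implicit Types (f g h : gfun G) (e : edge G).

Definition gdiff f g : gfun G := gadd (gscale (-1) g) f.

Lemma gdiffE f g e t : gdiff f g e t = f e t - g e t.
Proof. by rewrite /gdiff /gadd /gscale mulN1r addrC. Qed.

Lemma gsubE f g : gsub f g = gdiff f g.
Proof. by apply/funext => e; apply/funext => t; rewrite gdiffE. Qed.

Lemma edge_L2_gdiff f g e : edge_L2 (len e) (f e) -> edge_L2 (len e) (g e) ->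
  edge_L2 (len e) (gdiff f g e).
Proof. by move=> fe ge; exact: edge_L2_linear. Qed.

Lemma sq_norm_triangle f g h e : edge_L2 (len e) (f e) -> edge_L2 (len e) (g e) ->
  edge_L2 (len e) (h e) ->
  sq_norm (gdiff f g) e <= 4 * (sq_norm (gdiff f h) e + sq_norm (gdiff h g) e).
Proof.
move=> fe ge he.
have -> : gdiff f g = gadd (gscale 1 (gdiff f h)) (gdiff h g).
  apply/funext => x; apply/funext => t.
  by rewrite [RHS]/gadd /gscale mul1r !gdiffE addrA subrK.
have := sq_norm_linear_le 1 (edge_L2_gdiff fe he) (edge_L2_gdiff he ge).
by rewrite /cabs2 /= expr1n expr0n addr0 mulr1 (_ : 2 + 2 = 4)//; lra.
Qed.

(** The limit is taken pointwise. The rate [K e] depends on the edge, so convergence in L^2 comes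
    from the Cauchy bound on finite sets of edges, which is independent of the set. *)
Lemma L2_locally_uniform_limit (F : nat -> gfun G) (K : edge G -> R) :
  (forall n, L2 (F n)) -> (forall e, 0 <= K e) ->
  (forall eps : R, 0 < eps -> exists N, forall m n, (N <= m)%N -> (N <= n)%N ->
    (forall S : {fset edge G}, \sum_(e <- S) sq_norm (gdiff (F m) (F n)) e <= eps ^+ 2) /\
    forall b e t, 0 <= t <= len e -> `|part b (F m e t) - part b (F n e t)| <= K e * eps) ->
  exists2 f, L2 f & forall eps : R, 0 < eps -> exists N, forall m, (N <= m)%N ->
    (norm2 (gdiff (F m) f) <= eps%:E)%E.
Proof.
move=> FL K0 cauchyF.
have FLe n e : edge_L2 (len e) (F n e) by case: (FL n).
have ev_cvg b e t : 0 <= t <= len e -> cvgn (fun n => part b (F n e t)).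
  move=> tl; have K1 : 0 < K e + 1 by rewrite ltr_wpDl.
  apply: R_complete; apply/cauchy_exP => eps eps0.
  have [N hN] := cauchyF (eps / 2 / (K e + 1)) ltac:(by rewrite !divr_gt0).
  exists (part b (F N e t)); exists N => // n /= Nn; rewrite -ball_normE /=.
  have [_ h] := hN N n (leqnn N) Nn; apply: le_lt_trans (h b e t tl) _.
  apply: (@le_lt_trans _ _ ((K e + 1) * (eps / 2 / (K e + 1)))).
    by rewrite ler_wpM2r ?lerDl// !divr_ge0// ltW.
  by rewrite mulrC divfK ?gt_eqF//; lra.
pose f : gfun G := fun e t =>
  Complex (limn (fun n => part false (F n e t))) (limn (fun n => part true (F n e t))).
have fE b e t : part b (f e t) = limn (fun n => part b (F n e t)) by case: b.
have close eps : 0 < eps -> exists N, forall m, (N <= m)%N -> forall b e t,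
    0 <= t <= len e -> `|part b (F m e t) - part b (f e t)| <= K e * eps.
  move=> eps0; have [N hN] := cauchyF eps eps0; exists N => m Nm b e t tl.
  have h : (fun n => `|part b (F m e t) - part b (F n e t)|) @ \oo -->
      `|part b (F m e t) - part b (f e t)|.
    by apply: cvg_norm; apply: cvgB; [exact: cvg_cst|rewrite fE; exact: ev_cvg].
  rewrite -(cvg_lim _ h)//; apply: limr_le; first by apply/cvg_ex; eexists; exact: h.
  by exists N => // n /= Nn; have [_] := hN m n Nm Nn; apply.
have mf b e : measurable_fun `[0, len e] (fun t => part b (f e t)).
  apply: (measurable_fun_cvg (h := fun n t => part b (F n e t))).
    by move=> n; have /edge_L2P/(_ b)[] := FLe n e.
  by move=> t; rewrite /= in_itv/= => tl; rewrite fE; exact: ev_cvg.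
have fL e : edge_L2 (len e) (f e).
  apply/edge_L2P => b; split => //.
  have [N hN] := close 1 ltr01.
  have /edge_L2P/(_ b)[mu iu] := FLe N e.
  apply: (dominated_integrable_on (g := fun t => 2 * part b (F N e t) ^+ 2 + 2 * K e ^+ 2)).
  - exact: measurable_funX.
  - move=> t tl; rewrite ger0_norm ?sqr_ge0//.
    have := hN N (leqnn N) b e t tl; rewrite mulr1.
    rewrite -(ler_pXn2r (n := 2)) ?nnegrE// real_normK ?num_real//.
    move: (part b (F N e t)) (part b (f e t)) (K e) => x y k h.
    have := sqr_ge0 (2 * x - y); lra.
  - exact: integrable_onD (integrable_onZ 2 iu) (integrable_on_cst _ _).
have dfL m e : edge_L2 (len e) (gdiff (F m) f e) by exact: edge_L2_gdiff.
have sum_le eps : 0 < eps -> exists N, forall m, (N <= m)%N -> forall S : {fset edge G},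
    \sum_(e <- S) sq_norm (gdiff (F m) f) e <= 4 * eps ^+ 2 + eps.
  move=> eps0; have [N hN] := cauchyF eps eps0; exists N => m Nm S.
  pose B := \sum_(e <- S) 8 * (len e * K e ^+ 2).
  have l0 e : 0 <= len e := ltW (len_gt0 e).
  have B0 : 0 <= B by apply: sumr_ge0 => e _; rewrite mulr_ge0// mulr_ge0 ?sqr_ge0.
  have B1 : 0 < B + 1 by rewrite ltr_wpDl.
  (* An intermediate index [k], depending on the finite set [S], makes the uniform error on [S] at
     most B d^2 <= B d <= eps; [k] disappears from the final bound. In [B], 8 is the triangle
     constant 4 times the two parts. *)
  pose d := Num.min 1 (eps / (B + 1)).
  have d0 : 0 < d by rewrite lt_min ltr01 divr_gt0.
  have dB : B * d ^+ 2 <= eps.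
    have d1 : d <= 1 by rewrite ge_min lexx.
    have : d <= eps / (B + 1) by rewrite ge_min lexx orbT.
    rewrite ler_pdivlMr// => d2; rewrite -subr_ge0 in d1.
    have := mulr_ge0 (mulr_ge0 (ltW d0) B0) d1.
    move: (d) (B) d0 B0 d2 => x y *. lra.
  have [N' hN'] := close d d0.
  pose k := maxn N N'.
  have le_e e : sq_norm (gdiff (F m) f) e <=
      4 * sq_norm (gdiff (F m) (F k)) e + 8 * (len e * K e ^+ 2) * d ^+ 2.
    apply: le_trans (sq_norm_triangle (FLe m e) (fL e) (FLe k e)) _.
    rewrite mulrDr lerD2l.
    rewrite (_ : 8 * _ * _ = 4 * (2 * (len e * (K e * d) ^+ 2))); last by rewrite exprMn; ring.
    apply: ler_wpM2l => //; rewrite sq_normE big_bool/= mulr_natl mulr2n.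
    have /edge_L2P kL := dfL k e.
    have bnd b : \int[lebesgue_measure]_(t in `[0, len e])
       (part b (gdiff (F k) f e t) ^+ 2) <= len e * (K e * d) ^+ 2.
      apply: (itg_sqr_le (l0 e) (kL b).2) => t tl; rewrite gdiffE partB.
      have := hN' k (leq_maxr _ _) b e t tl.
      rewrite -(ler_pXn2r (n := 2)) ?nnegrE// ?mulr_ge0 ?(ltW d0)//.
      by rewrite real_normK ?num_real.
    by apply: lerD; [exact: (bnd true)|exact: (bnd false)].
  apply: le_trans (ler_sum _ (fun e _ => le_e e)) _.
  rewrite big_split/= -mulr_sumr -mulr_suml -/B; apply: lerD => //.
  by apply: ler_wpM2l => //; have [+ _] := hN m k Nm (leq_maxl _ _); apply.
have norm_le eps : 0 < eps -> exists N, forall m, (N <= m)%N ->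
    (norm2 (gdiff (F m) f) <= (4 * eps ^+ 2 + eps)%:E)%E.
  move=> eps0; have [N hN] := sum_le eps eps0; exists N => m Nm.
  apply: ge_ereal_sup => _ [S [finS _]] <-.
  rewrite fsbig_finite//= (eq_bigr (fun e => (sq_norm (gdiff (F m) f) e)%:E)).
    by rewrite sumEFin lee_fin; exact: hN.
  by move=> e _; rewrite edge_norm2E.
exists f.
  have [N hN] := norm_le 1 ltr01.
  have h : L2 (gdiff (F N) f).
    split=> [e|]; first exact: dfL.
    by apply: le_lt_trans (hN N (leqnn N)) _; rewrite ltry.
  have := L2_linear (-1) h (FL N); congr L2.
  apply/funext => e; apply/funext => t.
  by rewrite /gadd /gscale gdiffE mulN1r opprB addrNK.
move=> eps eps0; pose d := Num.min 1 (eps / 5).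
have d0 : 0 < d by rewrite lt_min ltr01 divr_gt0.
have [N hN] := norm_le d d0; exists N => m Nm; apply: le_trans (hN m Nm) _.
have d1 : d <= 1 by rewrite ge_min lexx.
have d2 : d <= eps / 5 by rewrite ge_min lexx orbT.
rewrite lee_fin; rewrite -subr_ge0 in d1; have := mulr_ge0 (ltW d0) d1.
by move: (d) d2 => x *; lra.
Qed.

End LocallyUniformLimit.

Section CoreCompleteness.
Context {R : realType} (G : metric_graph R) (VD : set (vertex G)).
Implicit Types (e : edge G) (b : bool) (t : R) (p : core VD) (u : nat -> core VD).

Local Notation ip := (@l2_ip R G).
Local Notation iota := (@core_fun R G VD).
Local Notation delta := (@core_deriv R G VD).
Local Notation nx := (seminorm ip).
Local Notation nv := (seminorm (h1 ip iota delta)).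
Local Notation psd_ip := (@psd_l2_ip R G).

Lemma sq_norm_le_ip (x : l2 G) e : sq_norm (l2_val x : gfun G) e <= ip x x.
Proof.
have [xe sx] := (L2P _).1 (l2P x).
rewrite -lee_fin -l2_norm2; apply: esum_ge; exists [set e].
  by split; [exact: finite_set1|].
by rewrite fsbig_set1 edge_norm2E.
Qed.

Lemma sum_sq_norm_le_ip (x : l2 G) (F : {fset edge G}) :
  \sum_(e <- F) sq_norm (l2_val x : gfun G) e <= ip x x.
Proof.
have [xe sx] := (L2P _).1 (l2P x).
rewrite -lee_fin -l2_norm2; apply: esum_ge; exists [set` F]; first by split.
rewrite fsbig_finite//= set_fsetK -sumEFin.
by apply: lee_sum => e _; rewrite edge_norm2E.
Qed.

Definition eval b e t p := part b ((core_val p).1 e t).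

Lemma eval_scalar b e t : scalar (eval b e t).
Proof. by move=> c p q; rewrite /eval /= partD part_scale. Qed.

Lemma part_itg_le_ip (x : l2 G) b e :
  \int[lebesgue_measure]_(t in `[0, len e]) (part b (l2_val x e t) ^+ 2) <= ip x x.
Proof.
apply: le_trans (sq_norm_le_ip x e); rewrite sq_normE (bigD1 b)//= lerDl.
by apply: sumr_ge0 => c _; apply: itg_ge0 => t _; exact: sqr_ge0.
Qed.

Lemma eval_sqr_le b e t p s : 0 < s -> 0 <= t <= len e ->
  eval b e t p ^+ 2 <= ((len e)^-1 + s) * ip (iota p) (iota p) + s^-1 * ip (delta p) (delta p).
Proof.
move=> s0 tl; apply: le_trans (c1_sup (len_gt0 e) (dom_H0_c1 b e (coreP p)) tl s0) _.
have l0 : 0 <= (len e)^-1 by rewrite invr_ge0 ltW// len_gt0.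
apply: lerD; apply: ler_wpM2l.
- by rewrite addr_ge0// ltW.
- exact: (part_itg_le_ip (iota p)).
- by rewrite invr_ge0 ltW.
- exact: (part_itg_le_ip (delta p)).
Qed.

(** Point evaluations are continuous in the form norm. This makes form-Cauchy sequences uniformly
    Cauchy on every edge, and point constraints admissible as functionals of finite codimension. *)
Lemma eval_bounded e : exists2 K : R, 0 <= K & forall b t p, 0 <= t <= len e ->
  `|eval b e t p| <= K * nv p.
Proof.
have l0 : 0 < (len e)^-1 by rewrite invr_gt0 len_gt0.
exists (Num.sqrt ((len e)^-1 + 2)); first exact: sqrtr_ge0.
move=> b t p tl.
rewrite -(ler_pXn2r (n := 2)) ?nnegrE ?mulr_ge0 ?seminorm_ge0 ?sqrtr_ge0//.
rewrite real_normK ?num_real// exprMn sqr_sqrtr; last by lra.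
rewrite (sqr_seminorm (psd_h1 iota delta psd_ip)).
apply: le_trans (eval_sqr_le b p ltr01 tl) _.
rewrite /h1 /mass /form invr1 mul1r.
have [_ _ p0] := psd_ip; have m0 := p0 (iota p); have f0 := p0 (delta p).
have am := mulr_ge0 (ltW l0) m0; have af := mulr_ge0 (ltW l0) f0.
move: m0 f0 am af; move: (ip _ _) (ip _ _) (_^-1) => M F a; lra.
Qed.

Lemma l2_val_sub (x y : l2 G) :
  l2_val (x - y) = gdiff (l2_val x : gfun G) (l2_val y : gfun G) :> gfun G.
Proof. by apply/funext => e; apply/funext => t; rewrite gdiffE. Qed.

Lemma norm2_gdiff (x y : l2 G) :
  norm2 (gdiff (l2_val x : gfun G) (l2_val y : gfun G)) = (nx (x - y) ^+ 2)%:E.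
Proof. by rewrite -l2_val_sub l2_norm2 (sqr_seminorm psd_ip). Qed.

Lemma core_complete u : h1_cauchy ip iota delta u ->
  exists x, xlim ip (fun n => iota (u n)) x.
Proof.
move=> cu; have /choice[K hK] e : exists K, 0 <= K /\ forall b t p, 0 <= t <= len e ->
    `|eval b e t p| <= K * nv p.
  by have [K K0 hK] := eval_bounded e; exists K.
have [] := @L2_locally_uniform_limit R G (fun n => l2_val (iota (u n))) K.
- by move=> n; exact: l2P.
- by move=> e; case: (hK e).
- move=> eps eps0; have [N hN] := cu eps eps0; exists N => m n Nm Nn; split.
    move=> S; rewrite -l2_val_sub -linearB; apply: le_trans (sum_sq_norm_le_ip _ S) _.
    rewrite -(sqr_seminorm psd_ip) ler_pXn2r ?nnegrE ?seminorm_ge0 ?(ltW eps0)//.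
    by apply: le_trans (iota_le_h1 iota delta psd_ip _) _; exact: hN.
  move=> b e t tl; have [K0 hKe] := hK e.
  rewrite -/(eval b e t (u m)) -/(eval b e t (u n)) -(scalarB (eval_scalar b e t)).
  by apply: le_trans (hKe b t _ tl) _; apply: ler_wpM2l => //; exact: hN.
move=> f fL hf; exists (to_l2 fL); apply/cvgrPdist_le => eps eps0.
have [N hN] := hf (eps ^+ 2) (exprn_gt0 2 eps0); exists N => // n /= Nn.
rewrite sub0r normrN ger0_norm ?seminorm_ge0//.
rewrite -(ler_pXn2r (n := 2)) ?nnegrE ?seminorm_ge0 ?(ltW eps0)//.
by rewrite -lee_fin -norm2_gdiff; exact: hN.
Qed.

End CoreCompleteness.

(** * Closability of the form *)

Section CoreClosable.
Context {R : realType} (G : metric_graph R) (VD : set (vertex G)).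
Implicit Types (e : edge G) (b : bool) (t : R) (p : core VD) (u : nat -> core VD).

Local Notation ip := (@l2_ip R G).
Local Notation iota := (@core_fun R G VD).
Local Notation delta := (@core_deriv R G VD).
Local Notation nx := (seminorm ip).
Local Notation nv := (seminorm (h1 ip iota delta)).
Local Notation psd_ip := (@psd_l2_ip R G).

Definition l2_edge_ip e (x y : l2 G) := edge_ip (len e) (l2_val x e) (l2_val y e).

Lemma psd_l2_edge_ip e : psd_form (l2_edge_ip e).
Proof.
have lin z : scalar ((l2_edge_ip e)^~ z).
  by move=> k x y; apply: edge_ip_linear; [case: (l2P x)|case: (l2P y)|case: (l2P z)].
have sym x y : l2_edge_ip e x y = l2_edge_ip e y x by exact: edge_ip_sym.
split=> //; first by split=> // x k y z; rewrite sym lin !(sym x).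
by move=> x; exact: edge_ip_ge0.
Qed.

Definition core_support p := support ((core_val p).1 : gfun G).

Lemma ip_core_deriv (x : l2 G) p :
  ip x (delta p) = \sum_(e <- core_support p) l2_edge_ip e x (delta p).
Proof.
rewrite /l2_ip (gipE (l2P x) (l2P (delta p))); apply: real_sum_fset => e ep.
apply/eqP; rewrite -normr_le0.
apply: le_trans (cauchy_schwarz_psd (psd_l2_edge_ip e) x (delta p)) _.
have -> : seminorm (l2_edge_ip e) (delta p) = 0; last by rewrite mulr0.
by apply/eqP; rewrite sqrtr_eq0; rewrite -(sq_norm_deriv_support (coreP p) ep).
Qed.

(** Only the finitely many edges in the support of [p] matter. On each of them [u n] tends to 0
    uniformly while its derivative stays bounded in L^2, which is the situation of
    [primitive_weak_null]. *)
Lemma core_weak_null u p : h1_cauchy ip iota delta u ->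
  (fun n => nx (iota (u n))) @ \oo --> (0 : R) ->
  (fun n => ip (delta (u n)) (delta p)) @ \oo --> (0 : R).
Proof.
move=> cu iu0.
have [M M0 hM] := h1_cauchy_bounded psd_ip cu.
have dM n : ip (delta (u n)) (delta (u n)) <= M ^+ 2.
  rewrite -(sqr_seminorm psd_ip) ler_pXn2r ?nnegrE ?seminorm_ge0 ?(ltW M0)//.
  exact: le_trans (delta_le_h1 iota delta psd_ip _) (hM n).
have small e (S : R) : 0 < S -> \forall n \near \oo, forall b t, 0 <= t <= len e ->
    `|eval b e t (u n)| <= S.
  (* This weight turns the derivative term s^-1 M^2 of [eval_sqr_le] into S^2/2; the other half is
     left to the L^2 norm. *)
  move=> S0; pose s := 2 * M ^+ 2 / S ^+ 2.
  have s0 : 0 < s by rewrite divr_gt0 ?mulr_gt0 ?exprn_gt0.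
  have q0 : 0 < (len e)^-1 + s by rewrite addr_gt0 ?invr_gt0 ?len_gt0.
  have d0 : 0 < S ^+ 2 / 2 / ((len e)^-1 + s) by rewrite !divr_gt0 ?exprn_gt0.
  have sq0 : (fun n => nx (iota (u n)) ^+ 2) @ \oo --> (0 : R).
    rewrite -[X in _ --> X](mulr0 (0 : R)).
    by under eq_fun do rewrite expr2; exact: cvgM.
  move/cvgrPdist_le : sq0 => /(_ _ d0); apply: filterS => n.
  rewrite sub0r normrN ger0_norm ?sqr_ge0// (sqr_seminorm psd_ip) => hn b t tl.
  rewrite -(ler_pXn2r (n := 2)) ?nnegrE ?(ltW S0)// real_normK ?num_real//.
  apply: le_trans (eval_sqr_le b (u n) s0 tl) _.
  rewrite [leRHS]splitr; apply: lerD; first by rewrite mulrC -ler_pdivlMr.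
  apply: (@le_trans _ _ (s^-1 * M ^+ 2)).
    by apply: ler_wpM2l => //; rewrite invr_ge0 ltW.
  rewrite /s le_eqVlt; apply/orP; left; apply/eqP; field.
  by rewrite !gt_eqF.
have [f'' hf''] := dom_H0_primitive2 (coreP p).
have edge_null e b : (fun n => \int[lebesgue_measure]_(t in `[0, len e])
    (part b (l2_val (delta (u n)) e t) * part b (l2_val (delta p) e t))) @ \oo --> (0 : R).
  apply/cvgrPdist_le => eps eps0.
  have lM : 0 < len e + M ^+ 2 by rewrite addr_gt0 ?len_gt0 ?exprn_gt0.
  have [C C0 hC] := primitive_weak_null (len_gt0 e) (hf'' b e)
    (divr_gt0 (divr_gt0 eps0 (ltr0Sn R 1)) lM).
  have C1 : 0 < C + 1 by rewrite ltr_wpDl.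
  have S0 : 0 < eps / 2 / (C + 1) by rewrite !divr_gt0.
  have := small e _ S0; apply: filterS => n hn; rewrite sub0r normrN.
  apply: le_trans (hC _ _ _ (dom_H0_primitive b e (coreP (u n))) (fun t tl => hn b t tl)) _.
  rewrite [leRHS]splitr; apply: lerD.
    apply: (@le_trans _ _ ((C + 1) * (eps / 2 / (C + 1)))).
      by rewrite ler_wpM2r ?lerDl// ltW.
    by rewrite mulrC divfK ?gt_eqF.
  apply: (@le_trans _ _ (eps / 2 / (len e + M ^+ 2) * (len e + M ^+ 2))).
    apply: ler_wpM2l; first by rewrite !divr_ge0 ?(ltW eps0)// ltW.
    by rewrite lerD2l; apply: le_trans (dM n); exact: (part_itg_le_ip (delta (u n))).
  by rewrite divfK// gt_eqF.
have : (fun n => \sum_(e <- core_support p) \sum_(b : bool)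
    \int[lebesgue_measure]_(t in `[0, len e])
    (part b (l2_val (delta (u n)) e t) * part b (l2_val (delta p) e t))) @ \oo -->
    \sum_(e <- core_support p) \sum_(b : bool) (0 : R).
  apply: cvg_big => [|e _]; first exact: add_continuous.
  by apply: cvg_big => [|b _]; [exact: add_continuous|exact: edge_null].
rewrite big1; last by move=> e _; rewrite big1.
suff -> : (fun n => ip (delta (u n)) (delta p)) = (fun n => \sum_(e <- core_support p)
    l2_edge_ip e (delta (u n)) (delta p)) by [].
by apply/funext => n; exact: ip_core_deriv.
Qed.

(** The squared norm of the derivative of [u n] is its product with that of u n - u N, small by the
    Cauchy property, plus its product with that of the fixed [u N], which tends to 0 weakly. *)
Lemma core_closable u : h1_cauchy ip iota delta u ->
  (fun n => nx (iota (u n))) @ \oo --> (0 : R) ->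
  (fun n => nx (delta (u n))) @ \oo --> (0 : R).
Proof.
move=> cu iu0.
have [M M0 hM] := h1_cauchy_bounded psd_ip cu.
have [ipl _ _] := psd_ip.
apply/cvgrPdist_le => eps eps0.
have e1 : 0 < eps ^+ 2 / 2 / M by rewrite !divr_gt0 ?exprn_gt0.
have e2 : 0 < eps ^+ 2 / 2 by rewrite !divr_gt0 ?exprn_gt0.
have [N hN] := cu _ e1.
have /cvgrPdist_le/(_ _ e2) := core_weak_null (u N) cu iu0.
have : \forall n \near \oo, (N <= n)%N by exists N.
apply: filterS2 => n Nn; rewrite !sub0r !normrN => hn.
rewrite ger0_norm ?seminorm_ge0//.
rewrite -(ler_pXn2r (n := 2)) ?nnegrE ?seminorm_ge0 ?(ltW eps0)// (sqr_seminorm psd_ip).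
have -> : ip (delta (u n)) (delta (u n)) =
    ip (delta (u n)) (delta (u n - u N)) + ip (delta (u n)) (delta (u N)).
  by rewrite -(scalarD (ipl.2 _)) -linearD subrK.
rewrite [leRHS]splitr; apply: lerD; last exact: le_trans (ler_norm _) hn.
apply: le_trans (ler_norm _) _; apply: le_trans (form_le_h1 iota delta psd_ip _ _) _.
rewrite -[leRHS](divfK (x := M)) ?gt_eqF// mulrC.
apply: ler_pM; rewrite ?seminorm_ge0//; exact: hN.
Qed.

End CoreClosable.

(** * The Cheeger inequality on the form core *)

Section CoreCheeger.
Context {R : realType} (G : metric_graph R) (VD : set (vertex G)).
Implicit Types (e : edge G) (v : vertex G) (b : bool) (t : R) (p : core VD).

Local Notation ip := (@l2_ip R G).
Local Notation iota := (@core_fun R G VD).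
Local Notation delta := (@core_deriv R G VD).
Local Notation cfun p := (l2_val (iota p) : gfun G).
Local Notation cder p := (l2_val (delta p) : gfun G).

Lemma mass_core p : mass ip iota p p = \sum_(e <- core_support p) sq_norm (cfun p) e.
Proof.
rewrite /mass /l2_ip (gipE (l2P (iota p)) (l2P (iota p))); apply: real_sum_fset => e ep.
exact: sq_norm_support (coreP p) ep.
Qed.

Lemma form_core p : form ip delta p p = \sum_(e <- core_support p) sq_norm (cder p) e.
Proof. exact: ip_core_deriv. Qed.

Lemma end_value_src (f : gfun G) e : end_value f (src e) e = f e 0.
Proof. by rewrite /end_value eqxx. Qed.

Lemma end_value_tgt (f : gfun G) e : end_value f (tgt e) e = f e (len e).
Proof. by rewrite /end_value; case: eqP => // /no_loop. Qed.

Section Cheeger.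
Variables (S : set (edge G)) (D : set (vertex G)) (A : R).
Hypothesis A0 : 0 <= A.
Hypothesis isoperimetric : forall Y, conn_subgraphs S Y ->
  A * mes Y <= (deg_boundary S D Y)%:R.
Hypothesis VD_D : VD `<=` D.

(** Stated for an edge set [S] with Dirichlet set [D], so that it serves both G and G \ K; real and
    imaginary parts are treated separately. *)
Lemma core_cheeger p :
  (forall v e, D v -> S e -> incident v e -> end_value (cfun p) v e = 0) ->
  A ^+ 2 / 4 * (\sum_(e <- core_support p | `[< S e >]) sq_norm (cfun p) e) <=
    \sum_(e <- core_support p | `[< S e >]) sq_norm (cder p) e.
Proof.
move=> pD; have [A00|A00] := eqVneq A 0.
  by rewrite A00 expr0n mul0r mul0r; apply: sumr_ge0 => e _; exact: edge_ip_ge0.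
have Apos : 0 < A by rewrite lt_neqAle eq_sym A00.
rewrite big_fset_condE [leRHS]big_fset_condE /=; set F := [fset e in _ | _]%fset.
under eq_bigr do rewrite sq_normE; under [leRHS]eq_bigr do rewrite sq_normE.
rewrite exchange_big [leRHS]exchange_big mulr_sumr/=; apply: ler_sum => b _.
have hc e := dom_H0_c1 b e (coreP p).
have l0 e : 0 < len e := len_gt0 e.
have hcont e : {within `[0, len e], continuous (fun t => part b (cfun p e t))}.
  exact: (primitive_continuous (ltW (l0 e)) (hc e).1).
have hi e := continuous_square_integrable (hcont e).
have /choice[x hx] e : exists x, 0 <= x <= len e /\ forall t, 0 <= t <= len e ->
    part b (cfun p e t) ^+ 2 <= part b (cfun p e x) ^+ 2.
  have c2 : {within `[0, len e], continuous (fun t => part b (cfun p e t) ^+ 2)}.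
    rewrite (_ : (fun t => _) = fun t => part b (cfun p e t) * part b (cfun p e t))//.
    by move=> t; apply: continuousM; exact: hcont.
  have [x + xmax] := EVT_max (ltW (l0 e)) c2.
  rewrite in_itv/= => xl; exists x; split=> // t tl; exact: xmax.
pose M e := part b (cfun p e (x e)) ^+ 2.
(* The squared vertex value does not depend on the edge used to read it off: it is 0 on [D], and
   elsewhere continuity applies. Vertices without edges in [S] get the default 0. *)
have /choice[g hg] v : exists gv : R,
    (forall e, S e -> incident v e -> gv = part b (end_value (cfun p) v e) ^+ 2) /\
    ((forall e, S e -> ~ incident v e) -> gv = 0).
  have [[e [Se ev]]|nov] := pselect (exists e, S e /\ incident v e); last first.
    by exists 0; split => // e Se ev; case: nov; exists e.
  exists (part b (end_value (cfun p) v e) ^+ 2); split; last by move=> /(_ e Se).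
  move=> e' Se' ev'; congr (part b _ ^+ 2).
  have [Dv|nDv] := pselect (D v); first by rewrite !pD.
  have [_ _ _ [_ h]] := coreP p.
  by have [+ _] := h v (fun h => nDv (VD_D h)); apply.
have FS : [set` F] `<=` S by move=> e; rewrite /= !inE => /andP[_ /asboolP].
have inF e : S e -> e \notin F -> e \notin core_support p.
  by move=> Se; apply: contra => ep; rewrite !inE ep; apply/asboolP.
have zero_end e : 0 <= 0 <= len e by rewrite lexx ltW.
have len_end e : 0 <= len e <= len e by rewrite lexx ltW.
have disc := @discrete_cheeger R G S D A isoperimetric F M g FS
  (fun e _ => sqr_ge0 _).
have {}disc : A * (\sum_(e <- F) len e * M e) <=
    \sum_(e <- F) (2 * M e - g (src e) - g (tgt e)).
  apply: disc.
  - move=> e Se /(inF e Se) ep; have [xl _] := hx e.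
    rewrite /M (_ : cfun p e (x e) = 0); first by rewrite part0 expr0n.
    exact: notin_support (coreP p) ep _ xl.
  - move=> v; have [[e [Se ev]]|nov] := pselect (exists e, S e /\ incident v e).
      by rewrite ((hg v).1 e Se ev) sqr_ge0.
    by rewrite ((hg v).2 _)// => e Se ev; case: nov; exists e.
  - move=> v Dv; have [[e [Se ev]]|nov] := pselect (exists e, S e /\ incident v e).
      by rewrite ((hg v).1 e Se ev) (pD v e)// part0 expr0n.
    by rewrite ((hg v).2 _)// => e Se ev; case: nov; exists e.
  - move=> v e Se ev; rewrite ((hg v).1 e Se ev); have [_ h] := hx e.
    by case: ev => <-; rewrite ?end_value_src ?end_value_tgt; apply: h.
(* From A E0 <= s E0 + s^-1 E1 one gets s (A - s) E0 <= E1, which is best at s = A/2. *)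
pose s := A / 2; have s0 : 0 < s by rewrite divr_gt0.
pose E0 e := \int[lebesgue_measure]_(t in `[0, len e]) (part b (cfun p e t) ^+ 2).
pose E1 e := \int[lebesgue_measure]_(t in `[0, len e]) (part b (cder p e t) ^+ 2).
have up : \sum_(e <- F) (2 * M e - g (src e) - g (tgt e)) <=
    \sum_(e <- F) (s * E0 e + s^-1 * E1 e).
  rewrite big_seq [leRHS]big_seq; apply: ler_sum => e eF; have Se := FS e eF.
  rewrite ((hg (src e)).1 e)//; last by left.
  rewrite ((hg (tgt e)).1 e)//; last by right.
  rewrite end_value_src end_value_tgt; have [/andP[x0 xl] _] := hx e.
  exact: c1_cheeger_edge (hc e) x0 xl s0.
have low : A * (\sum_(e <- F) E0 e) <= A * (\sum_(e <- F) len e * M e).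
  apply: ler_wpM2l => //; apply: ler_sum => e _.
  by apply: (itg_sqr_le (ltW (l0 e)) (hi e).2) => t tl; have [_ h] := hx e; exact: h.
have := le_trans (le_trans low disc) up.
rewrite big_split/= -!mulr_sumr -/(E0 _) -/(E1 _) /s.
move: (\sum_(e <- F) E0 e) (\sum_(e <- F) E1 e) => a0 a1 h.
have /(ler_wpM2l (ltW s0)) : A / 2 * a0 <= (A / 2)^-1 * a1 by lra.
have -> : s * ((A / 2)^-1 * a1) = a1 by rewrite /s; field.
by apply: le_trans; rewrite le_eqVlt; apply/orP; left; apply/eqP; rewrite /s; field.
Qed.

End Cheeger.

Lemma core_gap (A : R) : 0 <= A ->
  (forall Y, conn_subgraphs setT Y -> A * mes Y <= (deg_boundary setT VD Y)%:R) ->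
  forall p, A ^+ 2 / 4 * mass ip iota p p <= form ip delta p p.
Proof.
move=> A0 iso p.
have := @core_cheeger setT VD A A0 iso (fun v => id) p.
have allE e : `[< [set: edge G] e >] = true by apply/asboolP.
rewrite !(eq_bigl _ _ allE) -mass_core -form_core; apply => v e vD _ ev.
by have [_ _ _ [h _]] := coreP p; exact: h.
Qed.

(** The zeros at k = 0 and k = n, with continuity at vertices, give the Dirichlet conditions needed
    off [K]. On [K], the Poincare factor len^2/n times A^2/4 is at most 1 by the choice of [n]. *)
Lemma core_gap_removed (K : finite_subgraph G) (A : R) (n : nat) : 0 <= A ->
  (forall Y, conn_subgraphs (~` [set` sub_E K]) Y -> A * mes Y <=
     (deg_boundary (~` [set` sub_E K])
       (VD `|` [set v | exists2 e, e \in sub_E K & incident v e]) Y)%:R) ->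
  (0 < n)%N -> (forall e, e \in sub_E K -> A ^+ 2 / 4 * len e ^+ 2 <= n%:R) ->
  forall p, (forall b e k, e \in sub_E K -> (k <= n)%N ->
      eval b e (k%:R * len e / n%:R) p = 0) ->
  A ^+ 2 / 4 * mass ip iota p p <= form ip delta p p.
Proof.
move=> A0 iso n0 hn p p0.
have n0' : n%:R != 0 :> R by rewrite pnatr_eq0 -lt0n.
have p_src e : e \in sub_E K -> cfun p e 0 = 0.
  move=> eK; apply: complex_eqP => b; have := p0 b e 0%N eK isT.
  by rewrite !mul0r /eval => ->; rewrite part0.
have p_tgt e : e \in sub_E K -> cfun p e (len e) = 0.
  move=> eK; apply: complex_eqP => b; have := p0 b e n eK (leqnn n).
  by rewrite mulrAC divff// mul1r /eval => ->; rewrite part0.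
have pD v e : (VD `|` [set v | exists2 e, e \in sub_E K & incident v e]) v ->
    (~` [set` sub_E K]) e -> incident v e -> end_value (cfun p) v e = 0.
  move=> Dv _ ev; have [_ _ _ [hD hc]] := coreP p.
  have [vD|nvD] := pselect (VD v); first exact: hD.
  case: Dv => [/nvD//|[e' e'K e'v]]; have [+ _] := hc v nvD => /(_ e e' ev e'v) ->.
  by case: e'v => <-; [rewrite end_value_src; exact: p_src|
    rewrite end_value_tgt; exact: p_tgt].
have off := core_cheeger A0 iso (@subsetUl _ _ _) pD.
rewrite mass_core form_core.
have SE e : `[< (~` [set` sub_E K]) e >] = (e \notin sub_E K).
  by apply/asboolP/idP => [/negP|/negP].
rewrite (bigID (fun e => e \in sub_E K)) [leRHS](bigID (fun e => e \in sub_E K))/=.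
rewrite mulrDr; apply: lerD; last by move: off; rewrite !(eq_bigl _ _ SE).
rewrite mulr_sumr; apply: ler_sum => e eK.
rewrite !sq_normE mulr_sumr; apply: ler_sum => b _.
have hp := dom_H0_primitive b e (coreP p).
have h := primitive_poincare (len_gt0 e) hp n0 (fun k kn => p0 b e k eK kn).
have c0 : 0 <= A ^+ 2 / 4 by rewrite divr_ge0 ?sqr_ge0.
have c1 : A ^+ 2 / 4 * (len e ^+ 2 / n%:R) <= 1.
  by rewrite mulrA ler_pdivrMr ?ltr0n// mul1r; exact: hn.
apply: le_trans (ler_wpM2l c0 h) _; rewrite mulrA -[leRHS]mul1r.
by apply: ler_wpM2r c1; apply: itg_ge0 => t _; exact: sqr_ge0.
Qed.

End CoreCheeger.

(** * The spectrum of the Kirchhoff Laplacian *)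

Section Bridge.
Context {R : realType} (G : metric_graph R) (VD : set (vertex G)).
Implicit Types (p : core VD) (U W : nat -> core VD) (x y : l2 G) (f g : gfun G).

Local Notation ip := (@l2_ip R G).
Local Notation iota := (@core_fun R G VD).
Local Notation delta := (@core_deriv R G VD).
Local Notation nx := (seminorm ip).
Local Notation nv := (seminorm (h1 ip iota delta)).
Local Notation psd_ip := (@psd_l2_ip R G).
Local Notation h1_limit := (h1_limit ip iota delta).
Local Notation h1_cauchy := (h1_cauchy ip iota delta).
Local Notation friedrichs := (friedrichs ip iota delta).
Local Notation fform := (form ip delta).
Local Notation mass := (mass ip iota).

Lemma norm2_gsub x y : norm2 (gsub (l2_val x : gfun G) (l2_val y)) = (nx (x - y) ^+ 2)%:E.
Proof. by rewrite gsubE norm2_gdiff. Qed.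

Lemma sqr_cvg0 (s : nat -> R) : (fun n => s n) @ \oo --> (0 : R) ->
  (fun n => s n ^+ 2) @ \oo --> (0 : R).
Proof.
move=> s0; rewrite -[X in _ --> X](mulr0 (0 : R)).
by under eq_fun do rewrite expr2; exact: cvgM.
Qed.

Lemma L2_cvgP (s : nat -> l2 G) x :
  L2_cvg (fun n => l2_val (s n) : gfun G) (l2_val x) <-> xlim ip s x.
Proof.
rewrite /L2_cvg /xlim; under eq_fun do rewrite norm2_gsub.
split=> [/fine_cvgP[_] h|h]; last by apply/fine_cvgP; split; [exact: nearW|exact: sqr_cvg0].
apply/cvgrPdist_le => eps eps0.
move/cvgrPdist_le : h => /(_ _ (exprn_gt0 2 eps0)); apply: filterS => n /=.
rewrite !sub0r !normrN !ger0_norm ?sqr_ge0 ?seminorm_ge0// ler_pXn2r ?nnegrE ?seminorm_ge0//.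
exact: ltW.
Qed.

Lemma form_approxP u u' f (fL : L2 f) : form_approx VD u u' f <->
  exists U, (forall n, core_val (U n) = (u n, u' n)) /\ h1_limit U (to_l2 fL).
Proof.
split=> [[uD u'c _ uf]|[U [UE [cU Uf]]]].
  pose U n := to_core (uD n); exists U; split=> //.
  have Uf : xlim ip (fun n => iota (U n)) (to_l2 fL) by apply/L2_cvgP.
  split=> // eps eps0.
  have e4 : 0 < eps / 4 by rewrite divr_gt0.
  have e2 : 0 < eps / 2 by rewrite divr_gt0.
  have [N _ hN] := (cvgrPdist_le _ _).1 Uf _ e4.
  have [N' hN'] := u'c _ (exprn_gt0 2 e2).
  exists (maxn N N') => m n; rewrite !geq_max => /andP[Nm N'm] /andP[Nn N'n].
  apply: le_trans (h1_le_iota_delta iota delta psd_ip _) _.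
  rewrite [leRHS]splitr !linearB; apply: lerD.
    have hn k : (N <= k)%N -> nx (iota (U k) - to_l2 fL) <= eps / 4.
      by move=> /hN /=; rewrite sub0r normrN ger0_norm ?seminorm_ge0.
    rewrite -(subrKA (to_l2 fL)); apply: le_trans (seminormD psd_ip _ _) _.
    rewrite -(opprB (iota (U n))) (seminormN psd_ip).
    by apply: le_trans (lerD (hn m Nm) (hn n Nn)) _; clear; lra.
  have := hN' m n N'm N'n; rewrite (norm2_gsub (delta (U m)) (delta (U n))) lte_fin.
  by rewrite ltr_pXn2r ?nnegrE ?seminorm_ge0 ?(ltW e2)// => /ltW.
have uE n : u n = l2_val (iota (U n)) by rewrite /= UE.
have u'E n : u' n = l2_val (delta (U n)) by rewrite /= UE.
split=> //.
- by move=> n; have := coreP (U n); rewrite UE.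
(* [norm2] is the square of the seminorm, hence the root; the factor 1/2 gives the strict
   inequality. *)
- move=> eps eps0; have q0 : 0 < Num.sqrt (eps / 2) by rewrite sqrtr_gt0 divr_gt0.
  have [N hN] := cU _ q0; exists N => m n Nm Nn.
  rewrite !u'E norm2_gsub lte_fin -linearB.
  have := le_trans (delta_le_h1 iota delta psd_ip _) (hN m n Nm Nn).
  rewrite -(ler_pXn2r (n := 2)) ?nnegrE ?seminorm_ge0 ?(ltW q0)//.
  have -> : Num.sqrt (eps / 2) ^+ 2 = eps / 2 by rewrite sqr_sqrtr// divr_ge0// ltW.
  by move=> /le_lt_trans; apply; rewrite ltr_pdivrMr// ltr_pMr// ltr1n.
- have -> : u = fun n => l2_val (iota (U n)) by apply/funext.
  exact: (L2_cvgP _ (to_l2 fL)).2 Uf.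
Qed.

Lemma form_dom_core p : form_dom VD (l2_val (iota p)).
Proof.
exists (fun=> (core_val p).1), (fun=> (core_val p).2).
apply/(form_approxP _ _ (l2P (iota p))); exists (fun=> p); split.
  by move=> _; exact: surjective_pairing.
split; first exact: h1_cauchy_cst psd_ip _.
rewrite (_ : to_l2 _ = iota p); first exact: xlim_cst psd_ip _.
exact/val_inj.
Qed.

Lemma core_mul_i_dom p : dom_H0 VD (gscale 'i%C ((core_val p).1 : gfun G))
  (gscale 'i%C ((core_val p).2 : gfun G)).
Proof.
have := dom_H0_linear 'i%C (coreP p) (dom_H0_zero VD).
have e f : gadd (gscale 'i%C f) gzero = gscale 'i%C f.
  by apply/funext => ?; apply/funext => ?; rewrite /gadd addr0.
by rewrite !e.
Qed.

Lemma core_funB p q : iota (p - q) = iota p - iota q. Proof. exact: linearB. Qed.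

Lemma core_derivB p q : delta (p - q) = delta p - delta q. Proof. exact: linearB. Qed.

Lemma mul_iB x y : mul_i (x - y) = mul_i x - mul_i y. Proof. exact: linearB. Qed.

Definition core_mul_i p : core VD := to_core (core_mul_i_dom p).

Lemma core_fun_mul_i p : iota (core_mul_i p) = mul_i (iota p).
Proof. exact/val_inj. Qed.

Lemma core_deriv_mul_i p : delta (core_mul_i p) = mul_i (delta p).
Proof. exact/val_inj. Qed.

Lemma core_h1E p : nv p = Num.sqrt (ip (iota p) (iota p) + ip (delta p) (delta p)).
Proof. by []. Qed.

Lemma core_formE p q : fform p q = ip (delta p) (delta q).
Proof. by []. Qed.

Lemma h1_core_mul_iB p q : nv (core_mul_i p - core_mul_i q) = nv (p - q).
Proof.
rewrite !core_h1E.
have -> : iota (core_mul_i p - core_mul_i q) = mul_i (iota (p - q)).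
  by rewrite !core_funB !core_fun_mul_i mul_iB.
have -> : delta (core_mul_i p - core_mul_i q) = mul_i (delta (p - q)).
  by rewrite !core_derivB !core_deriv_mul_i mul_iB.
by rewrite !mul_i_isometry.
Qed.

Lemma h1_limit_mul_i U x : h1_limit U x -> h1_limit (fun n => core_mul_i (U n)) (mul_i x).
Proof.
move=> [cU Ux]; split.
  move=> eps eps0; have [N hN] := cU _ eps0; exists N => m n Nm Nn.
  by rewrite h1_core_mul_iB; exact: hN.
have e : (fun n => nx (iota (core_mul_i (U n)) - mul_i x)) = (fun n => nx (iota (U n) - x)).
  by apply/funext => n; rewrite core_fun_mul_i -mul_iB /seminorm mul_i_isometry.
by rewrite /xlim e.
Qed.

Lemma cabs2_cvg0 (s : nat -> R[i]) (c : R[i]) :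
  (fun n => cabs2 (s n - c)) @ \oo --> (0 : R) <->
  (fun n => complex.Re (s n)) @ \oo --> complex.Re c /\
  (fun n => complex.Im (s n)) @ \oo --> complex.Im c.
Proof.
have sq_le (a b eps : R) : 0 < eps -> a ^+ 2 + b ^+ 2 <= eps ^+ 2 -> `|a| <= eps.
  move=> eps0 h; rewrite -(ler_pXn2r (n := 2)) ?nnegrE ?(ltW eps0)// real_normK ?num_real//.
  by apply: le_trans h; rewrite lerDl sqr_ge0.
have cE n : cabs2 (s n - c) = (complex.Re (s n) - complex.Re c) ^+ 2 +
    (complex.Im (s n) - complex.Im c) ^+ 2.
  by rewrite /cabs2; case: (s n) c => [? ?] [? ?].
under eq_fun do rewrite cE; split=> [h|[h1 h2]].
  split; apply/cvgrPdist_le => eps eps0;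
    move/cvgrPdist_le : h => /(_ _ (exprn_gt0 2 eps0)); apply: filterS => n;
    rewrite sub0r normrN distrC => /(le_trans (ler_norm _)).
    exact: sq_le.
  by rewrite addrC; exact: sq_le.
rewrite -[X in _ --> X](addr0 (0 : R)); apply: cvgD; apply: sqr_cvg0.
  by rewrite -[X in _ --> X](subrr (complex.Re c)); apply: cvgB => //; exact: cvg_cst.
by rewrite -[X in _ --> X](subrr (complex.Im c)); apply: cvgB => //; exact: cvg_cst.
Qed.

Let complete := @core_complete R G VD.
Let closable := @core_closable R G VD.

(** Two gaps are bridged: [kirchhoff] tests against the whole form domain and compares complex
    values. Real parts with core test functions suffice for one direction; for the other, the
    imaginary part at phi is the real part at i phi, and the form domain is stable under
    multiplication by i. *)
Lemma kirchhoffP x y : kirchhoff VD (l2_val x : gfun G) (l2_val y) <-> friedrichs x y.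
Proof.
have to_l2K z (zL : L2 (l2_val z : gfun G)) : to_l2 zL = z by exact/val_inj.
have approxE U z : h1_limit U z -> form_approx VD (fun n => l2_val (iota (U n)) : gfun G)
    (fun n => l2_val (delta (U n)) : gfun G) (l2_val z).
  move=> Uz; apply/(form_approxP _ _ (l2P z)); exists U; split; last by rewrite to_l2K.
  by move=> n; exact: surjective_pairing.
split=> [[[u [u' /(form_approxP _ _ (l2P x))[U [_ Ux]]]] _ xform]|[U Ux Uy]].
  rewrite to_l2K in Ux; exists U => // p.
  have [v [v' [w [w' [va wa vw]]]]] := xform _ (form_dom_core p).
  have /(form_approxP _ _ (l2P x))[V [VE]] := va; rewrite to_l2K => Vx.
  have /(form_approxP _ _ (l2P (iota p)))[W [WE]] := wa; rewrite to_l2K => Wp.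
  have p_lim : h1_limit (fun=> p) (iota p).
    by split; [exact: h1_cauchy_cst psd_ip _|exact: xlim_cst psd_ip _].
  have [re _] := (cabs2_cvg0 _ _).1 vw.
  have vE n : v' n = l2_val (delta (V n)) by rewrite /= VE.
  have wE n : w' n = l2_val (delta (W n)) by rewrite /= WE.
  have VW : (fun n => fform (V n) (W n)) @ \oo --> ip y (iota p).
    have -> : (fun n => fform (V n) (W n)) = fun n => complex.Re (dotp (v' n) (w' n)).
      by apply/funext => n; rewrite vE wE.
    exact: re.
  (* [closed_form] supplies sequences [V], [W] of its own; by [form_sub_null] they may be exchanged
     for [U] and the constant sequence [p]. *)
  have -> : (fun n => fform (U n) p) =
      (fun n => (fform (U n) p - fform (V n) (W n)) + fform (V n) (W n)).
    by apply/funext => n; rewrite subrK.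
  rewrite -[X in _ --> X]add0r; apply: cvgD => //.
  exact: (form_sub_null psd_ip closable Ux Vx p_lim Wp).
split.
- exists (fun n => l2_val (iota (U n)) : gfun G), (fun n => l2_val (delta (U n)) : gfun G).
  by apply: approxE; exact: Ux.
- exact: l2P.
move=> phi [w [w' wa]].
have phiL : L2 phi by case: wa.
have [W [WE Wphi]] := (form_approxP _ _ phiL).1 wa.
exists (fun n => l2_val (iota (U n)) : gfun G), (fun n => l2_val (delta (U n)) : gfun G), w, w'.
have fr : friedrichs x y := ex_intro2 _ _ U Ux Uy.
have wE n : w' n = l2_val (delta (W n)) by rewrite /= WE.
split; [by apply: approxE; exact: Ux|exact: wa|].
apply/cabs2_cvg0; split.
  have := friedrichs_form psd_ip closable fr Ux Wphi.
  have <- : (fun n => complex.Re (dotp (l2_val (delta (U n)) : gfun G) (w' n))) =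
      fun n => fform (U n) (W n).
    by apply/funext => n; rewrite wE.
  exact.
have := friedrichs_form psd_ip closable fr Ux (h1_limit_mul_i Wphi).
rewrite -(Im_dotp y (to_l2 phiL)).
have <- : (fun n => complex.Im (dotp (l2_val (delta (U n)) : gfun G) (w' n))) =
    fun n => fform (U n) (core_mul_i (W n)).
  by apply/funext => n; rewrite wE Im_dotp core_formE core_deriv_mul_i.
exact.
Qed.

Lemma kirchhoff_L2 f g : kirchhoff VD f g -> L2 f /\ L2 g.
Proof. by move=> [[u [u' [_ _ fL _]]] gL _]. Qed.

Lemma complex_mulE (s t : R) (z : Rcomplex R) :
  Complex s t * (z : R[i]) = s *: z + t *: ('i%C * (z : R[i]) : Rcomplex R) :> R[i].
Proof.
by case: z => a b; apply/eqP; rewrite eq_complex /=; apply/andP; split; apply/eqP; ring.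
Qed.

Lemma shiftedP (s t : R) x y :
  shifted (kirchhoff VD) (Complex s t) (l2_val x : gfun G) (l2_val y) <->
  friedrichs x (y + (s *: x + t *: mul_i x)).
Proof.
rewrite -kirchhoffP /shifted.
rewrite (_ : gadd _ _ = l2_val (y + (s *: x + t *: mul_i x)))//.
apply/funext => e; apply/funext => r; rewrite /gadd /gscale /=.
by congr (_ + _); exact: complex_mulE.
Qed.

Lemma shifted_L2 z f g : L2 g -> shifted (kirchhoff VD) z f g ->
  exists x y, f = l2_val x /\ g = l2_val y.
Proof.
move=> gL /kirchhoff_L2[fL _]; by exists (to_l2 fL), (to_l2 gL).
Qed.

Lemma resolvent_setP (s t : R) :
  (forall y, exists x, friedrichs x (y + (s *: x + t *: mul_i x))) ->
  (exists C : R, forall x y, friedrichs x (y + (s *: x + t *: mul_i x)) ->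
     ip x x <= C * ip y y) ->
  resolvent_set (kirchhoff VD) (Complex s t).
Proof.
move=> surj [C hC]; split.
  move=> g gL; have [x xy] := surj (to_l2 gL); exists (l2_val x).
  exact/(shiftedP s t x (to_l2 gL)).
exists C => f g gL fg; have [x [y [fx gy]]] := shifted_L2 gL fg.
rewrite fx gy in fg *; rewrite !l2_norm2 -EFinM lee_fin; apply: hC.
exact/shiftedP.
Qed.

End Bridge.

(** * Discreteness of the spectrum below a gap of finite codimension *)

Section SpectrumBelowGap.
Context {R : realType} (G : metric_graph R) (VD : set (vertex G)).
Implicit Types (p : core VD) (x y : l2 G) (s t : R).

Local Notation ip := (@l2_ip R G).
Local Notation iota := (@core_fun R G VD).
Local Notation delta := (@core_deriv R G VD).
Local Notation nx := (seminorm ip).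
Local Notation nv := (seminorm (h1 ip iota delta)).
Local Notation psd_ip := (@psd_l2_ip R G).
Local Notation friedrichs := (friedrichs ip iota delta).
Local Notation fform := (form ip delta).
Local Notation mass := (mass ip iota).

(** Testing the eigenvalue equation with i times the eigenvector: the form term has real part 0, and
    t times the squared norm remains. *)
Lemma eigenvector_real s t x : friedrichs x (s *: x + t *: mul_i x) -> ip x x != 0 -> t = 0.
Proof.
move=> fr x0; have [ipl sym _] := psd_ip.
have [U Ux] := friedrichs_limit fr.
have := friedrichs_form psd_ip (@core_closable R G VD) fr Ux (h1_limit_mul_i Ux).
have -> : (fun n => fform (U n) (core_mul_i (U n))) = (fun=> 0).
  by apply/funext => n; rewrite core_formE core_deriv_mul_i sym mul_i_skew.
have -> : ip (s *: x + t *: mul_i x) (mul_i x) = t * ip x x.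
  rewrite (scalarD (ipl.1 _)) !(scalar_scale (ipl.1 _)) sym mul_i_skew mulr0 add0r.
  by rewrite mul_i_isometry.
move=> h; have h0 : (fun _ : nat => 0 : R) @ \oo --> (0 : R) by exact: cvg_cst.
have : t * ip x x = 0 by rewrite (cvg_unique _ h h0).
by move=> /eqP; rewrite mulf_eq0 (negbTE x0) orbF => /eqP.
Qed.

Variables (N : nat) (l : 'I_N -> core VD -> R) (c : R).
Hypothesis l_scalar : forall j, scalar (l j).
Hypothesis l_bounded : forall j, exists K : R, forall p, `|l j p| <= K * nv p.
Hypothesis gap : forall p, (forall j, l j p = 0) -> c * mass p p <= fform p p.

Let codim : exists (r : nat) (e : 'I_r -> core VD) (a : 'I_r -> core VD -> R),
  [/\ forall i, scalar (a i), forall i, exists K : R, forall p, `|a i p| <= K * nv p,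
      forall i k, a i (e k) = (i == k)%:R &
      forall p, c * mass (proj e a p) (proj e a p) <= fform (proj e a p) (proj e a p)].
Proof.
have [r [e [a [aE ae al]]]] := finite_codim_projection l_scalar.
exists r, e, a; split=> // [i|i|p].
- have [d dE] := aE i; move=> k u v; rewrite !dE mulr_sumr -big_split/=.
  by apply: eq_bigr => j _; rewrite l_scalar; ring.
- have [d dE] := aE i; have /choice[K hK] := l_bounded.
  exists (\sum_j `|d j| * K j) => p; rewrite dE mulr_suml.
  apply: le_trans (ler_norm_sum _ _ _) _; apply: ler_sum => j _.
  by rewrite normrM -mulrA; apply: ler_wpM2l.
- by apply: gap => j; exact: al.
Qed.

Lemma spectrum_below_gap s t : `|t| < c - s ->
  spectrum (kirchhoff VD) (Complex s t) ->
  t = 0 /\ exists2 x, ip x x != 0 & friedrichs x (s *: x).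
Proof.
move=> ts spec; have [r [e [a [alin abd ae agap]]]] := codim.
have iso x : ip (mul_i x) (mul_i x) = ip x x by exact: mul_i_isometry.
have [[x x0 xe]|[surj bd]] := resolvent_alternative psd_ip iso (@mul_i_skew R G)
  (@core_complete R G VD) (@core_closable R G VD) alin abd ae agap ts.
  have t0 := eigenvector_real xe x0; split; first exact: t0.
  by apply: (ex_intro2 _ _ x x0); move: xe; rewrite t0 scale0r addr0.
by case: spec; exact: resolvent_setP.
Qed.

Lemma discrete_below_gap s : s < c -> spectrum (kirchhoff VD) (Complex s 0) ->
  discrete_spectrum (kirchhoff VD) (Complex s 0).
Proof.
move=> sc spec; have [r [e [a [alin abd ae agap]]]] := codim.
have [k [x [mu [[mu_c eig _] max]]]] := eigenfamily_maximal psd_ip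
  (@core_closable R G VD) alin abd agap.
have cs : 0 < c - s by rewrite subr_gt0.
have s0 : `|0 : R| < c - s by rewrite normr0.
have [_ [x0 x0n x0e]] := spectrum_below_gap s0 spec.
(* A radius that excludes all other eigenvalues of the maximal family; the cap (c - s)/2 keeps the
   disc inside the region |Im z| < c - Re z. *)
pose d := \big[Num.min/((c - s) / 2)]_(i < k | mu i != s) `|mu i - s|.
have d0 : 0 < d.
  by apply: lt_bigmin => [|i mis]; rewrite ?divr_gt0// normr_gt0 subr_eq0.
have dc : d <= (c - s) / 2 by exact: bigmin_le_id.
have dmu i : mu i != s -> d <= `|mu i - s| by move=> mis; exact: bigmin_le_cond.
split.
- split=> //; exists d => // -[a' b'] wspec; rewrite /cabs2 /= oppr0 addr0 => wd.
  have lt_d u v : u ^+ 2 + v ^+ 2 < d ^+ 2 -> `|u| < d.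
    move=> uvd; rewrite -(ltr_pXn2r (n := 2)) ?nnegrE ?(ltW d0)//.
    by rewrite real_normK ?num_real//; apply: le_lt_trans uvd; rewrite lerDl sqr_ge0.
  have a'd := lt_d _ _ wd; have b'd : `|b'| < d by rewrite addrC in wd; exact: lt_d wd.
  have b'c : `|b'| < c - a'.
    apply: lt_le_trans b'd _; move: a'd; rewrite ltr_norml => /andP[_ a'd]; lra.
  have [-> [y y0 ye]] := spectrum_below_gap b'c wspec.
  have [->//|a's] := eqVneq a' s.
  have a'c : a' < c by rewrite -subr_gt0; exact: le_lt_trans (normr_ge0 b') b'c.
  (* No [mu i] equals [a'], so maximality of the family would make the eigenvector [y] null. *)
  have := max a' y a'c ye; rewrite big_pred0 => [|i].
    by rewrite subr0 => /eqP; rewrite (negbTE y0).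
  apply/eqP => mia; have mis : mu i != s by rewrite mia.
  by have := dmu i mis; rewrite mia leNgt a'd.
- exists (l2_val x0 : gfun G); last first.
    by rewrite l2_norm2 => -[/eqP]; rewrite (negbTE x0n).
  rewrite /eigenspace/=; apply/(shiftedP VD s 0 x0 0).
  by rewrite scale0r addr0 add0r.
(* Members of the family for other eigenvalues are replaced by 0, which lies in every eigenspace;
   real coefficients already suffice. *)
- exists k, (fun i => l2_val (if mu i == s then x i else 0) : gfun G); split.
    move=> i; apply/(shiftedP VD s 0 _ 0); rewrite scale0r addr0 add0r.
    case: ifP => [/eqP <-|_]; [exact: eig|rewrite scaler0].
    exact: (friedrichs0 _ _ psd_ip).
  move=> f fe; have [x1 [y1 [fx gy]]] := shifted_L2 (L2_zero G) fe.
  have fr : friedrichs x1 (s *: x1).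
    have := (shiftedP VD s 0 x1 0).1; rewrite scale0r addr0 add0r; apply.
    by rewrite -fx.
  exists (fun i => (ip x1 (x i))%:C%C); have := max s x1 sc fr.
  set y := \sum_(i | _) _ => y0.
  rewrite (_ : (fun (e1 : edge G) (t1 : R) => _) = (l2_val y : gfun G)).
    by rewrite fx norm2_gsub (sqr_seminorm psd_ip) y0.
  apply/funext => e1; apply/funext => t1.
  pose val_at (z : l2 G) : R[i] := (l2_val z : gfun G) e1 t1.
  have val_atD z w : val_at (z + w) = val_at z + val_at w by [].
  have val_at0 : val_at 0 = 0 by [].
  rewrite -/(val_at y) /y (big_morph _ val_atD val_at0).
  rewrite [RHS]big_mkcond; apply: eq_bigr => i _; case: ifP => _.
    by rewrite /val_at -scaleRc.
  exact: mulr0.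
Qed.

End SpectrumBelowGap.

(** * Isoperimetric constants as extended reals *)

Section IsoperimetricConstants.
Context {R : realType}.
Implicit Types (x A : R) (a : \bar R).

Lemma real_between x a : (x%:E < a)%E -> exists2 A, x < A & (A%:E < a)%E.
Proof.
case: a => [r|_|//]; last by exists (x + 1); rewrite ?ltrDl ?ltry.
by rewrite lte_fin => xr; exists ((x + r) / 2); rewrite ?lte_fin ?midf_lt.
Qed.

(* The alternative [A = 0] is needed when [a = 0], where [x < 0]. *)
Lemma lt_quarter_sqr x a : (0 <= a)%E -> (x%:E < (4^-1)%:E * a ^+ 2)%E ->
  exists A, [/\ 0 <= A, x < A ^+ 2 / 4 & A = 0 \/ (A%:E < a)%E].
Proof.
move=> a0; have [x0 _|x0 xa] := ltP x 0.
  by exists 0; split; rewrite ?expr0n ?mul0r//; left.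
have s0 : 0 <= 2 * Num.sqrt x by rewrite mulr_ge0 ?sqrtr_ge0.
have [|A sA Aa] := @real_between (2 * Num.sqrt x) a.
  rewrite ltNge; apply/negP => as_; move: xa; rewrite ltNge => /negP; apply.
  case: a a0 as_ => [r| |]//; rewrite !lee_fin => r0 rs.
  rewrite -expr2 ler_pdivrMl//.
  have := lerXn2r 2 r0 s0 rs; rewrite exprMn sqr_sqrtr// => h.
  by apply: le_trans h _; rewrite expr2 -natrM.
exists A; split; [exact: le_trans s0 (ltW sA) | | by right].
rewrite ltr_pdivlMr// -[x in x * _](sqr_sqrtr x0).
have := sA; rewrite -(ltr_pXn2r (n := 2)) ?nnegrE//; last exact: le_trans s0 (ltW sA).
by rewrite exprMn [X in X * _]expr2 -natrM mulrC.
Qed.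

Context (G : metric_graph R).
Implicit Types (S : set (edge G)) (D VD : set (vertex G)) (Y K : finite_subgraph G).

Lemma mes_gt0 S Y : conn_subgraphs S Y -> 0 < mes Y.
Proof.
case=> /fset0Pn[e eY] _ _; rewrite /mes (big_fsetD1 e)//=.
by rewrite ltr_wpDr ?len_gt0// sumr_ge0// => e' _; rewrite ltW// len_gt0.
Qed.

Lemma alpha_in_ge0 S D : (0 <= alpha_in S D)%E.
Proof.
apply: le_ereal_inf_tmp => _ [Y SY <-].
by rewrite lee_fin divr_ge0// ltW// (mes_gt0 SY).
Qed.

Lemma alpha_in_isoperimetric S D A Y : (A%:E <= alpha_in S D)%E ->
  conn_subgraphs S Y -> A * mes Y <= (deg_boundary S D Y)%:R.
Proof.
move=> Aa SY; rewrite -ler_pdivlMr ?(mes_gt0 SY)// -lee_fin.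
by apply: le_trans Aa _; apply: ereal_inf_lbound; exists Y.
Qed.

Lemma exists_edge : exists e : edge G, True.
Proof.
have [u _] := infinite_setN0 (@infinite_graph R G).
apply: contrapT => noe; apply: (@infinite_graph R G).
apply: (@sub_finite_set _ _ [set u]); last exact: finite_set1.
move=> v _ /=; elim: (connected_graph u v) => //= [a b [e _ _]|a b c _ -> _ ->//].
by case: noe; exists e.
Qed.

Lemma exists_conn_subgraph : exists K, conn_subgraphs [set: edge G] K.
Proof.
have [e _] := exists_edge.
have [Y [_ _ [Y0 _ Yc] _]] := component_subgraph (fset11 e).
by exists Y; split.
Qed.

(** The supremum must range over a nonempty family: over an empty one it would be -oo, whose square
    is +oo. *)
Lemma alpha_ess_ge0 VD : (0 <= alpha_ess VD)%E.
Proof.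
have [K hK] := exists_conn_subgraph.
apply: (le_trans (alpha_in_ge0 (~` [set` sub_E K])
  (VD `|` [set v | exists2 e, e \in sub_E K & incident v e]))).
by apply: ereal_sup_ubound; exists K.
Qed.

End IsoperimetricConstants.

Section KirchhoffCheeger.
Context {R : realType} (G : metric_graph R) (VD : set (vertex G)).

Local Notation ip := (@l2_ip R G).
Local Notation iota := (@core_fun R G VD).
Local Notation delta := (@core_deriv R G VD).

(** The case of no constraints. A spectral point below [c] would be an eigenvalue, and the gap
    inequality, passed to the limit at its eigenvector, excludes that. *)
Lemma spectrum_ge (c s : R) :
  (forall p, c * mass ip iota p p <= form ip delta p p) ->
  spectrum (kirchhoff VD) s%:C%C -> c <= s.
Proof.
move=> gap spec; rewrite leNgt; apply/negP => sc.
have t0 : `|0 : R| < c - s by rewrite normr0 subr_gt0.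
have l0 (j : 'I_0) : scalar (fun _ : core VD => 0 : R) by case: j.
have b0 (j : 'I_0) : exists K : R, forall p : core VD,
  `|0 : R| <= K * seminorm (h1 ip iota delta) p by case: j.
have [_ [x x0 fr]] := spectrum_below_gap l0 b0 (fun p _ => gap p) t0 spec.
have psd_ip := @psd_l2_ip R G; have [U Ux] := friedrichs_limit fr.
have hform := friedrichs_form psd_ip (@core_closable R G VD) fr Ux Ux.
have hmass := ip_cvg psd_ip Ux.2 Ux.2.
have : c * ip x x <= ip (s *: x) x.
  have hc : (fun n => c * mass ip iota (U n) (U n)) @ \oo --> c * ip x x.
    by apply: cvgM; [exact: cvg_cst|exact: hmass].
  by apply: (ler_cvg_to hc hform); apply: nearW => n; exact: gap.
have [ipl _ ip0] := psd_ip; rewrite (scalar_scale (ipl.1 _)).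
by rewrite ler_pM2r ?leNgt ?sc// lt_neqAle eq_sym x0; exact: ip0.
Qed.

Lemma essential_spectrum_ge (K : finite_subgraph G) (A s : R) : 0 <= A ->
  (A%:E <= alpha_removed VD K)%E ->
  essential_spectrum (kirchhoff VD) s%:C%C -> A ^+ 2 / 4 <= s.
Proof.
move=> A0 AK [spec]; rewrite leNgt => ess; apply/negP => sA; apply: ess.
pose B := \sum_(e <- sub_E K) A ^+ 2 / 4 * len e ^+ 2.
have term0 (e : edge G) : 0 <= A ^+ 2 / 4 * len e ^+ 2 by rewrite mulr_ge0 ?divr_ge0 ?sqr_ge0.
(* The sum [B] dominates the requirement of every edge of [K] at once; the successor makes [n]
   positive. *)
pose n := (Num.bound B).+1.
have hn e : e \in sub_E K -> A ^+ 2 / 4 * len e ^+ 2 <= n%:R.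
  move=> eK; apply: (@le_trans _ _ B).
    by rewrite /B (big_fsetD1 e)//= lerDl sumr_ge0// => e' _; exact: term0.
  have B0 : 0 <= B by rewrite sumr_ge0// => e' _; exact: term0.
  by apply: ltW; apply: lt_trans (archi_boundP B0) _; rewrite ltr_nat.
(* One real constraint for each part, edge of [K] and grid point; there are n + 1 grid points, since
   both ends of an edge count. *)
pose I := (bool * sub_E K * 'I_n.+1)%type.
pose point (i : I) : R := i.2%:R * len (val i.1.2) / n%:R.
have point_in (i : I) : 0 <= point i <= len (val i.1.2).
  have l0 := ltW (len_gt0 (val i.1.2)); have n0 : 0 < n%:R :> R by rewrite ltr0n.
  rewrite /point divr_ge0 ?mulr_ge0//= ler_pdivrMr// mulrC ler_wpM2l// ler_nat.
  by rewrite -ltnS ltn_ord.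
pose l (j : 'I_#|{: I}|) : core VD -> R :=
  let i := enum_val j in eval i.1.1 (val i.1.2) (point i).
apply: (@discrete_below_gap R G VD _ l (A ^+ 2 / 4)) => //.
- by move=> j; exact: eval_scalar.
- move=> j; have [C C0 hC] := @eval_bounded R G VD (val (enum_val j).1.2).
  by exists C => p; apply: hC; exact: point_in.
- move=> p p0; apply: (core_gap_removed (n := n) A0 _ _ hn) => //.
    by move=> Y; exact: alpha_in_isoperimetric.
  move=> b e k eK kn; have kn' : (k < n.+1)%N by [].
  have := p0 (enum_rank ((b, [` eK]%fset, Ordinal kn') : I)).
  by rewrite /l enum_rankK.
Qed.

End KirchhoffCheeger.

Theorem theorem3p4 (R : realType) (G : metric_graph R) (VD : set (vertex G))
    (ell_finite : (ell_sup G < +oo)%E)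
    (deg_ne2 : forall v : vertex G, degree v <> 2%N)
    (VD_deg1 : forall v : vertex G, VD v -> degree v = 1%N) :
  ((4^-1)%:E * alpha VD ^+ 2 <= lambda0 VD)%E /\
  ((4^-1)%:E * alpha_ess VD ^+ 2 <= lambda0_ess VD)%E.
Proof.
have gap0 (p : core VD) : 0 ^+ 2 / 4 * mass (@l2_ip R G) (core_fun (VD := VD)) p p <=
    form (@l2_ip R G) (core_deriv (VD := VD)) p p.
  by rewrite expr0n mul0r mul0r form_core sumr_ge0// => e _; exact: edge_ip_ge0.
split; apply: le_ereal_inf_tmp => _ [s spec <-]; rewrite leNgt; apply/negP => sa.
- have [A [A0 sA Aa]] := lt_quarter_sqr (alpha_in_ge0 setT VD) sa.
  have : A ^+ 2 / 4 <= s.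
    apply: spectrum_ge spec; case: Aa => [->|Aa]; first exact: gap0.
    by apply: core_gap => // Y; apply: alpha_in_isoperimetric; exact: ltW.
  by rewrite leNgt sA.
- have [A [A0 sA Aa]] := lt_quarter_sqr (alpha_ess_ge0 VD) sa.
  have : A ^+ 2 / 4 <= s.
    (* The supremum need not be attained, but [A] lies strictly below it, so a single [K] does. For
       A = 0 the nonnegativity of the form is enough. *)
    case: Aa => [A00|/ereal_sup_gt[_ [K _ <-] AK]].
      by rewrite A00; apply: spectrum_ge gap0 _; case: spec.
    exact: essential_spectrum_ge A0 (ltW AK) spec.
  by rewrite leNgt sA.
Qed.
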